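(* Let $(M,*,\mathfrak g,\mathbf J,C)$ be a Hamiltonian quantum $\mathfrak g$-space with regular constraint surface, $(M,\omega)$ symplectic, with maps $\mathrm{prol},h$ fixed as in the context. (i) The map $$\hat{\mathbf h}':=\tfrac12\hat{\mathbf h}\big(\mathrm{id}+\tfrac12(\hat{\boldsymbol\delta}\hat{\mathbf h}+\hat{\mathbf h}\hat{\boldsymbol\delta})\big)^{-1}$$ is a homotopy for $\hat{\mathcal D}_{\mathrm S}$, i.e. $\hat{\mathcal D}_{\mathrm S}\hat{\mathbf h}'+\hat{\mathbf h}'\hat{\mathcal D}_{\mathrm S}=\mathrm{id}$. The $\mathbb C[[\lambda]]$-linear map $$\boldsymbol\Psi:\mathbf H^{(\bullet)}_{\mathrm{BRST}}(\mathcal A[[\lambda]])\to\mathbf H^\bullet_{\mathrm{CE}}(\mathfrak g,C^\infty(C)[[\lambda]]),\quad[a]\mapsto[\boldsymbol\iota^*a]$$ is an isomorphism with inverse $$\boldsymbol\Psi^{-1}:[c]\mapsto[2\hat{\mathbf h}'c]=\sum_{k=0}^n\big(-\tfrac12\big)^k\big[(\mathbf h\boldsymbol\delta)^k\,\mathrm{prol}\,c\big].$$ (ii) The isomorphism $\boldsymbol\Psi$ turns $\mathbf H^\bullet_{\mathrm{CE}}(\mathfrak g,C^\infty(C)[[\lambda]])$ into a $\mathbb Z$-graded associative algebra with unit, whose multiplication is, for representatives $c_1,c_2\in\bigwedge\mathfrak g^*\otimes C^\infty(C)[[\lambda]]$, $$[c_1]*[c_2]=4\big[\boldsymbol\iota^*\big((\hat{\mathbf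 h}'c_1)\star_{\mathrm S}(\hat{\mathbf h}'c_2)\big)\big].$$ (iii) The homomorphism $L:\mathbf H^0_{\mathrm{BRST}}(\mathcal A[[\lambda]])\to\boldsymbol{\mathcal B}_C/\boldsymbol{\mathcal I}_C$, which sends $[\phi]$ with $\phi=\sum_{i=0}^n\phi_i$, $\phi_i\in\mathcal A^{i,i}[[\lambda]]$, $\mathcal D_{\mathrm S}\phi=0$, to $\phi_0\bmod\boldsymbol{\mathcal I}_C$, is an isomorphism of associative algebras. (iv) For $c_1,c_2\in\mathbf H^0_{\mathrm{CE}}(\mathfrak g,C^\infty(C)[[\lambda]])=(C^\infty(C)[[\lambda]])^{\mathfrak g}$ (invariants of $\boldsymbol\varrho_C$) the multiplication simplifies to $$c_1*c_2=\boldsymbol\iota^*\big((\mathrm{prol}\,c_1)\star_{\mathrm S}(\mathrm{prol}\,c_2)\big).$$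
   Context: Setting. $(M,\omega)$ is a symplectic manifold with Poisson bracket $\{f,g\}=\omega(X_f,X_g)$, $i_{X_f}\omega=df$; functions are complex-valued. A star product $*$ is a $\mathbb C[[\lambda]]$-bilinear associative product $f*g=\sum_r\lambda^rC_r(f,g)$ on $C^\infty(M)[[\lambda]]$, $C_r$ bidifferential, $C_0(f,g)=fg$, $C_1(f,g)-C_1(g,f)=i\{f,g\}$, $C_r$ ($r\ge1$) vanishing on constants. $\mathfrak g$: real Lie algebra, $\dim\mathfrak g=n$, basis $e_a$, dual basis $e^a$, $[e_a,e_b]=\sum_cf^c{}_{ab}e_c$. Hamiltonian quantum $\mathfrak g$-space $(M,*,\mathfrak g,\mathbf J)$: $\mathbf J=J+O(\lambda)$ is a formal series of smooth maps $M\to\mathfrak g^*$, $J$ a classical momentum map ($\{\langle J,\xi\rangle,\langle J,\eta\rangle\}=\langle J,[\xi,\eta]\rangle$), and $\langle\mathbf J,\xi\rangle*\langle\mathbf J,\eta\rangle-\langle\mathbf J,\eta\rangle*\langle\mathbf J,\xi\rangle=i\lambda\langle\mathbf J,[\xi,\eta]\rangle$. Regular constraint surface: $0$ is a regular value of $J$ and $C=J^{-1}(\{0\})\neq\emptyset$; $\iota:C\to M$ is the inclusion. Write $J_a=\langle J,e_a\rangle$, $\mathbf J_a=\langle\mathbf J,e_a\rangle$, $\boldsymbol\varrho_M(\xi)f=\frac1{i\lambda}(\langle\mathbf J,\xi\rangle*f-f*\langle\mathbf J,\xi\rangle)$. Quantum BRST algebra. $\mathcal A^{k,l}=\bigwedge^k\mathfrak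 g^*\otimes\bigwedge^l\mathfrak g\otimes C^\infty(M)$, $\mathcal A=\bigoplus\mathcal A^{k,l}$, $\mathcal A^{(m)}=\bigoplus_{k-l=m}\mathcal A^{k,l}$. Left insertions on $\bigwedge\mathfrak g^*\otimes\bigwedge\mathfrak g\cong\bigwedge(\mathfrak g^*\oplus\mathfrak g)$: $i(X)(\alpha\otimes\xi)=(i(X)\alpha)\otimes\xi$ for $X\in\mathfrak g$, $i(\beta)(\alpha\otimes\xi)=(-1)^k\alpha\otimes i(\beta)\xi$ for $\beta\in\mathfrak g^*$, $\alpha\in\bigwedge^k\mathfrak g^*$; right insertion $j(v)a=-(-1)^mi(v)a$ for $a$ of degree $m$. $(a\otimes F)\star_{\mathrm S}(b\otimes G)=\mu\big(e^{2i\lambda P^*}(a\otimes b)\big)\otimes(F*G)$ with $P^*=\sum_aj(e^a)\otimes i(e_a)$ and $\mu$ the $\wedge$-product. $\Theta_{\mathrm S}=\Omega+\mathbf J+i\lambda\chi$ with $\Omega=-\frac14\sum f^c{}_{ab}e^a\wedge e^b\wedge e_c$, $\mathbf J=\sum_ae^a\otimes\mathbf J_a$, $\chi(\xi)=\frac12\operatorname{tr}\operatorname{ad}(\xi)$. The standard ordered BRST operator $\mathcal D_{\mathrm S}=\frac1{i\lambda}[\Theta_{\mathrm S},\cdot]_{\star_{\mathrm S}}$ (super-commutator) is an odd super-derivation of $\star_{\mathrm S}$ of square zero raising ghost number $m$ by one, and equals $\boldsymbol\delta+2\boldsymbol\partial$, with: $\boldsymbol\delta$ the Chevalley-Eilenberg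 differential of $\mathfrak g$ with values in $\bigwedge\mathfrak g\otimes C^\infty(M)[[\lambda]]$ with representation $\operatorname{ad}(\xi)\otimes\mathrm{id}+\mathrm{id}\otimes\boldsymbol\varrho_M(\xi)$ (for a $\mathfrak g$-module $(Q,\rho)$ the Chevalley-Eilenberg differential is $\alpha\otimes q\mapsto-\frac12\sum f^c{}_{ab}e^a\wedge e^b\wedge i(e_c)\alpha\otimes q+\sum_ae^a\wedge\alpha\otimes\rho(e_a)q$); and, for $\alpha\in\bigwedge^k\mathfrak g^*$, $\xi=\xi_1\wedge\cdots\wedge\xi_l$, $\boldsymbol\partial(\alpha\wedge\xi\otimes F)=(-1)^k\alpha\wedge\big[\sum_ai(e^a)\xi\otimes F*\mathbf J_a+i\lambda\,i(\chi)\xi\otimes F-i\lambda\sum_{i<j}(-1)^{i+j-1}[\xi_i,\xi_j]\wedge\xi_1\wedge\cdots\widehat{\xi_i}\cdots\widehat{\xi_j}\cdots\wedge\xi_l\otimes F\big]$. $\boldsymbol\partial_i$ is the restriction of $\boldsymbol\partial$ to $\mathcal A^{\bullet,i}[[\lambda]]$. $\mathbf H^{(\bullet)}_{\mathrm{BRST}}(\mathcal A[[\lambda]])=\ker\mathcal D_{\mathrm S}/\operatorname{im}\mathcal D_{\mathrm S}$ with product $[a]\star_{\mathrm S}[b]=[a\star_{\mathrm S}b]$. Ideals. $\boldsymbol{\mathcal I}_C=\boldsymbol\partial(\mathcal A^{0,1}[[\lambda]])\subset C^\infty(M)[[\lambda]]$ (a left ideal), $\boldsymbol{\mathcal B}_C=\{f:f*g-g*f\in\boldsymbol{\mathcal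 I}_C\ \forall g\in\boldsymbol{\mathcal I}_C\}$ (a subalgebra in which $\boldsymbol{\mathcal I}_C$ is a two-sided ideal). Augmentation and homotopies. Classical Koszul operator: $\partial(\alpha\otimes x\otimes F)=(-1)^k\sum_a\alpha\otimes i(e^a)x\otimes J_aF$, with restriction $\partial_i$ to $\mathcal A^{\bullet,i}$. Fix linear maps $\mathrm{prol}:C^\infty(C)\to C^\infty(M)$, $h_i:\bigwedge^i\mathfrak g\otimes C^\infty(M)\to\bigwedge^{i+1}\mathfrak g\otimes C^\infty(M)$ with $\iota^*\mathrm{prol}=\mathrm{id}$, $\mathrm{prol}\,\iota^*+\partial_1h_0=\mathrm{id}$, $h_{i-1}\partial_i+\partial_{i+1}h_i=\mathrm{id}$ ($i\ge1$), $h_0\,\mathrm{prol}=0$ (such maps exist). Extend $\iota^*,\mathrm{prol},h$ to $\bigwedge\mathfrak g^*\otimes(\cdot)$ by $\alpha\otimes x\mapsto(-1)^k\alpha\otimes(\cdot)x$, $\alpha\in\bigwedge^k\mathfrak g^*$, and $\mathbb C[[\lambda]]$-linearly. Put $B_1=\frac1\lambda(\partial_1-\boldsymbol\partial_1)$, $\boldsymbol\iota^*=\iota^*(\mathrm{id}-\lambda B_1h_0)^{-1}$ on $\mathcal A^{\bullet,0}[[\lambda]]$ (and $\boldsymbol\iota^*=0$ on $\mathcal A^{\bullet,l}[[\lambda]]$, $l>0$), $\mathbf h_0=h_0(\mathrm{id}-\lambda B_1h_0)^{-1}$, $\mathbf h_i=h_i(h_{i-1}\boldsymbol\partial_i+\boldsymbol\partial_{i+1}h_i)^{-1}$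 ($i\ge1$). $\boldsymbol\varrho_C(\xi)=\boldsymbol\iota^*\boldsymbol\varrho_M(\xi)\mathrm{prol}$ is a representation of $\mathfrak g$ on $C^\infty(C)[[\lambda]]$; $\boldsymbol\delta^c$ is its Chevalley-Eilenberg differential on $\bigwedge\mathfrak g^*\otimes C^\infty(C)[[\lambda]]$, with cohomology $\mathbf H^\bullet_{\mathrm{CE}}(\mathfrak g,C^\infty(C)[[\lambda]])$. On $\hat{\mathcal A}[[\lambda]]=(\bigwedge\mathfrak g^*\otimes C^\infty(C)[[\lambda]])\oplus\mathcal A[[\lambda]]$ set $\hat{\boldsymbol\delta}=\boldsymbol\delta^c+\boldsymbol\delta$, $\hat{\mathbf h}=\mathrm{prol}+\mathbf h$, $\hat{\mathcal D}_{\mathrm S}=\boldsymbol\delta^c+2\boldsymbol\iota^*+\mathcal D_{\mathrm S}$ (each map being zero where not previously defined). *)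

(* Defs.v *)
From HB Require Import structures.
From mathcomp Require Import all_boot all_order all_algebra.
From mathcomp Require Import complex.
From mathcomp Require Import all_classical all_reals all_analysis.

Set Implicit Arguments.
Unset Strict Implicit.
Unset Printing Implicit Defensive.
Import Order.TTheory GRing.Theory Num.Theory.
Import numFieldNormedType.Exports.
Local Open Scope classical_set_scope.
Local Open Scope ring_scope.

Local Notation Re := (@complex.Re _).
Local Notation Im := (@complex.Im _).

Section Smooth.
Variables (R : realType) (m : nat).
Implicit Types (U : set 'rV[R]_m) (f g : 'rV[R]_m -> R) (c : 'rV[R]_m -> R[i]).

Definition pder (i : 'I_m) f : 'rV[R]_m -> R := fun x => 'D_('e_i) f x.

Definition pders (s : seq 'I_m) f : 'rV[R]_m -> R := foldr pder f s.

(* All iterated partial derivatives exist and are continuous on [U]; only used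
   for open [U]. *)
Definition smooth_on U f : Prop :=
  forall (s : seq 'I_m) (x : 'rV[R]_m), U x ->
    {for x, continuous (pders s f)} /\
    forall i : 'I_m, derivable (pders s f) x 'e_i.

Definition csmooth_on U c : Prop :=
  smooth_on U (Re \o c) /\ smooth_on U (Im \o c).

Definition cpders (s : seq 'I_m) c : 'rV[R]_m -> R[i] :=
  fun x => Complex (pders s (Re \o c) x) (pders s (Im \o c) x).

Fixpoint Ck U (k : nat) f : Prop :=
  (forall x, U x -> {for x, continuous f}) /\
  if k is k'.+1 then
    forall i, (forall x, U x -> derivable f x 'e_i) /\ Ck U k' (pder i f)
  else True.

Lemma CkW U k f : Ck U k.+1 f -> Ck U k f.
Proof.
elim: k f => [|k IH] f; first by move=> [cf _].
by move=> [cf df]; split => // i; have [? ?] := df i; split => //; exact: IH.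
Qed.

Lemma smooth_onP U f : smooth_on U f <-> forall k, Ck U k f.
Proof.
split.
  move=> sf k; elim: k f sf => [|k IH] f sf /=; split => //.
  - by move=> x Ux; have [] := sf [::] x Ux.
  - by move=> x Ux; have [] := sf [::] x Ux.
  - move=> i; split; first by move=> x Ux; have [_] := sf [::] x Ux; apply.
    apply: IH => s x Ux; have := sf (rcons s i) x Ux.
    by rewrite /pders foldr_rcons.
move=> cf s; elim/last_ind: s f cf => [|s i IH] f cf x Ux.
  have [c0 d0] := cf 1%N; split; first exact: c0.
  by move=> i; have [d _] := d0 i; exact: d.
have := IH (pder i f) _ x Ux; rewrite /pders foldr_rcons; apply => k.
by have [_ /(_ i)[]] := cf k.+1.
Qed.

Lemma continuous_at_near_eq f g x : (\near x, f x = g x) ->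
  {for x, continuous f} -> {for x, continuous g}.
Proof.
move=> fg cf; change (g @ x --> g x); rewrite -(nbhs_singleton fg).
exact: cvg_trans (near_eq_cvg fg) cf.
Qed.

Lemma Ck_eq U k f g : open U -> (forall x, U x -> f x = g x) ->
  Ck U k f -> Ck U k g.
Proof.
move=> oU; elim: k f g => [|k IH] f g fg Cf.
all: have nfg x : U x -> \near x, f x = g x
  by move=> Ux; apply: (filterS fg); exact: open_nbhs_nbhs.
all: have cg x : U x -> {for x, continuous g} by move=> Ux;
  apply: (continuous_at_near_eq (nfg x Ux)); exact: Cf.1.
- by split.
- split => // i; have [di ci] := Cf.2 i; split.
    move=> x Ux; apply: (near_eq_derivable _ (di x Ux)); exact: nfg.
  apply: IH ci => x Ux; apply: near_eq_derive; exact: nfg.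
Qed.

Lemma Ck_cst U k (a : R) : Ck U k (cst a).
Proof.
elim: k a => [|k IH] a.
  by split => // x _; exact: (@cst_continuous _ _ a _).
split; first by move=> x _; exact: (@cst_continuous _ _ a _).
move=> i; split; first by move=> x _; exact: (@derivable_cst _ _ _ a x 'e_i).
suff -> : pder i (cst a) = cst 0 by exact: IH.
by apply/funext => x; rewrite /pder derive_cst.
Qed.

Lemma Ck_add U k f g : open U -> Ck U k f -> Ck U k g -> Ck U k (f \+ g).
Proof.
move=> oU; elim: k f g => [|k IH] f g [cf df] [cg dg].
  by split => // x Ux; exact: (cvgD (cf x Ux) (cg x Ux)).
split; first by move=> x Ux; exact: (cvgD (cf x Ux) (cg x Ux)).
move=> i; have [dfi cfi] := df i; have [dgi cgi] := dg i.
split; first by move=> x Ux; exact: (derivableD (dfi x Ux) (dgi x Ux)).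
apply: (Ck_eq oU _ (IH _ _ cfi cgi)) => x Ux.
by rewrite /pder (deriveD (dfi _ Ux) (dgi _ Ux)).
Qed.

Lemma Ck_mul U k f g : open U -> Ck U k f -> Ck U k g -> Ck U k (f \* g).
Proof.
move=> oU; elim: k f g => [|k IH] f g Cf Cg.
  case: Cf Cg => [cf df] [cg dg].
  by split => // x Ux; exact: (cvgM (cf x Ux) (cg x Ux)).
have Cf' := CkW Cf; have Cg' := CkW Cg.
case: Cf Cg => [cf df] [cg dg].
split; first by move=> x Ux; exact: (cvgM (cf x Ux) (cg x Ux)).
move=> i; have [dfi cfi] := df i; have [dgi cgi] := dg i.
split; first by move=> x Ux; exact: (derivableM (dfi x Ux) (dgi x Ux)).
apply: (Ck_eq oU _ (Ck_add oU (IH _ _ Cf' cgi) (IH _ _ Cg' cfi))) => x Ux.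
by rewrite /pder (deriveM (dfi _ Ux) (dgi _ Ux)).
Qed.

Lemma smooth_on_cst U (a : R) : smooth_on U (cst a).
Proof. by apply/smooth_onP => k; exact: Ck_cst. Qed.

Lemma smooth_on_add U f g : open U ->
  smooth_on U f -> smooth_on U g -> smooth_on U (f \+ g).
Proof.
by move=> oU /smooth_onP sf /smooth_onP sg; apply/smooth_onP => k; exact: Ck_add.
Qed.

Lemma smooth_on_mul U f g : open U ->
  smooth_on U f -> smooth_on U g -> smooth_on U (f \* g).
Proof.
by move=> oU /smooth_onP sf /smooth_onP sg; apply/smooth_onP => k; exact: Ck_mul.
Qed.

Lemma csmooth_on_cst U (z : R[i]) : csmooth_on U (cst z).
Proof. by split; exact: smooth_on_cst. Qed.

Lemma csmooth_on_add U c d : open U ->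
  csmooth_on U c -> csmooth_on U d -> csmooth_on U (c \+ d).
Proof.
move=> oU [cr ci] [dr di]; split.
  have -> : Re \o (c \+ d) = (Re \o c) \+ (Re \o d).
    by apply/funext => x /=; case: (c x) (d x) => ? ? [].
  exact: smooth_on_add.
have -> : Im \o (c \+ d) = (Im \o c) \+ (Im \o d).
  by apply/funext => x /=; case: (c x) (d x) => ? ? [].
exact: smooth_on_add.
Qed.

Lemma csmooth_on_mul U c d : open U ->
  csmooth_on U c -> csmooth_on U d -> csmooth_on U (c \* d).
Proof.
move=> oU [cr ci] [dr di]; split.
  have -> : Re \o (c \* d) =
      ((Re \o c) \* (Re \o d)) \+
      (cst (-1) \* ((Im \o c) \* (Im \o d))).
    by apply/funext => x /=; case: (c x) (d x) => ? ? [? ?] /=; rewrite mulN1r.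
  have sii := smooth_on_mul oU ci di.
  have sm := smooth_on_mul oU (@smooth_on_cst U (-1)) sii.
  exact: (smooth_on_add oU (smooth_on_mul oU cr dr) sm).
have -> : Im \o (c \* d) =
    ((Re \o c) \* (Im \o d)) \+
    ((Im \o c) \* (Re \o d)).
  by apply/funext => x /=; case: (c x) (d x) => ? ? [].
exact: (smooth_on_add oU (smooth_on_mul oU cr di) (smooth_on_mul oU ci dr)).
Qed.

End Smooth.

Lemma continuous_mulmxr (R : realType) (m d : nat) (K : 'M[R]_(d, m)) :
  continuous (fun y : 'rV[R]_d => y *m K).
Proof.
have -> : (fun y : 'rV[R]_d => y *m K) =
    (fun y => \sum_(j <- enum 'I_d) y 0 j *: row j K).
  by apply/funext => y; rewrite mulmx_sum_row big_enum.
elim: (enum 'I_d) => [|j s IH].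
  rewrite (_ : (fun _ => _) = cst 0); first exact: cst_continuous.
  by apply/funext => y; rewrite big_nil.
rewrite (_ : (fun _ => _) = (fun y : 'rV[R]_d => y 0 j *: row j K) \+
  (fun y : 'rV[R]_d => \sum_(j <- s) y 0 j *: row j K)); last first.
  by apply/funext => y /=; rewrite big_cons.
move=> y; refine (cvgD _ (IH y)).
exact: (@cvgZr_tmp _ _ _ _ _ _ _ (row j K) (@coord_continuous R 1 d 0 j y)).
Qed.

Lemma smooth_on_slice (R : realType) (m d : nat) (K : 'M[R]_(d, m))
    (k : 'I_d -> 'I_m) (U : set 'rV[R]_m) (f : 'rV[R]_m -> R) :
  (forall j, ('e_j : 'rV[R]_d) *m K = 'e_(k j)) ->
  smooth_on U f ->
  smooth_on [set y | U (y *m K)] (fun y => f (y *m K)).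
Proof.
move=> Ke sf.
have cK := @continuous_mulmxr _ _ _ K.
have dK (h : 'rV[R]_m -> R) (y v : 'rV[R]_d) :
  'D_v (fun y => h (y *m K)) y = 'D_(v *m K) h (y *m K).
  by rewrite /derive; apply: (f_equal (fun F : R -> R => lim (F @ 0^')));
     apply/funext => t /=; rewrite mulmxDl scalemxAl.
have eqp s : pders s (fun y => f (y *m K)) =
    (fun y => pders (map k s) f (y *m K)).
  elim: s => //= j s IH; rewrite IH; apply/funext => y.
  by rewrite /pder dK Ke.
move=> s y Uy; rewrite eqp; have [cf df] := sf (map k s) _ Uy; split.
  exact: (continuous_comp (cK y) cf).
move=> j; have := df (k j); rewrite /derivable.
set F := fun t : R => _; set G := fun t : R => _.
suff -> : F = G by [].
by apply/funext => t; rewrite /F /G /= mulmxDl -scalemxAl Ke.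
Qed.

Section PowerSeries.

(* [fps C] is C[[lambda]] and [fps_module V] is the module V[[lambda]] over it. *)
Definition fps (C : Type) : Type := nat -> C.
Definition fps_module (V : Type) : Type := nat -> V.

HB.instance Definition _ (C : comNzRingType) :=
  GRing.Zmodule.copy (fps C) (nat -> C).
HB.instance Definition _ (V : zmodType) :=
  GRing.Zmodule.copy (fps_module V) (nat -> V).

Lemma sum_triangle (V : nmodType) (r : nat) (F : nat -> nat -> V) :
  \sum_(a < r.+1) \sum_(b < a.+1) F a b =
  \sum_(b < r.+1) \sum_(k < (r - b).+1) F (b + k)%N b.
Proof.
elim: r F => [|r IH] F; first by rewrite !big_ord_recl !big_ord0.
rewrite big_ord_recr IH /= [X in _ + X]big_ord_recr addrA -big_split /=.
rewrite [RHS]big_ord_recr /= subnn big_ord1 addn0; congr (_ + _).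
apply: eq_bigr => b _; have br : (b <= r)%N by rewrite -ltnS.
by rewrite (subSn br) [RHS]big_ord_recr /= -(subSn br) subnKC // ltnW.
Qed.

Section Ring.
Variable C : comNzRingType.
Implicit Types c d : fps C.

Definition fps_one : fps C := fun r => (r == 0)%:R.
Definition fps_mul c d : fps C := fun r => \sum_(a < r.+1) c a * d (r - a)%N.

Lemma fps_mulC : commutative fps_mul.
Proof.
move=> c d; apply/funext => r; rewrite /fps_mul (reindex_inj rev_ord_inj) /=.
by apply: eq_bigr => a _; rewrite subSS subKn -1?ltnS // mulrC.
Qed.

Lemma fps_mulA : associative fps_mul.
Proof.
move=> c d b; apply/funext => r; rewrite /fps_mul.
under [RHS]eq_bigr do rewrite mulr_suml.
rewrite (sum_triangle r (fun s a => c a * d (s - a)%N * b (r - s)%N)).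
apply: eq_bigr => a _; rewrite mulr_sumr; apply: eq_bigr => k _.
by rewrite mulrA addKn subnDA.
Qed.

Lemma fps_mul1 : left_id fps_one fps_mul.
Proof.
move=> c; apply/funext => r; rewrite /fps_mul big_ord_recl /= mul1r subn0.
by rewrite big1 ?addr0 // => a _; rewrite /fps_one /= mul0r.
Qed.

Lemma fps_mulDl : left_distributive fps_mul +%R.
Proof.
move=> c d b; apply/funext => r; rewrite [RHS]/GRing.add /= -big_split /=.
by apply: eq_bigr => a _; rewrite -mulrDl.
Qed.

Lemma fps_one_neq0 : fps_one != 0.
Proof.
by apply/eqP => /(congr1 (fun c => c 0%N)) /eqP; rewrite /fps_one oner_eq0.
Qed.

HB.instance Definition _ := GRing.Zmodule_isComNzRing.Build (fps C)
  fps_mulA fps_mulC fps_mul1 fps_mulDl fps_one_neq0.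

Variable V : lmodType C.
Implicit Types v w : fps_module V.

Definition fps_scale c v : fps_module V :=
  fun r => \sum_(a < r.+1) c a *: v (r - a)%N.

Lemma fps_scaleA c d v : fps_scale c (fps_scale d v) = fps_scale (c * d) v.
Proof.
apply/funext => r; rewrite /fps_scale.
under [RHS]eq_bigr do rewrite scaler_suml.
rewrite (sum_triangle r (fun s a => (c a * d (s - a)%N) *: v (r - s)%N)).
apply: eq_bigr => a _; rewrite scaler_sumr; apply: eq_bigr => k _.
by rewrite scalerA addKn subnDA.
Qed.

Lemma fps_scale1 : left_id 1 fps_scale.
Proof.
move=> v; apply/funext => r; rewrite /fps_scale big_ord_recl /= scale1r subn0.
by rewrite big1 ?addr0 // => a _; rewrite /GRing.one /= /fps_one /= scale0r.
Qed.

Lemma fps_scaleDr : right_distributive fps_scale +%R.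
Proof.
move=> c v w; apply/funext => r; rewrite [RHS]/GRing.add /= -big_split /=.
by apply: eq_bigr => a _; rewrite -scalerDr.
Qed.

Lemma fps_scaleDl v : {morph fps_scale^~ v : c d / c + d}.
Proof.
move=> c d; apply/funext => r; rewrite [RHS]/GRing.add /= -big_split /=.
by apply: eq_bigr => a _; rewrite -scalerDl.
Qed.

HB.instance Definition _ := GRing.Zmodule_isLmodule.Build (fps C) (fps_module V)
  fps_scaleA fps_scale1 fps_scaleDr fps_scaleDl.

End Ring.

Definition fpsC (C : comNzRingType) (z : C) : fps C :=
  fun r => if r is 0 then z else 0.
Definition lam (C : comNzRingType) : fps C := fun r => (r == 1%N)%:R.
Definition seriesC (V : zmodType) (v : V) : fps_module V :=
  fun r => if r is 0 then v else 0.

Definition smap (V W : Type) (f : V -> W) (v : fps_module V) : fps_module W :=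
  fun r => f (v r).

(* Division by lambda, meaningful for series without constant term. *)
Definition sdiv_lam (V : Type) (v : fps_module V) : fps_module V := fun r => v r.+1.

End PowerSeries.

Section Manifold.
Variables (R : realType) (m : nat).

Record chart (X : topologicalType) := Chart {
  dom : set X;
  img : set 'rV[R]_m;
  fwd : X -> 'rV[R]_m;
  bwd : 'rV[R]_m -> X;
  dom_open : open dom;
  img_open : open img;
  fwdK : forall p, dom p -> img (fwd p) /\ bwd (fwd p) = p;
  bwdK : forall x, img x -> dom (bwd x) /\ fwd (bwd x) = x;
  fwd_continuous : forall p, dom p -> {for p, continuous fwd};
  bwd_continuous : forall x, img x -> {for x, continuous bwd} }.

Definition transition_smooth (X : topologicalType) (c c' : chart X) : Prop :=
  forall j : 'I_m, smooth_on [set x | img c x /\ dom c' (bwd c x)]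
    (fun x => fwd c' (bwd c x) 0 j).

Record manifold := Manifold {
  points :> topologicalType;
  points_hausdorff : hausdorff_space points;
  points_second_countable : @second_countable points;
  atlas : set (chart points);
  atlas_cover : forall p, exists2 c, atlas c & dom c p;
  atlas_compatible : forall c c', atlas c -> atlas c' -> transition_smooth c c';
  atlas_maximal : forall c, (forall c', atlas c' ->
    transition_smooth c c' /\ transition_smooth c' c) -> atlas c }.

Variable X : manifold.
Implicit Types c : chart X.

Definition smooth (f : X -> R) : Prop :=
  forall c, atlas c -> smooth_on (img c) (f \o bwd c).

Definition csmooth (f : X -> R[i]) : Prop :=
  forall c, atlas c -> csmooth_on (img c) (f \o bwd c).

Definition csmooth_pred : {pred (X -> R[i])} := [pred f | `[< csmooth f >]].

Lemma csmooth_subring : subring_closed csmooth_pred.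
Proof.
have C a : cst a \in csmooth_pred.
  by apply/asboolP => c _; exact: csmooth_on_cst.
have D f g : f \in csmooth_pred -> g \in csmooth_pred ->
    f \+ g \in csmooth_pred.
  move=> /asboolP sf /asboolP sg; apply/asboolP => c Ac.
  by apply: csmooth_on_add; [exact: img_open|exact: sf|exact: sg].
have Mu f g : f \in csmooth_pred -> g \in csmooth_pred ->
    f \* g \in csmooth_pred.
  move=> /asboolP sf /asboolP sg; apply/asboolP => c Ac.
  by apply: csmooth_on_mul; [exact: img_open|exact: sf|exact: sg].
split; [exact: C| |exact: Mu] => f g sf sg.
suff -> : f - g = f \+ (cst (-1) \* g) by exact: (D _ _ sf (Mu _ _ (C (-1)) sg)).
by apply/funext => x /=; rewrite mulN1r.
Qed.

Record Cinfty := MkCinfty {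
  Cinfty_fun :> X -> R[i];
  Cinfty_smooth : Cinfty_fun \in csmooth_pred }.

HB.instance Definition _ := [isSub for Cinfty_fun].
HB.instance Definition _ := [Choice of Cinfty by <:].
HB.instance Definition _ :=
  GRing.SubChoice_isSubComPzRing.Build _ _ Cinfty csmooth_subring.

Lemma csmooth_scale (z : R[i]) (f : Cinfty) :
  (fun p => z * f p) \in csmooth_pred.
Proof.
have [_ _ M] := csmooth_subring; apply: (M (cst z)); last exact: valP.
by apply/asboolP => c _; exact: csmooth_on_cst.
Qed.

Definition Cinfty_scale (z : R[i]) (f : Cinfty) : Cinfty :=
  MkCinfty (csmooth_scale z f).

Lemma Cinfty_scaleA a b v :
  Cinfty_scale a (Cinfty_scale b v) = Cinfty_scale (a * b) v.
Proof. by apply/val_inj/funext => p /=; rewrite mulrA. Qed.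
Lemma Cinfty_scale1 : left_id 1 Cinfty_scale.
Proof. by move=> v; apply/val_inj/funext => p /=; rewrite mul1r. Qed.
Lemma Cinfty_scaleDr : right_distributive Cinfty_scale +%R.
Proof. by move=> a v w; apply/val_inj/funext => p /=; rewrite mulrDr. Qed.
Lemma Cinfty_scaleDl v : {morph Cinfty_scale^~ v : a b / a + b}.
Proof. by move=> a b; apply/val_inj/funext => p /=; rewrite mulrDl. Qed.

HB.instance Definition _ := GRing.Zmodule_isLmodule.Build R[i] Cinfty
  Cinfty_scaleA Cinfty_scale1 Cinfty_scaleDr Cinfty_scaleDl.

Lemma csmooth_of_real (f : X -> R) (sf : smooth f) :
  (fun p => (f p)%:C%C) \in csmooth_pred.
Proof.
apply/asboolP => c Ac; split; first exact: sf.
exact: (@smooth_on_cst R m (img c) 0).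
Qed.

Definition Cinfty_of_real (f : X -> R) (sf : smooth f) : Cinfty :=
  MkCinfty (csmooth_of_real sf).

End Manifold.

Section Submanifold.
Variables (R : realType) (m : nat) (X : manifold R m) (S : set X).

(* In the domain of [c], the set [S] is given by the vanishing of the coordinates
   whose index is not in the range of [k]. *)
Definition slice_chart (d : nat) (c : chart R m X) (k : 'I_d -> 'I_m) : Prop :=
  [/\ atlas c, injective k &
    forall p, dom c p -> S p <-> (forall i, i \notin codom k -> fwd c p 0 i = 0)].

Definition slice (d : nat) (k : 'I_d -> 'I_m) (y : 'rV[R]_d) : 'rV[R]_m :=
  y *m (\matrix_(j, i) (k j == i)%:R).

(* [f] is smooth for the submanifold structure of [S], whose charts are the
   restrictions of the slice charts: [g] is [f] in such a chart. *)
Definition sub_csmooth (f : {p : X | S p} -> R[i]) : Prop :=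
  forall d (c : chart R m X) (k : 'I_d -> 'I_m), slice_chart c k ->
  exists2 g : 'rV[R]_d -> R[i],
    csmooth_on [set y | img c (slice k y)] g &
    forall (q : {p : X | S p}) (y : 'rV[R]_d),
      img c (slice k y) -> bwd c (slice k y) = sval q -> g y = f q.

Definition sub_csmooth_pred : {pred ({p : X | S p} -> R[i])} :=
  [pred f | `[< sub_csmooth f >]].

Lemma slice_open d (c : chart R m X) (k : 'I_d -> 'I_m) :
  open [set y | img c (slice k y)].
Proof.
apply: open_comp; last exact: img_open.
by move=> y _; exact: continuous_mulmxr.
Qed.

Lemma sub_csmooth_zmod : zmod_closed sub_csmooth_pred.
Proof.
split.
  apply/asboolP => d c k _; exists (cst 0) => //; exact: csmooth_on_cst.
move=> f g /asboolP sf /asboolP sg; apply/asboolP => d c k sl.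
have [f' sf' ff'] := sf d c k sl; have [g' sg' gg'] := sg d c k sl.
have oU := @slice_open d c k.
exists (f' \+ (cst (-1) \* g')).
  exact: (csmooth_on_add oU sf' (csmooth_on_mul oU (@csmooth_on_cst R d _ (-1)) sg')).
by move=> q y iy by_ /=; rewrite (ff' q) // (gg' q) // mulN1r.
Qed.

Record sub_Cinfty := MkSubCinfty {
  sub_Cinfty_fun :> {p : X | S p} -> R[i];
  sub_Cinfty_smooth : sub_Cinfty_fun \in sub_csmooth_pred }.

HB.instance Definition _ := [isSub for sub_Cinfty_fun].
HB.instance Definition _ := [Choice of sub_Cinfty by <:].
HB.instance Definition _ :=
  GRing.SubChoice_isSubZmodule.Build _ _ sub_Cinfty sub_csmooth_zmod.

Lemma sub_csmooth_scale (z : R[i]) (f : sub_Cinfty) :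
  (fun q => z * f q) \in sub_csmooth_pred.
Proof.
apply/asboolP => d c k sl.
have [f' sf' ff'] := asboolP _ (valP f) d c k sl.
exists (cst z \* f'); last by move=> q y iy yq /=; rewrite (ff' q).
exact: (csmooth_on_mul (@slice_open d c k) (@csmooth_on_cst R d _ z) sf').
Qed.

Definition sub_Cinfty_scale (z : R[i]) (f : sub_Cinfty) : sub_Cinfty :=
  MkSubCinfty (sub_csmooth_scale z f).

Lemma sub_Cinfty_scaleA a b v :
  sub_Cinfty_scale a (sub_Cinfty_scale b v) = sub_Cinfty_scale (a * b) v.
Proof. by apply/val_inj/funext => p /=; rewrite mulrA. Qed.
Lemma sub_Cinfty_scale1 : left_id 1 sub_Cinfty_scale.
Proof. by move=> v; apply/val_inj/funext => p /=; rewrite mul1r. Qed.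
Lemma sub_Cinfty_scaleDr : right_distributive sub_Cinfty_scale +%R.
Proof. by move=> a v w; apply/val_inj/funext => p /=; rewrite mulrDr. Qed.
Lemma sub_Cinfty_scaleDl v : {morph sub_Cinfty_scale^~ v : a b / a + b}.
Proof. by move=> a b; apply/val_inj/funext => p /=; rewrite mulrDl. Qed.

HB.instance Definition _ := GRing.Zmodule_isLmodule.Build R[i] sub_Cinfty
  sub_Cinfty_scaleA sub_Cinfty_scale1 sub_Cinfty_scaleDr sub_Cinfty_scaleDl.

Lemma csmooth_restrict (f : Cinfty X) :
  (fun q : {p : X | S p} => f (sval q)) \in sub_csmooth_pred.
Proof.
apply/asboolP => d c k [Ac ik sl].
exists (f \o bwd c \o slice k); last by move=> q y _ /= ->.
have Ke j : ('e_j : 'rV[R]_d) *m (\matrix_(j, i) (k j == i)%:R) = 'e_(k j).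
  by apply/rowP => i; rewrite -rowE !mxE eqxx eq_sym.
have [sr si] := asboolP _ (valP f) c Ac.
by split; [exact: (smooth_on_slice Ke sr)|exact: (smooth_on_slice Ke si)].
Qed.

Definition restrict_to (f : Cinfty X) : sub_Cinfty :=
  MkSubCinfty (csmooth_restrict f).

End Submanifold.

Section SymplecticForm.
Variables (R : realType) (m : nat) (X : manifold R m).
Implicit Types c : chart R m X.

Definition jacobian_of_transition c c' (x : 'rV[R]_m) : 'M[R]_m :=
  \matrix_(i, j) pder i (fun y => fwd c' (bwd c y) 0 j) x.

(* [form c x i j] is the value of the form on the i-th and j-th coordinate
   vector fields of the chart [c] at the point with coordinates [x]. *)
Record symplectic_form := SymplecticForm {
  form :> chart R m X -> 'rV[R]_m -> 'M[R]_m;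
  form_smooth : forall c, atlas c -> forall i j,
    smooth_on (img c) (fun x => form c x i j);
  form_transition : forall c c' p, atlas c -> atlas c' -> dom c p -> dom c' p ->
    let Jac := jacobian_of_transition c c' (fwd c p) in
    form c (fwd c p) = Jac *m form c' (fwd c' p) *m Jac^T;
  form_alternating : forall c x, atlas c -> img c x -> (form c x)^T = - form c x;
  form_nondegenerate : forall c x, atlas c -> img c x -> form c x \in unitmx;
  form_closed : forall c x, atlas c -> img c x -> forall i j k,
    pder i (fun y => form c y j k) x + pder j (fun y => form c y k i) x
    + pder k (fun y => form c y i j) x = 0 }.

Variable om : symplectic_form.
Implicit Types f g : X -> R[i].

(* Functions are complex-valued, so the form is extended to complexified tangent
   spaces. *)
Definition formC c (x : 'rV[R]_m) : 'M[R[i]]_m :=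
  map_mx (fun t : R => t%:C%C) (om c x).

Definition differential c f (x : 'rV[R]_m) : 'rV[R[i]]_m :=
  \row_i cpders [:: i] (f \o bwd c) x.

(* The solution [v] of [v *m formC c x = differential c f x]. *)
Definition hamiltonian_field c f (x : 'rV[R]_m) : 'rV[R[i]]_m :=
  differential c f x *m invmx (formC c x).

Definition poisson c f g (x : 'rV[R]_m) : R[i] :=
  (hamiltonian_field c f x *m formC c x *m (hamiltonian_field c g x)^T) 0 0.

End SymplecticForm.

Section StarProduct.
Variables (R : realType) (m : nat) (X : manifold R m) (om : symplectic_form X).

Definition multi_index (N : nat) (al : {ffun 'I_m -> 'I_N.+1}) : seq 'I_m :=
  flatten [seq nseq (al i) i | i <- enum 'I_m].

(* The order is bounded by [N] in each of the coordinates of each chart. *)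
Definition bidifferential (B : Cinfty X -> Cinfty X -> Cinfty X) : Prop :=
  exists N : nat, forall c, atlas c ->
  exists a : {ffun 'I_m -> 'I_N.+1} -> {ffun 'I_m -> 'I_N.+1} ->
             'rV[R]_m -> R[i],
    (forall al be, csmooth_on (img c) (a al be)) /\
    (forall f g x, img c x -> B f g (bwd c x) =
      \sum_al \sum_be a al be x * cpders (multi_index al) (f \o bwd c) x
                                * cpders (multi_index be) (g \o bwd c) x).

Definition star_of (C : nat -> Cinfty X -> Cinfty X -> Cinfty X)
    (f g : fps_module (Cinfty X)) : fps_module (Cinfty X) :=
  fun r => \sum_(i < r.+1) \sum_(j < (r - i).+1) C (r - i - j)%N (f i) (g j).

Record star_product := StarProduct {
  star_coef : nat -> Cinfty X -> Cinfty X -> Cinfty X;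
  star_bidifferential : forall r, bidifferential (star_coef r);
  star_coef0 : forall f g, star_coef 0 f g = f * g;
  star_coef1 : forall f g c p, atlas c -> dom c p ->
    (star_coef 1 f g - star_coef 1 g f) p = 'i%C * poisson om c f g (fwd c p);
  star_coef_cst : forall r (f : Cinfty X) (z : R[i]), (0 < r)%N ->
    star_coef r (z *: (1 : Cinfty X)) f = 0 /\
    star_coef r f (z *: (1 : Cinfty X)) = 0;
  star_assoc : forall f g h, star_of star_coef f (star_of star_coef g h) =
                             star_of star_coef (star_of star_coef f g) h }.

Definition star (S : star_product) := star_of (star_coef S).

End StarProduct.

Record lieAlgebra (R : realType) := LieAlgebra {
  lie_space :> vectType R;
  lie : lie_space -> lie_space -> lie_space;
  lie_linearl : forall y, linear (lie^~ y);
  lie_linearr : forall x, linear (lie x);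
  lie_alternating : forall x, lie x x = 0;
  lie_jacobi : forall x y z,
    lie x (lie y z) + lie y (lie z x) + lie z (lie x y) = 0 }.

Section MomentumMap.
Variables (R : realType) (m : nat) (X : manifold R m) (om : symplectic_form X).
Variables (S : star_product om) (g : lieAlgebra R).

Definition iC : R[i] := 'i%C.
Definition ilam : fps R[i] := fpsC iC * lam R[i].

Record quantum_momentum_map := QuantumMomentumMap {
  momentum : nat -> X -> 'Hom(g, R^o);
  momentum_smooth : forall r xi, smooth (fun p => momentum r p xi : R);
  pairing := fun xi : g =>
    (fun r => Cinfty_of_real (momentum_smooth r xi)) : fps_module (Cinfty X);
  momentum_classical : forall xi eta c p, atlas c -> dom c p ->
    poisson om c (pairing xi 0%N) (pairing eta 0%N) (fwd c p) =
      pairing (lie xi eta) 0%N p;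
  momentum_quantum : forall xi eta,
    star S (pairing xi) (pairing eta) - star S (pairing eta) (pairing xi) =
      ilam *: pairing (lie xi eta) }.

Variable J : quantum_momentum_map.

Definition constraint : set X := [set p | momentum J 0 p = 0].

(* The differential of the classical momentum map is onto at each zero. *)
Definition regular_constraint : Prop :=
  constraint !=set0 /\
  forall p c, constraint p -> atlas c -> dom c p ->
    forall mu : 'Hom(g, R^o), exists v : 'rV[R]_m, forall xi : g,
      'D_v (fun x => momentum J 0 (bwd c x) xi : R) (fwd c p) = mu xi.

End MomentumMap.

(* [ext n V] is the exterior algebra of an n-dimensional space tensored with V:
   [x I] is the coefficient of the monomial v_(i1) /\ .. /\ v_(ik), where
   I = {i1 < .. < ik} and (v_i) is the chosen basis. *)
Notation ext n V := {ffun {set 'I_n} -> V}.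

Section Exterior.
Variables (n : nat) (K : comNzRingType) (V W : lmodType K).
Implicit Types (I : {set 'I_n}) (x : ext n V).

Definition position (a : 'I_n) I : nat := #|[pred b in I | (b < a)%N]|.

(* Left insertion of the a-th dual basis vector. *)
Definition ext_insert (a : 'I_n) x : ext n V :=
  [ffun I : {set 'I_n} => if a \in I then 0 else (-1) ^+ position a I *: x (a |: I)].

(* Left multiplication by the a-th basis vector. *)
Definition ext_wedge (a : 'I_n) x : ext n V :=
  [ffun I : {set 'I_n} => if a \in I then (-1) ^+ position a I *: x (I :\ a) else 0].

Definition ext0 (v : V) : ext n V := [ffun I : {set 'I_n} => if I == finset.set0 then v else 0].

Definition ext_map (f : V -> W) x : ext n W := [ffun I : {set 'I_n} => f (x I)].

(* alpha (x) v |-> (-1)^k alpha (x) f v for alpha of degree k. *)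
Definition ext_smap (f : V -> W) x : ext n W :=
  [ffun I : {set 'I_n} => (-1) ^+ #|I| *: f (x I)].

Definition ext_homog (k : int) : set (ext n V) :=
  [set x | forall I, #|I|%:Z != k -> x I = 0].

End Exterior.

(* Elements of a quotient of a submodule by a submodule B are cosets, that is
   sets; an operation on classes is defined by applying it to all the
   representatives and adding B. *)
Section Classes.
Variables (K : comNzRingType) (V W : lmodType K).

Definition vcoset (B : set V) (v : V) : set V := [set v + b | b in B].

Definition class_op (B : set V) (op : V -> V -> V) (X Y : set V) : set V :=
  [set z | exists x y, [/\ X x, Y y & vcoset B (op x y) z]].

Definition cohomology_of (D : V -> V) (P : set V) : set (set V) :=
  [set vcoset (range D) a | a in [set a | P a /\ D a = 0]].

Definition cohomology (D : V -> V) : set (set V) := cohomology_of D setT.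

End Classes.

Definition class_map (K : comNzRingType) (V W : lmodType K) (B : set W)
    (f : V -> W) (X : set V) : set W :=
  [set w | exists x, X x /\ vcoset B (f x) w].

Definition class_add (K : comNzRingType) (V : lmodType K) (B : set V) :=
  class_op B +%R.
Definition class_scale (K : comNzRingType) (V : lmodType K) (B : set V) (k : K) :=
  class_map B (fun v : V => k *: v).

Record graded_unital_algebra (K : comNzRingType) (V : lmodType K) (B : set V)
    (N : nat) (H : set (set V)) (Hd : int -> set (set V))
    (mul : set V -> set V -> set V) (one : set V) : Prop := {
  gua_homog : forall z X, Hd z X -> H X;
  gua_range : forall z X, Hd z X -> ~~ (0 <= z < N%:Z) -> X = B;
  gua_direct : forall X, H X -> exists! Y : 'I_N -> set V,
    (forall p : 'I_N, Hd p%:Z (Y p)) /\ X = \big[class_add B/B]_(p < N) Y p;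
  gua_mul : forall X Y, H X -> H Y -> H (mul X Y);
  gua_graded : forall z w X Y, Hd z X -> Hd w Y -> Hd (z + w) (mul X Y);
  gua_one : Hd 0 one;
  gua_assoc : forall X Y Z, H X -> H Y -> H Z ->
    mul X (mul Y Z) = mul (mul X Y) Z;
  gua_mul1 : forall X, H X -> mul one X = X /\ mul X one = X;
  gua_mulDl : forall X Y Z, H X -> H Y -> H Z ->
    mul (class_add B X Y) Z = class_add B (mul X Z) (mul Y Z);
  gua_mulDr : forall X Y Z, H X -> H Y -> H Z ->
    mul X (class_add B Y Z) = class_add B (mul X Y) (mul X Z);
  gua_mulZ : forall (k : K) X Y, H X -> H Y ->
    mul (class_scale B k X) Y = class_scale B k (mul X Y) /\
    mul X (class_scale B k Y) = class_scale B k (mul X Y) }.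

(* The inverse of the restriction of [f] to [P], when this restriction is a
   bijection of [P] onto itself. *)
Definition inverse_on (V : zmodType) (P : set V) (f : V -> V) (y : V) : V :=
  xget 0 [set x | P x /\ f x = y].

Section BRST.
Variables (R : realType) (m : nat) (X : manifold R m) (om : symplectic_form X).
Variables (S : star_product om) (g : lieAlgebra R).
Variables (J : quantum_momentum_map S g) (n : nat) (e : n.-tuple g).

Local Notation K := (fps R[i]).
Local Notation OM := (Cinfty X).
Local Notation OC := (sub_Cinfty (constraint J)).
Local Notation F := (fps_module OM).
Local Notation Lg := (ext n F).
Local Notation A := (ext n Lg).
Local Notation E := (ext n (fps_module OC)).

Definition rc (t : R) : K := fpsC t%:C%C.

Definition struct_const (c a b : 'I_n) : R := coord e c (lie (tnth e a) (tnth e b)).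

Definition chi (xi : g) : R := 2^-1 * \sum_b coord e b (lie xi (tnth e b)).

(* Division by i lambda. *)
Definition div_ilam (f : F) : F := fpsC (iC R)^-1 *: sdiv_lam f.

Definition rhoM (xi : g) (f : F) : F :=
  div_ilam (star S (pairing J xi) f - star S f (pairing J xi)).

(* [a I1 I2] is the coefficient of e^(I1) /\ e_(I2). *)
Definition insert_vec (b : 'I_n) (a : A) : A := ext_insert b a.
Definition insert_covec (b : 'I_n) (a : A) : A := ext_smap (ext_insert b) a.

Definition parity (a : A) : A :=
  [ffun I1 : {set 'I_n} => [ffun I2 : {set 'I_n} =>
    (-1) ^+ (#|I1| + #|I2|)%N *: a I1 I2]].

Definition rinsert_covec (b : 'I_n) (a : A) : A := - insert_covec b (parity a).

Definition shuffle_sign (I1 I2 : {set 'I_n}) : K :=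
  (-1) ^+ #|[pred p : 'I_n * 'I_n | [&& p.1 \in I1, p.2 \in I2 & (p.2 < p.1)%N]]|.

(* The wedge product combined with the star product on coefficients; the sign
   (-1)^(#|I2| * #|L1|) comes from moving e^(L1), L1 = K1 :\: I1, past e_(I2). *)
Definition wedge_star (a b : A) : A :=
  [ffun K1 : {set 'I_n} => [ffun K2 : {set 'I_n} =>
    \sum_(I1 in powerset K1) \sum_(I2 in powerset K2)
      ((-1) ^+ (#|I2| * #|K1 :\: I1|)%N * shuffle_sign I1 (K1 :\: I1)
        * shuffle_sign I2 (K2 :\: I2))
      *: star S (a I1 I2) (b (K1 :\: I1) (K2 :\: I2))]].

(* The wedge product composed with exp(2 i lam P), where P is the sum over c of
   j(e^c) (x) i(e_c): the r-th power of P is the sum, over the r-tuples s, of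
   j(e^(s_1)) .. j(e^(s_r)) (x) i(e_(s_1)) .. i(e_(s_r)), and vanishes for
   r > n. *)
Definition starS (a b : A) : A :=
  \sum_(r < n.+1) (rc (r`!%:R)^-1 * (2%:R * ilam R) ^+ r) *:
    \sum_(s : r.-tuple 'I_n)
      wedge_star (foldr rinsert_covec a s) (foldr insert_vec b s).

Definition one_F : F := seriesC 1.
Definition one_A : A := ext0 n (ext0 n one_F).

Definition Omega : A := - \sum_a \sum_b \sum_c rc (4^-1 * struct_const c a b) *:
  ext_wedge a (ext_wedge b (ext0 n (ext_wedge c (ext0 n one_F)))).

Definition J_A : A := \sum_a ext_wedge a (ext0 n (ext0 n (pairing J (tnth e a)))).

Definition chi_A : A := \sum_a rc (chi (tnth e a)) *: ext_wedge a one_A.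

Definition Theta : A := Omega + J_A + ilam R *: chi_A.

(* As Theta is odd, its super-commutator with a is
   Theta * a - (-1)^(deg a) a * Theta. *)
Definition brst (a : A) : A :=
  ext_map (ext_map div_ilam) (starS Theta a - starS (parity a) Theta).

Definition CE (Q : lmodType K) (rho : g -> Q -> Q) (x : ext n Q) : ext n Q :=
  - (\sum_a \sum_b \sum_c rc (2^-1 * struct_const c a b) *:
       ext_wedge a (ext_wedge b (ext_insert c x)))
  + \sum_a ext_wedge a (ext_map (rho (tnth e a)) x).

(* The derivation extending the adjoint representation. *)
Definition ad_ext (xi : g) (x : Lg) : Lg :=
  \sum_b \sum_c rc (coord e c (lie xi (tnth e b))) *: ext_wedge c (ext_insert b x).

Definition delta : A -> A := CE (fun xi x => ad_ext xi x + ext_map (rhoM xi) x).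

(* On a monomial xi_1 /\ .. /\ xi_l, inserting the duals of xi_i and then of
   xi_j, i < j, removes both and produces the sign (-1)^(i+j-1). *)
Definition quantum_koszul_g (x : Lg) : Lg :=
  \sum_a ext_map (fun f => star S f (pairing J (tnth e a))) (ext_insert a x)
  + ilam R *: (\sum_a rc (chi (tnth e a)) *: ext_insert a x)
  - ilam R *: (\sum_(a : 'I_n) \sum_(b : 'I_n | (a < b)%N) \sum_c
      rc (struct_const c a b) *: ext_wedge c (ext_insert b (ext_insert a x))).

Definition quantum_koszul : A -> A := ext_smap quantum_koszul_g.

Definition koszul_g (x : ext n OM) : ext n OM :=
  \sum_a ext_map (fun f => pairing J (tnth e a) 0%N * f) (ext_insert a x).

Definition series_lift (T : ext n OM -> ext n OM) (x : Lg) : Lg :=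
  [ffun I : {set 'I_n} => fun r => T [ffun I' : {set 'I_n} => x I' r] I].

Definition koszul : A -> A := ext_smap (series_lift koszul_g).

(* Elements of degree l in the exterior algebra of g, of bidegree (k, l), and of
   ghost number z. *)
Definition A_l (l : nat) : set A :=
  [set a : A | forall I1 I2 : {set 'I_n}, #|I2| != l -> a I1 I2 = 0].
Definition A_kl (k l : nat) : set A :=
  [set a : A | forall I1 I2 : {set 'I_n}, (#|I1| != k) || (#|I2| != l) -> a I1 I2 = 0].
Definition A_ghost (z : int) : set A :=
  [set a : A | forall I1 I2 : {set 'I_n}, #|I1|%:Z - #|I2|%:Z != z -> a I1 I2 = 0].

Definition proj_l (l : nat) (a : A) : A :=
  [ffun I1 : {set 'I_n} => [ffun I2 : {set 'I_n} =>
    if #|I2| == l then a I1 I2 else 0]].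

Definition ideal_C : set F :=
  [set quantum_koszul a finset.set0 finset.set0 | a in A_kl 0 1].
Definition normalizer_C : set F :=
  [set f : F | forall g0 : F, ideal_C g0 -> ideal_C (star S f g0 - star S g0 f)].

Local Notation restr := (restrict_to (constraint J)).

(* [hmt] restricts to the maps h_i, i >= 0. *)
Record koszul_contraction := KoszulContraction {
  prol : {linear OC -> OM};
  hmt : {linear ext n OM -> ext n OM};
  prolK : forall c, restr (prol c) = c;
  hmt_degree : forall (i : nat) x,
    ext_homog i%:Z x -> ext_homog i.+1%:Z (hmt x);
  hmt_contract0 : forall f : OM,
    ext0 n (prol (restr f)) + koszul_g (hmt (ext0 n f)) = ext0 n f;
  hmt_contract : forall (i : nat) x, (0 < i)%N -> ext_homog i%:Z x ->
    hmt (koszul_g x) + koszul_g (hmt x) = x;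
  hmt_prol : forall c, hmt (ext0 n (prol c)) = 0 }.

Variable H : koszul_contraction.

Definition iota_cl : A -> E := ext_smap (fun x : Lg => smap restr (x finset.set0)).
Definition prol_A : E -> A :=
  ext_smap (fun c : fps_module OC => ext0 n (smap (prol H) c)).
Definition h_cl : A -> A := ext_smap (series_lift (hmt H)).

Definition B1 (a : A) : A :=
  ext_map (ext_map (@sdiv_lam OM))
    (koszul (proj_l 1 a) - quantum_koszul (proj_l 1 a)).

(* [htpy_op0] is inverted on [A_l 0] and [htpy_op] on [A_l i] for i > 0. *)
Definition htpy_op0 (a : A) : A := a - lam R[i] *: B1 (h_cl a).
Definition htpy_op (a : A) : A := h_cl (quantum_koszul a) + quantum_koszul (h_cl a).

Definition iota_q (a : A) : E := iota_cl (inverse_on (A_l 0) htpy_op0 (proj_l 0 a)).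

Definition h_q (a : A) : A :=
  h_cl (inverse_on (A_l 0) htpy_op0 (proj_l 0 a))
  + \sum_(1 <= i < n.+1) h_cl (inverse_on (A_l i) htpy_op (proj_l i a)).

Definition iota_F (f : F) : fps_module OC := iota_q (ext0 n (ext0 n f)) finset.set0.

Definition rhoC (xi : g) (c : fps_module OC) : fps_module OC :=
  iota_F (rhoM xi (smap (prol H) c)).

Definition deltaC : E -> E := CE rhoC.

Local Notation hatA := (E * A)%type.

Definition delta_hat (x : hatA) : hatA := (deltaC x.1, delta x.2).
Definition h_hat (x : hatA) : hatA := (0, prol_A x.1 + h_q x.2).
Definition brst_hat (x : hatA) : hatA := (deltaC x.1 + iota_q x.2 *+ 2, brst x.2).

Definition htpy_op_hat (x : hatA) : hatA :=
  x + rc 2^-1 *: (delta_hat (h_hat x) + h_hat (delta_hat x)).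

Definition h_hat' (x : hatA) : hatA :=
  rc 2^-1 *: h_hat (inverse_on setT htpy_op_hat x).

Definition h_hatC' (c : E) : A := (h_hat' (c, 0)).2.

Definition H_BRST : set (set A) := cohomology brst.
Definition H_BRST_deg (z : int) : set (set A) := cohomology_of brst (A_ghost z).
Definition H_CE : set (set E) := cohomology deltaC.
Definition H_CE_deg (z : int) : set (set E) :=
  cohomology_of deltaC (@ext_homog _ _ _ z).

Definition cls_BRST (a : A) : set A := vcoset (range brst) a.
Definition cls_CE (c : E) : set E := vcoset (range deltaC) c.
Definition mul_BRST := class_op (range brst) starS.

Definition Psi : set A -> set E := class_map (range deltaC) iota_q.
Definition Psi_inv : set E -> set A :=
  class_map (range brst) (fun c => h_hatC' c *+ 2).

(* The product transported along Psi. *)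
Definition mul_CE (Y1 Y2 : set E) : set E :=
  Psi (mul_BRST (Psi_inv Y1) (Psi_inv Y2)).

Definition reduced : set (set F) := [set vcoset ideal_C f | f in normalizer_C].
Definition mul_reduced := class_op ideal_C (star S).

(* On the class of a cocycle phi of ghost number 0, the class of the component of
   phi in degree (0, 0). *)
Definition Lmap (Z : set A) : set F :=
  class_map ideal_C (fun phi : A => phi finset.set0 finset.set0) (Z `&` A_ghost 0).

Definition invariants : set (fps_module OC) :=
  [set c | forall xi : g, rhoC xi c = 0].

End BRST.

(* Main.v *)
(** Left multiplication by the generators e^c, e_c and f represents a Clifford
    algebra on A, and the standard ordered product is determined by this
    representation; hence it is associative, and D_S^2 = 0 follows from
    Theta * Theta = 0.  Splitting D_S = delta + 2 d by the antighost degree gives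
    delta^2 = 0, d^2 = 0 and d delta + delta d = 0, where d is the quantum Koszul
    operator.

    Since d agrees with the classical Koszul operator up to order lambda, the
    operator Q = 1 - (d_cl - d) h - h (d_cl - d) is invertible by a geometric series
    in lambda.  Both i_q = i Q^-1 and h_q = h Q^-1 then satisfy the contraction
    identities for d, and they are the maps obtained by inverting the homotopy
    operators degree by degree.

    As h_q delta is nilpotent, the extended complex is contractible.  So i_q is an
    isomorphism on cohomology, and sum_k (-1/2)^k (h_q delta)^k prol lifts cocycles.
    The ideal I_C is the kernel of i_q on functions; f normalizes it exactly when
    i_q f is invariant, which yields (iii), and in ghost number zero the (0, 0)
    component of a product is the star product of the (0, 0) components, which
    yields (iv). *)

Require Import Defs.
From HB Require Import structures.
From mathcomp Require Import all_boot all_order all_algebra.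
From mathcomp Require Import complex.
From mathcomp Require Import ring.
From mathcomp Require Import all_classical all_reals all_analysis.
Set Implicit Arguments.
Unset Strict Implicit.
Unset Printing Implicit Defensive.
Import Order.TTheory GRing.Theory Num.Theory.
Import numFieldNormedType.Exports.
Local Open Scope classical_set_scope.
Local Open Scope ring_scope.

(** * Linear and exterior calculus *)

(** The 2 in D_S = delta + 2 d is the origin of every factor one half. Together with the contraction
    for d it makes the anticommutator of the extended differential and the extended homotopy equal
    to 2 (id + N), where N is half the anticommutator with the delta part alone. N is nilpotent for
    a reason of degree: the homotopy raises the antighost degree, delta keeps it, and it never
    exceeds n. Hence two kinds of inversion occur, a finite one for N and a lambda-adic one for Q.

    The algebra is done over a commutative ring, for abstract modules with operators known only
    through their commutation relations; the exterior algebras over function spaces enter as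
    instances. Gradings appear as operators whose eigenspaces are the homogeneous parts. Since the
    modules have no integer torsion, a relation can be split into its degrees by commuting it with
    such an operator. *)

Lemma sign_parity (K : pzRingType) (p q : nat) :
  odd p = odd q -> (-1) ^+ p = (-1) ^+ q :> K.
Proof. by move=> pq; rewrite -signr_odd pq signr_odd. Qed.

Lemma sign_parityN (K : pzRingType) (p q : nat) :
  odd p = ~~ odd q -> (-1) ^+ p = - (-1) ^+ q :> K.
Proof. by move=> pq; rewrite -[RHS]mulN1r -exprS; apply: sign_parity; rewrite pq. Qed.

Ltac odd_cases :=
  rewrite /= ?oddD; repeat match goal with |- context [odd ?x] => case: (odd x) end; done.

Section ModuleNormalForm.
Variables (K : comNzRingType) (V : lmodType K).

Inductive mod_expr :=
  | MVar of nat | MZero | MAdd of mod_expr & mod_expr | MOpp of mod_expr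
  | MScale of K & mod_expr.

Fixpoint mod_eval (env : seq V) e : V :=
  match e with
  | MVar i => nth 0 env i
  | MZero => 0
  | MAdd e1 e2 => mod_eval env e1 + mod_eval env e2
  | MOpp e1 => - mod_eval env e1
  | MScale k e1 => k *: mod_eval env e1
  end.

(** Plain recursion instead of [==], so that the [cbv] in [module_eq], which unfolds only the names
    it lists, evaluates the comparison of concrete indices. *)
Fixpoint nat_eqb (i j : nat) : bool :=
  match i, j with
  | O, O => true | S i, S j => nat_eqb i j | _, _ => false
  end.

Fixpoint mod_coef e (i : nat) : K :=
  match e with
  | MVar j => if nat_eqb i j then 1 else 0
  | MZero => 0
  | MAdd e1 e2 => mod_coef e1 i + mod_coef e2 i
  | MOpp e1 => - mod_coef e1 i
  | MScale k e1 => k * mod_coef e1 i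
  end.

Fixpoint mod_coef_eq e1 e2 (i : nat) : Prop :=
  match i with
  | O => True
  | S i => mod_coef e1 i = mod_coef e2 i /\ mod_coef_eq e1 e2 i
  end.

Lemma nat_eqbE i j : nat_eqb i j = (i == j).
Proof. by elim: i j => [|i IH] [|j] //=; rewrite IH. Qed.

Lemma mod_evalE env e : mod_eval env e = \sum_(i < size env) mod_coef e i *: nth 0 env i.
Proof.
elim: e => [j||e1 IH1 e2 IH2|e IH|k e IH] /=.
- have [js|sj] := ltnP j (size env).
    rewrite (bigD1 (Ordinal js)) //= nat_eqbE eqxx scale1r big1 ?addr0 // => i.
    by rewrite -val_eqE nat_eqbE /= => /negPf->; rewrite scale0r.
  rewrite nth_default // big1 // => i _; rewrite nat_eqbE; case: eqP => [ij|_].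
    by have := ltn_ord i; rewrite ij ltnNge sj.
  by rewrite scale0r.
- by rewrite big1 // => i _; rewrite scale0r.
- by rewrite IH1 IH2 -big_split; apply: eq_bigr => i _; rewrite scalerDl.
- by rewrite IH -sumrN; apply: eq_bigr => i _; rewrite scaleNr.
- by rewrite IH scaler_sumr; apply: eq_bigr => i _; rewrite scalerA.
Qed.

(** Reflection step of [module_eq]: one ring identity remains for each atom. The criterion is only
    sufficient, since atoms may be linearly dependent. *)
Lemma mod_evalP env e1 e2 :
  mod_coef_eq e1 e2 (size env) -> mod_eval env e1 = mod_eval env e2.
Proof.
rewrite !mod_evalE => h; apply: eq_bigr => -[i /= ilt] _; congr (_ *: _).
elim: (size env) h ilt => //= m IH [h1 h2]; rewrite ltnS leq_eqVlt.
by case/predU1P => [->|]; [exact: h1|exact: IH].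
Qed.

End ModuleNormalForm.

(** The [match] on [constr:(Set)] with two catch-all branches is a try-else for tactics that return
    terms: failure of the first branch starts the second. *)
Ltac mod_lookup x env :=
  lazymatch env with
  | cons ?y ?l => match constr:(Set) with
      | _ => let _ := constr:(ltac:(first [constr_eq_nounivs x y | unify x y]; exact tt) : unit) in constr:(O)
      | _ => let i := mod_lookup x l in constr:(S i)
      end
  end.

Ltac mod_atoms t env :=
  lazymatch t with
  | (?x + ?y)%R => let env := mod_atoms x env in mod_atoms y env
  | (- ?x)%R => mod_atoms x env
  | (_ *: ?x)%R => mod_atoms x env
  | 0%R => env
  | ?x => match constr:(Set) with
      | _ => let _ := mod_lookup x env in env
      | _ => constr:(cons x env)
      end
  end.

Ltac mod_reify K t env :=
  lazymatch t with
  | (?x + ?y)%R => let u := mod_reify K x env in let v := mod_reify K y env in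
      constr:(MAdd u v)
  | (- ?x)%R => let u := mod_reify K x env in constr:(MOpp u)
  | (?k *: ?x)%R => let u := mod_reify K x env in constr:(MScale (k : K) u)
  | 0%R => constr:(MZero K)
  | ?x => let i := mod_lookup x env in constr:(MVar K i)
  end.

(* Decides equations between linear combinations over K in the K-module V, up to
   equations between the coefficients, which it tries to solve with [ring]. *)
Ltac module_eq K V :=
  lazymatch goal with |- @eq _ ?x ?y =>
    let env := mod_atoms x (@nil (GRing.Lmodule.sort V)) in
    let env := mod_atoms y env in
    let u := mod_reify K x env in
    let v := mod_reify K y env in
    refine (@mod_evalP K V env u v _);
    cbv [mod_coef_eq mod_coef nat_eqb size];
    repeat split; try ring
  end.

Section LinearRules.
Variables (K : pzRingType) (U V : lmodType K).

(** The product of rules serves as a single multirule for [rewrite], also for maps such as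
    [fun a => st a b] that carry no canonical linear structure. *)
Lemma lin_rulesP (f : U -> V) : linear f ->
  ((forall x y : U, (f (x + y) = f x + f y)%R) * (forall x : U, (f (- x) = - f x)%R) *
   (forall (k : K) (x : U), (f (k *: x) = k *: f x)%R) * (f 0 = 0)%R *
   (forall (I : Type) (r : seq I) (P : pred I) (F : I -> U),
      (f (\sum_(i <- r | P i) F i) = \sum_(i <- r | P i) f (F i))%R))%type.
Proof.
move=> lf.
have fD x y : f (x + y) = f x + f y by rewrite -{1}(scale1r x) lf scale1r.
have f0 : f 0 = 0 by apply: (addrI (f 0)); rewrite -fD !addr0.
have fZ k x : f (k *: x) = k *: f x by rewrite -[k *: x]addr0 lf f0 addr0.
do !split => //; first by move=> x; rewrite -scaleN1r fZ scaleN1r.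
by move=> I r P F; exact: (big_morph f fD f0).
Qed.
End LinearRules.

(** For a map given as an abstraction the rules contain beta-redexes, and [rewrite] would not find
    their left-hand sides; their type is reduced first. *)
Ltac lin_beta p :=
  let t := type of (lin_rulesP p) in let t := eval cbv beta in t in
  exact (lin_rulesP p : t).

Section ExteriorCalculus.
Variables (n : nat) (K : comNzRingType).
Implicit Types (V W : lmodType K) (I : {set 'I_n}) (a b : 'I_n).

Lemma positionE a I : position a I = (\sum_(b in I) (b < a))%N.
Proof.
rewrite /position -sum1_card big_mkcondr /=.
by apply: eq_bigr => b _; case: (b < a)%N.
Qed.

Lemma positionU1 a b I : b \notin I -> position a (b |: I) = ((b < a) + position a I)%N.
Proof. by move=> bI; rewrite !positionE big_setU1. Qed.

Lemma positionD1 a b I : b \in I -> position a I = ((b < a) + position a (I :\ b))%N.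
Proof. by move=> bI; rewrite !positionE (big_setD1 b). Qed.

Lemma ext_wedge_linear V a : linear (@ext_wedge n K V a).
Proof.
move=> k x y; apply/ffunP => I; rewrite !ffunE; case: ifP => _.
  by rewrite scalerDr !scalerA mulrC.
by rewrite scaler0 addr0.
Qed.
HB.instance Definition _ V a := GRing.isLinear.Build K (ext n V) (ext n V) _
  (@ext_wedge n K V a) (@ext_wedge_linear V a).

Lemma ext_insert_linear V a : linear (@ext_insert n K V a).
Proof.
move=> k x y; apply/ffunP => I; rewrite !ffunE; case: ifP => _.
  by rewrite scaler0 addr0.
by rewrite scalerDr !scalerA mulrC.
Qed.
HB.instance Definition _ V a := GRing.isLinear.Build K (ext n V) (ext n V) _
  (@ext_insert n K V a) (@ext_insert_linear V a).

Lemma ext0_linear V : linear (@ext0 n K V).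
Proof.
move=> k x y; apply/ffunP => I; rewrite !ffunE; case: ifP => _ //.
by rewrite scaler0 addr0.
Qed.
HB.instance Definition _ V := GRing.isLinear.Build K V (ext n V) _
  (@ext0 n K V) (@ext0_linear V).

Lemma ext_map_linear V W (f : {linear V -> W}) : linear (@ext_map n K V W f).
Proof. by move=> k x y; apply/ffunP => I; rewrite !ffunE linearP. Qed.
HB.instance Definition _ V W (f : {linear V -> W}) :=
  GRing.isLinear.Build K (ext n V) (ext n W) _
  (@ext_map n K V W f) (@ext_map_linear V W f).

Lemma ext_smap_linear V W (f : {linear V -> W}) : linear (@ext_smap n K V W f).
Proof.
move=> k x y; apply/ffunP => I; rewrite !ffunE linearP.
by rewrite scalerDr !scalerA mulrC.
Qed.
HB.instance Definition _ V W (f : {linear V -> W}) :=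
  GRing.isLinear.Build K (ext n V) (ext n W) _
  (@ext_smap n K V W f) (@ext_smap_linear V W f).

Lemma ext_wedgeC V a b (x : ext n V) :
  ext_wedge a (ext_wedge b x) = - ext_wedge b (ext_wedge a x).
Proof.
apply/ffunP => I; rewrite !ffunE; have [<-|ab] := eqVneq a b.
  by rewrite !inE eqxx /= scaler0 if_same oppr0.
have ba : b != a by rewrite eq_sym.
rewrite !inE ab ba /=; case: ifP => aI; case: ifP => bI; rewrite ?scaler0 ?oppr0 //.
rewrite !scalerA -!exprD -scaleNr finset.setDDl finset.setUC -finset.setDDl.
(* Removing [a] and [b] in either order leaves the same set; the exponents differ in parity because
   exactly one of [a < b] and [b < a] holds. *)
congr (_ *: _); apply: sign_parityN.
rewrite (positionD1 a bI) (positionD1 b aI) /= !oddD.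
by case: ltngtP ab => [||/val_inj->]; rewrite ?eqxx // => _ _; odd_cases.
Qed.

Lemma ext_insertC V a b (x : ext n V) :
  ext_insert a (ext_insert b x) = - ext_insert b (ext_insert a x).
Proof.
apply/ffunP => I; rewrite !ffunE; have [<-|ab] := eqVneq a b.
  by rewrite !inE eqxx /= scaler0 if_same oppr0.
have ba : b != a by rewrite eq_sym.
rewrite !inE (negPf ab) (negPf ba) /=.
case: ifP => aI; case: ifP => bI; rewrite ?scaler0 ?oppr0 //.
rewrite !scalerA -!exprD -scaleNr finset.setUCA.
congr (_ *: _); apply: sign_parityN.
rewrite !positionU1 ?aI ?bI //= !oddD.
by case: ltngtP ab => [||/val_inj->]; rewrite ?eqxx // => _ _; odd_cases.
Qed.

Lemma ext_insert_wedge V a b (x : ext n V) :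
  ext_insert a (ext_wedge b x) = (a == b)%:R *: x - ext_wedge b (ext_insert a x).
Proof.
apply/ffunP => I; rewrite !ffunE; have [<-|ab] := eqVneq a b.
  rewrite !inE eqxx /= scale1r; case: ifP => aI.
    rewrite scalerA -exprD finset.setD1K // (positionD1 a aI) ltnn add0n.
    by rewrite -signr_odd oddD addbb expr0 scale1r subrr.
  by rewrite oppr0 addr0 positionU1 ?aI // ltnn add0n finset.setU1K ?aI //
    scalerA -exprD -signr_odd oddD addbb expr0 scale1r.
have ba : b != a by rewrite eq_sym.
rewrite !inE ab (negPf ba) scale0r add0r /=.
case: ifP => aI; case: ifP => bI; rewrite ?scaler0 ?oppr0 //.
have -> : (a |: I) :\ b = a |: I :\ b.
  by apply/setP => d; rewrite !inE; case: eqVneq => // ->; rewrite (negPf ba).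
rewrite !scalerA -!exprD -scaleNr; congr (_ *: _); apply: sign_parityN.
rewrite positionU1 ?aI // (positionD1 a bI) /= !oddD.
by case: ltngtP ab => [||/val_inj->]; rewrite ?eqxx // => _ _; odd_cases.
Qed.

Lemma ext_insert0 V a (v : V) : ext_insert a (ext0 n v) = 0.
Proof.
apply/ffunP => I; rewrite !ffunE; case: ifP => // aI.
case: ifP => [/eqP h|]; last by rewrite scaler0.
by have := setU11 a I; rewrite h inE.
Qed.

Lemma ext_map0 V W (f : {linear V -> W}) v : ext_map f (ext0 n v) = ext0 n (f v).
Proof. by apply/ffunP => I; rewrite !ffunE; case: ifP => //; rewrite linear0. Qed.

Lemma ext_smap0 V W (f : {linear V -> W}) v : ext_smap f (ext0 n v) = ext0 n (f v).
Proof.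
apply/ffunP => I; rewrite !ffunE; case: ifP => [/eqP->|]; last by rewrite linear0 scaler0.
by rewrite cards0 expr0 scale1r.
Qed.

Lemma ext_map_wedge V W (f : {linear V -> W}) a x :
  ext_map f (ext_wedge a x) = ext_wedge a (ext_map f x).
Proof.
by apply/ffunP => I; rewrite !ffunE; case: ifP => _; rewrite ?linearZ ?linear0.
Qed.

Lemma ext_map_insert V W (f : {linear V -> W}) a x :
  ext_map f (ext_insert a x) = ext_insert a (ext_map f x).
Proof.
by apply/ffunP => I; rewrite !ffunE; case: ifP => _; rewrite ?linearZ ?linear0.
Qed.

Lemma ext_smap_wedge V W (f : {linear V -> W}) a x :
  ext_smap f (ext_wedge a x) = - ext_wedge a (ext_smap f x).
Proof.
apply/ffunP => I; rewrite !ffunE; case: ifP => aI; last by rewrite linear0 scaler0 oppr0.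
rewrite linearZ /= !scalerA -!exprD -scaleNr; congr (_ *: _).
apply: sign_parityN; rewrite (cardsD1 a I) aI /= !oddD.
odd_cases.
Qed.

Lemma ext_smap_insert V W (f : {linear V -> W}) a x :
  ext_smap f (ext_insert a x) = - ext_insert a (ext_smap f x).
Proof.
apply/ffunP => I; rewrite !ffunE; case: ifP => aI; first by rewrite linear0 scaler0 oppr0.
rewrite linearZ /= !scalerA -!exprD -scaleNr; congr (_ *: _).
apply: sign_parityN; rewrite cardsU1 aI /= !oddD.
odd_cases.
Qed.

Lemma ext_smap_smap V1 V2 V3 (f : {linear V2 -> V3}) (h : V1 -> V2) (x : ext n V1) :
  ext_smap f (ext_smap h x) = ext_map (f \o h) x.
Proof.
apply/ffunP => I; rewrite !ffunE linearZ /= scalerA -exprD -signr_odd.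
by rewrite oddD addbb expr0 scale1r.
Qed.

Lemma ext_map_map V1 V2 V3 (f : V2 -> V3) (h : V1 -> V2) (x : ext n V1) :
  ext_map f (ext_map h x) = ext_map (f \o h) x.
Proof. by apply/ffunP => I; rewrite !ffunE. Qed.

Lemma ext_smap_map V1 V2 V3 (f : V2 -> V3) (h : V1 -> V2) (x : ext n V1) :
  ext_smap f (ext_map h x) = ext_smap (f \o h) x.
Proof. by apply/ffunP => I; rewrite !ffunE. Qed.

Lemma ext_map_smap V1 V2 V3 (f : {linear V2 -> V3}) (h : V1 -> V2) (x : ext n V1) :
  ext_map f (ext_smap h x) = ext_smap (f \o h) x.
Proof. by apply/ffunP => I; rewrite !ffunE linearZ. Qed.

Definition ext_single V I (v : V) : ext n V := [ffun L => if L == I then v else 0].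

Lemma ext_single_sum V (x : ext n V) : x = \sum_I ext_single I (x I).
Proof.
apply/ffunP => I; rewrite sum_ffunE (bigD1 I) //= ffunE eqxx big1 ?addr0 // => L LI.
by rewrite ffunE eq_sym (negPf LI).
Qed.

(** Every element is a sum of monomials, and the monomial at a nonempty [I] is, up to sign, the
    wedge of any [a] in [I] with the monomial at [I :\ a]. *)
Lemma ext_ind V (P : ext n V -> Prop) :
  (forall x y, P x -> P y -> P (x + y)) -> (forall v, P (ext0 n v)) ->
  (forall a x, P x -> P (ext_wedge a x)) -> forall x, P x.
Proof.
move=> PD P0 Pw x.
have Pz : P 0 by have := P0 0; rewrite linear0.
rewrite (ext_single_sum x); apply: (big_ind P) => // I _; move: (x I).
elim: {I}#|I| {-2}I (erefl #|I|) => [|k IH] I cI v.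
  by move/eqP: cI; rewrite cards_eq0 => /eqP->; exact: P0.
have [I0|[a aI]] := set_0Vmem I; first by rewrite I0 cards0 in cI.
have cI' : #|I :\ a| = k by move: cI; rewrite (cardsD1 a I) aI => -[].
suff -> : ext_single I v = ext_wedge a (ext_single (I :\ a) ((-1) ^+ position a I *: v)).
  exact/Pw/IH.
apply/ffunP => L; rewrite !ffunE; have [->|LI] := eqVneq L I; first by rewrite aI eqxx scalerA -exprD -signr_odd oddD addbb expr0 scale1r.
case: ifP => // aL; case: (L :\ a =P I :\ a) => [h|]; last by rewrite scaler0.
by case/eqP: LI; rewrite -(finset.setD1K aL) h finset.setD1K.
Qed.

(** The degree as an operator, so that gradings can be carried through sums by commutation rules. *)
Definition ext_num V (x : ext n V) : ext n V := [ffun I : {set 'I_n} => x I *+ #|I|].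

Lemma ext_num_linear V : linear (@ext_num V).
Proof. by move=> k x y; apply/ffunP => I; rewrite !ffunE mulrnDl scalerMnr. Qed.
HB.instance Definition _ V := GRing.isLinear.Build K (ext n V) (ext n V) _
  (@ext_num V) (@ext_num_linear V).

Lemma ext_num0 V (v : V) : ext_num (ext0 n v) = 0.
Proof.
apply/ffunP => I; rewrite !ffunE; case: eqVneq => [->|]; last by rewrite mul0rn.
by rewrite cards0.
Qed.

Lemma ext_num_wedge V a (x : ext n V) :
  ext_num (ext_wedge a x) = ext_wedge a (ext_num x) + ext_wedge a x.
Proof.
apply/ffunP => I; rewrite !ffunE; case: ifP => aI; last by rewrite mul0rn addr0.
by rewrite (cardsD1 a I) aI add1n -scalerDr -mulrSr scalerMnr.
Qed.

Lemma ext_num_insert V a (x : ext n V) :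
  ext_num (ext_insert a x) = ext_insert a (ext_num x) - ext_insert a x.
Proof.
apply/ffunP => I; rewrite !ffunE; case: ifP => aI; first by rewrite mul0rn subr0.
by rewrite cardsU1 aI add1n -scalerBr mulrSr addrK scalerMnr.
Qed.

Lemma ext_num_map V W (f : {linear V -> W}) x :
  ext_num (ext_map f x) = ext_map f (ext_num x).
Proof. by apply/ffunP => I; rewrite !ffunE linearMn. Qed.

Lemma ext_num_smap V W (f : {linear V -> W}) x :
  ext_num (ext_smap f x) = ext_smap f (ext_num x).
Proof. by apply/ffunP => I; rewrite !ffunE linearMn scalerMnr. Qed.

Definition ext_wedge_lin V a := lin_rulesP (@ext_wedge_linear V a).
Definition ext_insert_lin V a := lin_rulesP (@ext_insert_linear V a).
Definition ext0_lin V := lin_rulesP (@ext0_linear V).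
Definition ext_map_lin V W (f : {linear V -> W}) := lin_rulesP (ext_map_linear f).
Definition ext_num_lin V := lin_rulesP (@ext_num_linear V).
Definition ext_smap_lin V W (f : {linear V -> W}) := lin_rulesP (ext_smap_linear f).

End ExteriorCalculus.

(** * Clifford products and the BRST charge *)

Section BigradedCalculus.
Variables (n : nat) (K : comNzRingType) (F : lmodType K).
Local Notation A := (ext n (ext n F)).
Implicit Types (a b : A) (c d : 'I_n) (x : ext n F).

(** The sign in [ext_smap] makes the operators on antighosts anticommute with those on ghosts; all
    together they obey the relations of one exterior algebra, that of the sum of g* and g. *)
Definition inner_wedge c a : A := ext_smap (ext_wedge c) a.
Definition inner_insert c a : A := ext_smap (ext_insert c) a.
Definition ext_parity a : A := ext_smap (ext_smap idfun) a.
Definition coef_op (f : F -> F) a : A := ext_map (ext_map f) a.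

HB.instance Definition _ c := GRing.isLinear.Build K A A _ (inner_wedge c)
  (ext_smap_linear (ext_wedge c)).
HB.instance Definition _ c := GRing.isLinear.Build K A A _ (inner_insert c)
  (ext_smap_linear (ext_insert c)).
HB.instance Definition _ := GRing.isLinear.Build K A A _ ext_parity
  (ext_smap_linear (ext_smap idfun)).
HB.instance Definition _ (f : {linear F -> F}) := GRing.isLinear.Build K A A _
  (coef_op f) (ext_map_linear (ext_map f)).

Definition ghost a : A := locked (ext_num a - ext_map (@ext_num n K F) a).

Lemma ghostE a : ghost a = ext_num a - ext_map (@ext_num n K F) a.
Proof. by rewrite /ghost -lock. Qed.

Definition inner_wedge_lin c := lin_rulesP (ext_smap_linear (ext_wedge c) : linear (inner_wedge c)).
Definition inner_insert_lin c := lin_rulesP (ext_smap_linear (ext_insert c) : linear (inner_insert c)).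
Definition ext_parity_lin := lin_rulesP (ext_smap_linear (ext_smap idfun) : linear ext_parity).
Definition coef_op_lin (f : {linear F -> F}) :=
  lin_rulesP (ext_map_linear (ext_map f) : linear (coef_op f)).

Lemma inner_wedgeC c d a : inner_wedge c (inner_wedge d a) = - inner_wedge d (inner_wedge c a).
Proof.
rewrite /inner_wedge /= !ext_smap_smap; apply/ffunP => I.
by rewrite ffunE [RHS]ffunE ffunE /= ext_wedgeC.
Qed.

Lemma inner_insertC c d a : inner_insert c (inner_insert d a) = - inner_insert d (inner_insert c a).
Proof.
rewrite /inner_insert /= !ext_smap_smap; apply/ffunP => I.
by rewrite ffunE [RHS]ffunE ffunE /= ext_insertC.
Qed.

Lemma inner_insert_wedge c d a :
  inner_insert c (inner_wedge d a) = (c == d)%:R *: a - inner_wedge d (inner_insert c a).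
Proof.
rewrite /inner_insert /inner_wedge /= !ext_smap_smap; apply/ffunP => I.
by rewrite ffunE [RHS]ffunE [X in X + _]ffunE [X in _ + X]ffunE ffunE /= ext_insert_wedge.
Qed.

Lemma inner_wedge_wedge c d a : inner_wedge c (ext_wedge d a) = - ext_wedge d (inner_wedge c a).
Proof. exact: ext_smap_wedge. Qed.
Lemma inner_wedge_insert c d a : inner_wedge c (ext_insert d a) = - ext_insert d (inner_wedge c a).
Proof. exact: ext_smap_insert. Qed.
Lemma inner_insert_outer_wedge c d a :
  inner_insert c (ext_wedge d a) = - ext_wedge d (inner_insert c a).
Proof. exact: ext_smap_wedge. Qed.
Lemma inner_insert_outer_insert c d a :
  inner_insert c (ext_insert d a) = - ext_insert d (inner_insert c a).
Proof. exact: ext_smap_insert. Qed.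

Lemma inner_wedge0 c x : inner_wedge c (ext0 n x) = ext0 n (ext_wedge c x).
Proof. exact: ext_smap0. Qed.

Lemma ext_parity_wedge c a : ext_parity (ext_wedge c a) = - ext_wedge c (ext_parity a).
Proof. exact: ext_smap_wedge. Qed.
Lemma ext_parity_insert c a : ext_parity (ext_insert c a) = - ext_insert c (ext_parity a).
Proof. exact: ext_smap_insert. Qed.

Lemma ext_parity_inner_wedge c a : ext_parity (inner_wedge c a) = - inner_wedge c (ext_parity a).
Proof.
rewrite /ext_parity /inner_wedge /= !ext_smap_smap; apply/ffunP => I.
by rewrite ffunE [RHS]ffunE ffunE /= ext_smap_wedge.
Qed.
Lemma ext_parity_inner_insert c a :
  ext_parity (inner_insert c a) = - inner_insert c (ext_parity a).
Proof.
rewrite /ext_parity /inner_insert /= !ext_smap_smap; apply/ffunP => I.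
by rewrite ffunE [RHS]ffunE ffunE /= ext_smap_insert.
Qed.
Lemma ext_parity0 f : ext_parity (ext0 n (ext0 n f)) = ext0 n (ext0 n f).
Proof. by rewrite /ext_parity /= ext_smap0 /= ext_smap0. Qed.
Lemma ext_parity_ext0 x : ext_parity (ext0 n x) = ext0 n (ext_smap idfun x).
Proof. exact: ext_smap0. Qed.
Lemma inner_insert0 c f : inner_insert c (ext0 n (ext0 n f)) = 0.
Proof. by rewrite /inner_insert ext_smap0 /= ext_insert0 ext0_lin. Qed.
Lemma ext_parityK : involutive ext_parity.
Proof.
move=> a; rewrite /ext_parity /= ext_smap_smap; apply/ffunP => I.
rewrite ffunE /= ext_smap_smap; by apply/ffunP => J; rewrite ffunE.
Qed.

Lemma coef_op_wedge (f : {linear F -> F}) c a : coef_op f (ext_wedge c a) = ext_wedge c (coef_op f a).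
Proof. exact: ext_map_wedge. Qed.
Lemma coef_op_insert (f : {linear F -> F}) c a : coef_op f (ext_insert c a) = ext_insert c (coef_op f a).
Proof. exact: ext_map_insert. Qed.
Lemma coef_op_inner_wedge (f : {linear F -> F}) c a : coef_op f (inner_wedge c a) = inner_wedge c (coef_op f a).
Proof.
rewrite /coef_op /inner_wedge /= ext_map_smap ext_smap_map; apply/ffunP => I.
by rewrite !(ffunE (fun _ => _ *: _)) /= ext_map_wedge.
Qed.
Lemma coef_op_inner_insert (f : {linear F -> F}) c a : coef_op f (inner_insert c a) = inner_insert c (coef_op f a).
Proof.
rewrite /coef_op /inner_insert /= ext_map_smap ext_smap_map; apply/ffunP => I.
by rewrite !(ffunE (fun _ => _ *: _)) /= ext_map_insert.
Qed.
Lemma coef_op_parity (f : {linear F -> F}) a : coef_op f (ext_parity a) = ext_parity (coef_op f a).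
Proof.
rewrite /coef_op /ext_parity /= ext_map_smap ext_smap_map; apply/ffunP => I.
by rewrite !(ffunE (fun _ => _ *: _)) /= ext_map_smap ext_smap_map.
Qed.
Lemma coef_map0 (f : {linear F -> F}) g : coef_op f (ext0 n (ext0 n g)) = ext0 n (ext0 n (f g)).
Proof. by rewrite /coef_op /= ext_map0 /= ext_map0. Qed.
Lemma ghost_linear : linear ghost.
Proof. move=> k a b; rewrite !ghostE ?(ext_num_lin, ext_map_lin); module_eq K (A : lmodType K). Qed.
HB.instance Definition _ := GRing.isLinear.Build K A A _ ghost ghost_linear.

Definition ghost_lin := lin_rulesP ghost_linear.

Lemma ghost_wedge c a : ghost (ext_wedge c a) = ext_wedge c (ghost a) + ext_wedge c a.
Proof. by rewrite !ghostE ext_num_wedge ext_map_wedge linearB /= addrAC. Qed.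
Lemma ghost_insert c a : ghost (ext_insert c a) = ext_insert c (ghost a) - ext_insert c a.
Proof. by rewrite !ghostE ext_num_insert ext_map_insert linearB /= addrAC. Qed.
Lemma ghost_inner_wedge c a : ghost (inner_wedge c a) = inner_wedge c (ghost a) - inner_wedge c a.
Proof.
rewrite !ghostE /inner_wedge /= ext_num_smap ext_map_smap linearB /= -addrA -opprD; congr (_ - _).
rewrite ext_smap_map; apply/ffunP => I.
rewrite !(ffunE (fun _ => _ *: _)) /= [RHS]ffunE !(ffunE (fun _ => _ *: _)) /=.
by rewrite ext_num_wedge scalerDr.
Qed.
Lemma ghost_coef_map (f : {linear F -> F}) a : ghost (coef_op f a) = coef_op f (ghost a).
Proof.
rewrite !ghostE /coef_op /= linearB /= ext_num_map !ext_map_map; congr (_ - _).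
by apply/ffunP => I; rewrite !ffunE /= ext_num_map.
Qed.
Lemma ghost0 f : ghost (ext0 n (ext0 n f)) = 0.
Proof. by rewrite !ghostE ext_num0 ext_map0 /= ext_num0 linear0 subr0. Qed.

(** Words are built with the ghosts to the left of the antighosts, so antighosts are only ever put
    in front of elements [ext0 n x]. This is the form in which [cl_st_inner0] can be applied. *)
Lemma bigraded_ind (P : A -> Prop) :
  (forall a b, P a -> P b -> P (a + b)) ->
  (forall f, P (ext0 n (ext0 n f))) ->
  (forall c x, P (ext0 n x) -> P (inner_wedge c (ext0 n x))) ->
  (forall c a, P a -> P (ext_wedge c a)) -> forall a, P a.
Proof.
move=> PD P0 PH PE; apply: ext_ind => //; apply: ext_ind => //.
- by move=> x y Px Py; rewrite linearD; exact: PD.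
- by move=> c x Px; rewrite -inner_wedge0; exact: PH.
Qed.

Definition calculus_lin := (ext_wedge_lin, ext_insert_lin, inner_wedge_lin, inner_insert_lin,
  ext_parity_lin, coef_op_lin, ghost_lin, @ext0_lin n K F,
  @ext0_lin n K (ext n F : lmodType K)).

End BigradedCalculus.

Section CliffordProduct.
Variables (n : nat) (K : comNzRingType) (F : lmodType K) (kap : K).
Local Notation A := (ext n (ext n F)).
Implicit Types (a b : A) (c d : 'I_n) (x : ext n F) (f g : F).
Local Ltac modeq := module_eq K (A : lmodType K).

(* The lock keeps unification from exposing the sum. *)
Definition clifford_wedge c a : A := locked (inner_wedge c a + kap *: ext_insert c a).

Lemma clifford_wedgeE c a : clifford_wedge c a = inner_wedge c a + kap *: ext_insert c a.
Proof. by rewrite /clifford_wedge -lock. Qed.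

Lemma clifford_wedge_linear c : linear (clifford_wedge c).
Proof. by move=> k a b; rewrite !clifford_wedgeE ?(calculus_lin n F); modeq. Qed.
Definition clifford_wedge_lin c := lin_rulesP (clifford_wedge_linear c).

(* The last three rules determine the product: they exhibit left multiplication as
   a representation of the generators e^c, e_c and f of the algebra. *)
Record clifford_product := CliffordProduct {
  cl_mul : F -> {linear F -> F};
  cl_mulr : F -> {linear F -> F};
  cl_one : F;
  cl_st : A -> {linear A -> A};
  cl_str : A -> {linear A -> A};
  cl_mulrE : forall f g, cl_mulr g f = cl_mul f g;
  cl_mulA : forall f g h, cl_mul f (cl_mul g h) = cl_mul (cl_mul f g) h;
  cl_mul1 : forall f, cl_mul cl_one f = f;
  cl_mulx1 : forall f, cl_mul f cl_one = f;
  cl_strE : forall a b, cl_str b a = cl_st a b;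
  cl_st_wedge : forall c a b, cl_st (ext_wedge c a) b = ext_wedge c (cl_st a b);
  cl_st_inner0 : forall c x b, cl_st (inner_wedge c (ext0 n x)) b =
     clifford_wedge c (cl_st (ext0 n x) b);
  cl_st_coef : forall f b, cl_st (ext0 n (ext0 n f)) b = coef_op (cl_mul f) b }.

Variable P : clifford_product.
Local Notation mul := (cl_mul P).
Local Notation mulr := (cl_mulr P).
Local Notation one := (cl_one P).
Local Notation st := (cl_st P).
Local Notation oneA := (ext0 n (ext0 n one)).
Local Notation mulrE := (cl_mulrE P).
Local Notation mulA := (cl_mulA P).
Local Notation mul1 := (cl_mul1 P).
Local Notation mulx1 := (cl_mulx1 P).
Local Notation strE := (cl_strE P).
Local Notation st_wedge := (cl_st_wedge P).
Local Notation st_inner0 := (cl_st_inner0 P).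
Local Notation st_coef := (cl_st_coef P).

Lemma st_linearl b : linear (fun a => st a b).
Proof. by move=> k a a'; rewrite -!strE linearP. Qed.

Definition st_linl b := ltac:(lin_beta (st_linearl b)).
Lemma st_linearr a : linear (st a).
Proof. by move=> k b b'; rewrite linearP. Qed.
Definition st_linr a := lin_rulesP (st_linearr a).

Definition lin_all := (calculus_lin n F, clifford_wedge_lin, st_linl, st_linr).

Lemma clifford_wedge_wedge c d a :
  clifford_wedge c (ext_wedge d a) = (kap * (c == d)%:R) *: a - ext_wedge d (clifford_wedge c a).
Proof.
by rewrite !clifford_wedgeE inner_wedge_wedge ext_insert_wedge ?(lin_all); modeq.
Qed.

Lemma clifford_coef (f : {linear F -> F}) c a :
  clifford_wedge c (coef_op f a) = coef_op f (clifford_wedge c a).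
Proof. by rewrite !clifford_wedgeE ?(lin_all) coef_op_inner_wedge coef_op_insert. Qed.

Lemma clifford_wedge0 c x : clifford_wedge c (ext0 n x) = inner_wedge c (ext0 n x).
Proof. by rewrite !clifford_wedgeE ext_insert0 scaler0 addr0. Qed.

(** [cl_st_inner0] describes left multiplication by e_c only in front of elements without ghosts. It
    extends to all of A because e_c passes a ghost e^d by the same relation, [clifford_wedge_wedge],
    inside the first factor and in front of the product. *)
Lemma st_clifford c a b : st (clifford_wedge c a) b = clifford_wedge c (st a b).
Proof.
elim/bigraded_ind: a => [a a' IH IH'|f|d x IH|d a IH].
- by rewrite ?(lin_all) IH IH' ?(lin_all).
- by rewrite clifford_wedge0 st_inner0.
- by rewrite inner_wedge0 clifford_wedge0 st_inner0.
- by rewrite clifford_wedge_wedge ?(lin_all) !st_wedge IH clifford_wedge_wedge.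
Qed.

Lemma st_coef_map f a b : st (coef_op (mul f) a) b = coef_op (mul f) (st a b).
Proof.
elim/bigraded_ind: a => [a a' IH IH'|g|c x IH|c a IH].
- by rewrite ?(lin_all) IH IH' ?(lin_all).
- rewrite coef_map0 !st_coef; apply/ffunP => I; rewrite !ffunE.
  by apply/ffunP => J; rewrite !ffunE mulA.
- rewrite coef_op_inner_wedge st_inner0 -clifford_coef -IH.
  by rewrite /coef_op /= ext_map0 st_inner0.
- by rewrite coef_op_wedge !st_wedge IH coef_op_wedge.
Qed.

(** Left multiplication by each kind of generator commutes with forming a product from the right,
    and [a] is a combination of words in the generators. *)
Lemma stA a b a3 : st a (st b a3) = st (st a b) a3.
Proof.
elim/bigraded_ind: a => [a a' IH IH'|g|d x IH|d a IH].
- by rewrite ?(lin_all) IH IH' ?(lin_all).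
- by rewrite !st_coef st_coef_map.
- by rewrite !st_inner0 IH st_clifford.
- by rewrite !st_wedge IH.
Qed.

Lemma st1 a : st oneA a = a.
Proof. by rewrite st_coef; apply/ffunP => I; rewrite !ffunE; apply/ffunP => J; rewrite ffunE mul1. Qed.

(* Right multiplication by e^c, composed with the parity automorphism. *)
Definition coclifford_wedge c a : A := locked (ext_wedge c a - kap *: inner_insert c a).

Lemma coclifford_wedgeE c a : coclifford_wedge c a = ext_wedge c a - kap *: inner_insert c a.
Proof. by rewrite /coclifford_wedge -lock. Qed.

Lemma coclifford_wedge_linear c : linear (coclifford_wedge c).
Proof. move=> k a b; rewrite !coclifford_wedgeE !linearP /=; modeq. Qed.
HB.instance Definition _ c := GRing.isLinear.Build K A A _
  (coclifford_wedge c) (coclifford_wedge_linear c).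
Definition coclifford_wedge_lin c := lin_rulesP (coclifford_wedge_linear c).
Definition lin_all' := (lin_all, coclifford_wedge_lin).

Lemma coclifford_wedge_wedge c d a :
  coclifford_wedge c (ext_wedge d a) = - ext_wedge d (coclifford_wedge c a).
Proof.
rewrite !coclifford_wedgeE ?(lin_all') [ext_wedge c _]ext_wedgeC inner_insert_outer_wedge.
modeq.
Qed.

(** Left multiplication by e_d and twisted right multiplication by e^c each contract with the other;
    the two Kronecker terms are both [kap] and cancel. This compatibility drives the induction in
    [st_par_wedge1]. *)
Lemma coclifford_clifford c d a :
  coclifford_wedge c (clifford_wedge d a) = - clifford_wedge d (coclifford_wedge c a).
Proof.
rewrite !coclifford_wedgeE ?(lin_all') clifford_wedge_wedge !clifford_wedgeE.
rewrite ?(lin_all') inner_insert_wedge inner_insert_outer_insert.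
rewrite [d == c]eq_sym; modeq.
Qed.

Lemma st_par_wedge1 c a : st (ext_parity a) (ext_wedge c oneA) = coclifford_wedge c a.
Proof.
elim/bigraded_ind: a => [a a' IH IH'|g|d x IH|d a IH].
- by rewrite ?(lin_all') ?(lin_all) IH IH' ?(lin_all').
- rewrite ext_parity0 st_coef coef_op_wedge coef_map0 mulx1 !coclifford_wedgeE.
  by rewrite inner_insert0 scaler0 subr0.
- rewrite ext_parity_inner_wedge ?(lin_all) ext_parity_ext0 st_inner0.
  by rewrite -ext_parity_ext0 IH -coclifford_clifford clifford_wedge0.
- by rewrite ext_parity_wedge ?(lin_all) st_wedge IH coclifford_wedge_wedge.
Qed.

(** No contraction term: the exponential inserts into the ghosts of the second factor, and e_c has
    none. This asymmetry with [st_par_wedge1] is what standard ordering means. *)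
Lemma st_par_inner1 c a : st (ext_parity a) (inner_wedge c oneA) = inner_wedge c a.
Proof.
elim/bigraded_ind: a => [a a' IH IH'|g|d x IH|d a IH].
- by rewrite ?(lin_all') ?(lin_all) IH IH' ?(lin_all').
- by rewrite ext_parity0 st_coef coef_op_inner_wedge coef_map0 mulx1.
- rewrite ext_parity_inner_wedge ?(lin_all) ext_parity_ext0 st_inner0.
  by rewrite -ext_parity_ext0 IH [RHS]inner_wedgeC [inner_wedge c _]inner_wedge0 clifford_wedge0.
- by rewrite ext_parity_wedge ?(lin_all) st_wedge IH inner_wedge_wedge.
Qed.

Lemma st_coefr g a : st a (ext0 n (ext0 n g)) = coef_op (mulr g) a.
Proof.
elim/bigraded_ind: a => [a a' IH IH'|f|d x IH|d a IH].
- by rewrite ?(lin_all') ?(lin_all) IH IH'.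
- by rewrite st_coef !coef_map0 mulrE.
- by rewrite st_inner0 IH clifford_coef clifford_wedge0.
- by rewrite st_wedge IH coef_op_wedge.
Qed.

Lemma stx1 a : st a oneA = a.
Proof.
rewrite st_coefr; apply/ffunP => I; rewrite !ffunE; apply/ffunP => J.
by rewrite ffunE mulrE mulx1.
Qed.

(** By associativity, a ghost at the left end of the second factor is absorbed into the first
    one. *)
Lemma st_par_wedge c a b :
  st (ext_parity a) (ext_wedge c b) = st (coclifford_wedge c a) b.
Proof. by rewrite -st_par_wedge1 -stA st_wedge st1. Qed.

Lemma st_parity a b : ext_parity (st a b) = st (ext_parity a) (ext_parity b).
Proof.
elim/bigraded_ind: a => [a a' IH IH'|g|d x IH|d a IH].
- by rewrite ?(lin_all') ?(lin_all) ?(lin_all') IH IH' ?(lin_all).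
- by rewrite ext_parity0 !st_coef coef_op_parity.
- rewrite st_inner0 !clifford_wedgeE ?(lin_all') ext_parity_inner_wedge ext_parity_insert IH.
  rewrite ext_parity_inner_wedge ?(lin_all) ext_parity_ext0 st_inner0.
  by rewrite !clifford_wedgeE scalerN -opprD.
- by rewrite st_wedge !ext_parity_wedge ?(lin_all) st_wedge IH.
Qed.

(** Both terms of [clifford_wedge], adding an antighost and removing a ghost, lower the ghost number
    by one. So the deformation respects the ghost number although it mixes bidegrees. *)
Lemma st_ghost a b : ghost (st a b) = st (ghost a) b + st a (ghost b).
Proof.
elim/bigraded_ind: a => [a a' IH IH'|g|d x IH|d a IH].
- rewrite ?(ghost_lin, st_linl) IH IH'; modeq.
- by rewrite ghost0 !st_coef ghost_coef_map ?(lin_all) add0r.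
- have gx : ghost (ext0 n x) = ext0 n (- ext_num x).
    by rewrite !ghostE ext_num0 ext_map0 sub0r ?(lin_all').
  rewrite st_inner0 !clifford_wedgeE ghost_inner_wedge.
  rewrite ?(ghost_lin, inner_wedge_lin, st_linl) ghost_inner_wedge ghost_insert IH.
  rewrite gx !st_inner0 !clifford_wedgeE.
  rewrite ?(inner_wedge_lin, ext_insert_lin, st_linl); modeq.
- by rewrite st_wedge !ghost_wedge IH ?(lin_all) !st_wedge ?(lin_all'); modeq.
Qed.

Lemma st_ghostz a b (z w : int) : ghost a = a *~ z -> ghost b = b *~ w ->
  ghost (st a b) = st a b *~ (z + w).
Proof.
move=> az bw; rewrite st_ghost az bw mulrzDr; congr (_ + _).
  by rewrite -!strE; exact: raddfMz.
exact: raddfMz.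
Qed.

End CliffordProduct.

Lemma sum_swap_anti (V : zmodType) (I : finType) (phi psi : I -> I -> V) :
  (forall a b, phi a b = - psi b a) ->
  \sum_a \sum_b phi a b = - \sum_a \sum_b psi a b.
Proof.
move=> h; rewrite exchange_big -sumrN; apply: eq_bigr => a _.
by rewrite -sumrN; apply: eq_bigr => b _; rewrite h.
Qed.

Lemma sum_symmetric (V : zmodType) n (phi : 'I_n -> 'I_n -> V) :
  (forall a b, phi a b = phi b a) -> (forall a, phi a a = 0) ->
  \sum_a \sum_b phi a b = (\sum_(a < n) \sum_(b < n | (a < b)%N) phi a b) *+ 2.
Proof.
move=> phiC phi0; rewrite mulr2n [X in _ = _ + X](exchange_big_dep xpredT) //= -big_split /=.
apply: eq_bigr => a _; rewrite (bigID (fun b : 'I_n => (a < b)%N)) /=; congr (_ + _).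
rewrite (bigD1 a) ?ltnn //= phi0 add0r; apply: eq_big => [b|b _]; last exact: phiC.
by rewrite -leqNgt ltn_neqAle andbC.
Qed.

Lemma sum_delta (K : pzRingType) (V : lmodType K) (I : finType) (d : I) (phi : I -> V) :
  \sum_a (d == a)%:R *: phi a = phi d.
Proof.
rewrite (bigD1 d) //= eqxx scale1r big1 ?addr0 // => a /negPf ad.
by rewrite eq_sym ad scale0r.
Qed.

Lemma sum_rotate (V : nmodType) (I : finType) (f : I -> I -> I -> V) :
  \sum_a \sum_b \sum_c f a b c = \sum_a \sum_b \sum_c f b c a.
Proof.
transitivity (\sum_a \sum_c \sum_b f a b c); last exact: exchange_big.
by apply: eq_bigr => a _; exact: exchange_big.
Qed.

Lemma sum_rotate' (V : nmodType) (I : finType) (f : I -> I -> I -> V) :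
  \sum_a \sum_b \sum_c f a b c = \sum_a \sum_b \sum_c f c a b.
Proof. by rewrite exchange_big; apply: eq_bigr => a _; exact: exchange_big. Qed.

(** Identities between nested sums are proved by one such step for each index, ending with
    [module_eq] on a single summand. *)
Lemma sum_comb4 (K : pzRingType) (V : lmodType K) (I : Type) (r : seq I) (Q : pred I)
    (phi f1 f2 f3 f4 : I -> V) (k1 k2 k3 k4 : K) :
  (forall i, phi i = k1 *: f1 i + k2 *: f2 i + k3 *: f3 i + k4 *: f4 i) ->
  \sum_(i <- r | Q i) phi i = k1 *: (\sum_(i <- r | Q i) f1 i)
    + k2 *: (\sum_(i <- r | Q i) f2 i) + k3 *: (\sum_(i <- r | Q i) f3 i)
    + k4 *: (\sum_(i <- r | Q i) f4 i).
Proof. by move=> h; rewrite !scaler_sumr -!big_split; apply: eq_bigr => i _; rewrite h. Qed.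

Lemma sum_comb2 (K : pzRingType) (V : lmodType K) (I : Type) (r : seq I) (Q : pred I)
    (phi f1 f2 : I -> V) (k1 k2 : K) :
  (forall i, phi i = k1 *: f1 i + k2 *: f2 i) ->
  \sum_(i <- r | Q i) phi i = k1 *: (\sum_(i <- r | Q i) f1 i)
    + k2 *: (\sum_(i <- r | Q i) f2 i).
Proof. by move=> h; rewrite !scaler_sumr -!big_split; apply: eq_bigr => i _; rewrite h. Qed.

Lemma sum_comb3 (K : pzRingType) (V : lmodType K) (I : Type) (r : seq I) (Q : pred I)
    (phi f1 f2 f3 : I -> V) (k1 k2 k3 : K) :
  (forall i, phi i = k1 *: f1 i + k2 *: f2 i + k3 *: f3 i) ->
  \sum_(i <- r | Q i) phi i = k1 *: (\sum_(i <- r | Q i) f1 i)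
    + k2 *: (\sum_(i <- r | Q i) f2 i) + k3 *: (\sum_(i <- r | Q i) f3 i).
Proof. by move=> h; rewrite !scaler_sumr -!big_split; apply: eq_bigr => i _; rewrite h. Qed.

Definition linear_rules (K : pzRingType) (U V : lmodType K) (f : {linear U -> V}) :=
  lin_rulesP (@linearP K U V _ f : linear f).

(** * The BRST operator and the square of its charge in an abstract Clifford module *)

Section CliffordModule.
Variables (n : nat) (K : comNzRingType) (A : lmodType K) (ilam : K).
Implicit Types (a b : A) (c d e : 'I_n).
Local Notation kap := (ilam + ilam).

(* The operators of A used by the BRST operator: exterior multiplication and
   insertion on the ghosts (E, I) and on the antighosts (H, Y), and the product. *)
Record clifford_module := CliffordModule {
  cmE : 'I_n -> {linear A -> A}; cmI : 'I_n -> {linear A -> A};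
  cmH : 'I_n -> {linear A -> A}; cmY : 'I_n -> {linear A -> A};
  cm_par : {linear A -> A};
  cm_st : A -> {linear A -> A}; cm_str : A -> {linear A -> A}; cm_one : A;
  cm_EE : forall c d a, cmE c (cmE d a) = - cmE d (cmE c a);
  cm_II : forall c d a, cmI c (cmI d a) = - cmI d (cmI c a);
  cm_HH : forall c d a, cmH c (cmH d a) = - cmH d (cmH c a);
  cm_YY : forall c d a, cmY c (cmY d a) = - cmY d (cmY c a);
  cm_IE : forall c d a, cmI c (cmE d a) = (c == d)%:R *: a - cmE d (cmI c a);
  cm_HE : forall c d a, cmH c (cmE d a) = - cmE d (cmH c a);
  cm_HI : forall c d a, cmH c (cmI d a) = - cmI d (cmH c a);
  cm_YE : forall c d a, cmY c (cmE d a) = - cmE d (cmY c a);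
  cm_parE : forall c a, cm_par (cmE c a) = - cmE c (cm_par a);
  cm_parY : forall c a, cm_par (cmY c a) = - cmY c (cm_par a);
  cm_parK : forall a, cm_par (cm_par a) = a;
  cm_strE : forall a b, cm_str b a = cm_st a b;
  cm_stE : forall c a b, cm_st (cmE c a) b = cmE c (cm_st a b);
  cm_st1 : forall a, cm_st cm_one a = a;
  cm_stx1 : forall a, cm_st a cm_one = a;
  cm_stH1 : forall c a, cm_st (cmH c cm_one) a = cmH c a + kap *: cmI c a;
  cm_st_parE : forall c a b,
    cm_st (cm_par a) (cmE c b) = cm_st (cmE c a - kap *: cmY c a) b;
  cm_st_parH1 : forall c a, cm_st (cm_par a) (cmH c cm_one) = cmH c a }.

End CliffordModule.

Section BrstCharge.
Variables (n : nat) (K : comNzRingType) (A : lmodType K) (ilam : K).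
Implicit Types (x y a : A) (b c d e : 'I_n).
Local Ltac modeq := module_eq K A.
Local Notation kap := (ilam + ilam).
Variable P : clifford_module n A ilam.
Local Notation E := (cmE P).
Local Notation I := (cmI P).
Local Notation H := (cmH P).
Local Notation Y := (cmY P).
Local Notation par := (cm_par P).
Local Notation st := (cm_st P).
Local Notation one := (cm_one P).

(* t c a b is the structure constant f^c_ab; t2 and t4 are its half and quarter.
   The elements jv represent the momentum map; L, R and rho are the left and right
   multiplication by them and the commutator divided by ilam. *)
Variables (t t2 t4 : 'I_n -> 'I_n -> 'I_n -> K) (ch : 'I_n -> K).
Variables (jv : 'I_n -> A) (L R rho : 'I_n -> {linear A -> A}).
Hypotheses (t2E : forall c d b, t2 c d b = t4 c d b + t4 c d b)
  (tE : forall c d b, t c d b = t2 c d b + t2 c d b)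
  (t4C : forall c d b, t4 c d b = - t4 c b d) (t4xx : forall c d, t4 c d d = 0)
  (stj : forall d a, st (jv d) a = L d a) (stjr : forall d a, st a (jv d) = R d a)
  (LrhoE : forall d a, L d a = R d a + ilam *: rho d a)
  (RE : forall d c a, R d (E c a) = E c (R d a))
  (RY : forall d c a, R d (Y c a) = Y c (R d a)).

Lemma cm_st_linearl y : linear (fun x => st x y).
Proof. by move=> k a a'; rewrite -!cm_strE linearP. Qed.
Definition cm_stl y := ltac:(lin_beta (cm_st_linearl y)).
Definition cm_strl a := linear_rules (st a).
Definition cm_lin := (fun c => linear_rules (E c), fun c => linear_rules (H c), fun c => linear_rules (Y c),
  fun c => linear_rules (I c), linear_rules par, cm_stl, cm_strl).
Definition cm_coef_lin := (fun c => linear_rules (L c), fun c => linear_rules (R c),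
  fun c => linear_rules (rho c)).
Local Notation lin := (cm_lin, cm_coef_lin).

Definition brst_Omega : A := - \sum_d \sum_b \sum_c t4 c d b *: E d (E b (H c one)).
Definition brst_J : A := \sum_d E d (jv d).
Definition brst_chi : A := \sum_d ch d *: E d one.
Definition brst_charge : A := brst_Omega + brst_J + ilam *: brst_chi.

Definition ce_op a : A :=
  - (\sum_d \sum_b \sum_c t2 c d b *: E d (E b (I c a)))
  + \sum_d E d (\sum_b \sum_c t c d b *: H c (Y b a))
  + \sum_d E d (rho d a).
Definition koszul_op a : A :=
  \sum_d Y d (R d a) + ilam *: (\sum_d ch d *: Y d a)
  - ilam *: \sum_(d : 'I_n) \sum_(b : 'I_n | (d < b)%N) \sum_c t c d b *: H c (Y b (Y d a)).

Lemma st_word a d b c : st (E d (E b (H c one))) a = E d (E b (H c a + kap *: I c a)).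
Proof. by rewrite !cm_stE cm_stH1. Qed.

(** The two ghosts of the word are moved into the first factor one after the other. The four terms
    are those with no contraction, with one of either ghost, and with both. *)
Lemma st_parity_word a d b c :
  st (par a) (E d (E b (H c one))) =
  E d (E b (H c a)) - kap *: E b (H c (Y d a))
  + kap *: E d (H c (Y b a)) - (kap * kap) *: H c (Y b (Y d a)).
Proof.
(* The exchange rule [cm_st_parE] needs a first factor of the form [par a]; any factor has it
   because [par] is an involution. *)
have step x c' y : st x (E c' y) = st (E c' (par x) - kap *: Y c' (par x)) y.
  by rewrite -{1}[x](cm_parK P) cm_st_parE.
rewrite cm_st_parE step -[X in st X _](cm_parK P) cm_st_parH1.
rewrite ?lin !(cm_parE, cm_parY) ?lin !(cm_parE, cm_parY) cm_parK.
by do 3! rewrite ?lin ?(cm_YE, cm_HE); rewrite [E b (E d _)]cm_EE; modeq.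
Qed.

(** The uncontracted terms cancel. In the rest, [kap] is twice [ilam], which turns the quarters [t4]
    into the halves [t2]; the two single contractions agree by antisymmetry and give [t]; the double
    contraction, collected over [d < b], is the Lie algebra term of the quantum Koszul operator.
    This is the reason for the quarter in Omega. *)
Lemma brst_Omega_commutator a :
  st brst_Omega a - st (par a) brst_Omega =
  ilam *: (- (\sum_d \sum_b \sum_c t2 c d b *: E d (E b (I c a)))
    + \sum_d E d (\sum_b \sum_c t c d b *: H c (Y b a))
    - (ilam *: (\sum_(d : 'I_n) \sum_(b : 'I_n | (d < b)%N) \sum_c t c d b *:
         H c (Y b (Y d a)))) *+ 2).
Proof.
rewrite /brst_Omega ?lin.
pose S1 := \sum_d \sum_b \sum_c t4 c d b *: E d (E b (I c a)).
pose S2 := \sum_d \sum_b \sum_c t4 c d b *: E d (H c (Y b a)).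
pose S3 := \sum_(d : 'I_n) \sum_(b : 'I_n | (d < b)%N) \sum_c t4 c d b *: H c (Y b (Y d a)).
have swap : \sum_d \sum_b \sum_c t4 c d b *: E b (H c (Y d a)) = - S2.
  rewrite /S2 -(sum_swap_anti (phi := fun d b => \sum_c t4 c d b *: E b (H c (Y d a)))) //.
  by move=> d b; rewrite -sumrN; apply: eq_bigr => c _; rewrite t4C scaleNr.
have half : \sum_d \sum_b \sum_c t4 c d b *: H c (Y b (Y d a)) = S3 *+ 2.
  apply: sum_symmetric => [d b|d]; last by apply: big1 => c _; rewrite t4xx scale0r.
  by apply: eq_bigr => c _; rewrite t4C cm_YY ?lin; modeq.
transitivity (- kap *: S1 + - kap *: - S2 + kap *: S2 + - (kap * kap) *: (S3 *+ 2)).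
  rewrite -swap -half /S1 /S2 opprK addrC.
  rewrite -sumrB; apply: sum_comb4 => d; rewrite ?lin -sumrB; apply: sum_comb4 => b.
  rewrite ?lin -sumrB; apply: sum_comb4 => c.
  by rewrite ?lin st_word st_parity_word ?lin; modeq.
have e1 : \sum_d \sum_b \sum_c t2 c d b *: E d (E b (I c a)) = S1 *+ 2.
  rewrite mulr2n /S1 -!big_split; apply: eq_bigr => d _; rewrite -!big_split.
  by apply: eq_bigr => b _; rewrite -!big_split; apply: eq_bigr => c _; rewrite t2E scalerDl.
have e2 : \sum_d E d (\sum_b \sum_c t c d b *: H c (Y b a)) = S2 *+ 4.
  rewrite -sumrMnl; apply: eq_bigr => d _; rewrite ?lin -sumrMnl.
  apply: eq_bigr => b _; rewrite ?lin -sumrMnl; apply: eq_bigr => c _.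
  by rewrite ?lin tE t2E !mulrS !mulr0n; modeq.
have e3 : \sum_(d : 'I_n) \sum_(b : 'I_n | (d < b)%N) \sum_c t c d b *: H c (Y b (Y d a)) = S3 *+ 4.
  rewrite -sumrMnl; apply: eq_bigr => d _; rewrite -sumrMnl.
  apply: eq_bigr => b _; rewrite -sumrMnl; apply: eq_bigr => c _.
  by rewrite tE t2E !mulrS !mulr0n; modeq.
by rewrite e1 e2 e3 !mulrS !mulr0n; modeq.
Qed.

Lemma brst_J_commutator a :
  st brst_J a - st (par a) brst_J =
  ilam *: (\sum_d E d (rho d a) + (\sum_d Y d (R d a)) *+ 2).
Proof.
rewrite /brst_J ?lin -sumrB -sumrMnl -big_split /= scaler_sumr; apply: eq_bigr => d _.
by rewrite cm_stE cm_st_parE stj stjr ?lin LrhoE RE RY ?lin mulr2n; modeq.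
Qed.

Lemma brst_chi_commutator a :
  st brst_chi a - st (par a) brst_chi = (ilam *: \sum_d ch d *: Y d a) *+ 2.
Proof.
rewrite /brst_chi ?lin -sumrB scaler_sumr -sumrMnl; apply: eq_bigr => d _; rewrite ?lin.
by rewrite cm_stE cm_st1 cm_st_parE cm_stx1 mulr2n; modeq.
Qed.

Lemma brst_commutator a :
  st brst_charge a - st (par a) brst_charge = ilam *: (ce_op a + koszul_op a *+ 2).
Proof.
have -> : st brst_charge a - st (par a) brst_charge =
  (st brst_Omega a - st (par a) brst_Omega) + (st brst_J a - st (par a) brst_J)
  + ilam *: (st brst_chi a - st (par a) brst_chi) by rewrite /brst_charge ?lin; modeq.
rewrite brst_Omega_commutator brst_J_commutator brst_chi_commutator /ce_op /koszul_op.
by rewrite !mulr2n; modeq.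
Qed.

Hypotheses (jacobi : forall e b c d, \sum_i (t4 i b c * t4 e i d + t4 i c d * t4 e i b
                                   + t4 i d b * t4 e i c) = 0)
  (chE : forall d b, \sum_c t c d b * ch c = 0)
  (LE : forall d c a, L d (E c a) = E c (L d a))
  (LH : forall d c a, L d (H c a) = H c (L d a))
  (LI : forall d c a, L d (I c a) = I c (L d a))
  (LL : forall d b a, L d (L b a) - L b (L d a) = ilam *: \sum_c t c d b *: L c a)
  (torsion : forall (x : A) k, x *+ k.+1 = 0 -> x = 0).

Lemma eq_opp_eq0 x : x = - x -> x = 0.
Proof. by move=> h; apply: (torsion (k := 1)); rewrite mulr2n {2}h subrr. Qed.

(** [G] is left multiplication by e_c, [M] that by J_d + ilam chi(e_d), and [W] that by the part of
    Omega, quadratic in the ghosts, which stands in front of e_d. Theta acts as the sum of all W_d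
    G_d plus the sum of all E_d M_d, and its square is found by moving every [G] to the right. *)
Definition charge_G c x : A := locked (H c x + kap *: I c x).
Definition charge_M d x : A := locked (L d x + (ilam * ch d) *: x).
Definition charge_W d x : A := locked (- \sum_b \sum_c t4 d b c *: E b (E c x)).

Local Notation G := charge_G.
Local Notation M := charge_M.
Local Notation W := charge_W.

Lemma charge_GE c x : G c x = H c x + kap *: I c x. Proof. by rewrite /charge_G -lock. Qed.
Lemma charge_ME d x : M d x = L d x + (ilam * ch d) *: x. Proof. by rewrite /charge_M -lock. Qed.
Lemma charge_WE d x : W d x = - \sum_b \sum_c t4 d b c *: E b (E c x). Proof. by rewrite /charge_W -lock. Qed.

Lemma charge_G_linear c : linear (G c).
Proof. by move=> k x y; rewrite !charge_GE ?lin; modeq. Qed.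
Lemma charge_M_linear c : linear (M c).
Proof. by move=> k x y; rewrite !charge_ME ?lin; modeq. Qed.
Lemma charge_W_linear c : linear (W c).
Proof.
move=> k x y; rewrite !charge_WE scalerN -opprD scaler_sumr -big_split; congr (- _); apply: eq_bigr => d _.
by rewrite scaler_sumr -big_split; apply: eq_bigr => b _ /=; rewrite ?lin; modeq.
Qed.
Definition charge_lin := (fun c => lin_rulesP (charge_G_linear c), fun c => lin_rulesP (charge_M_linear c),
  fun c => lin_rulesP (charge_W_linear c)).
Local Notation lin' := (lin, charge_lin).

Lemma charge_GEw c d x : G c (E d x) = (kap * (c == d)%:R) *: x - E d (G c x).
Proof. by rewrite !charge_GE cm_HE cm_IE ?lin; modeq. Qed.
Lemma charge_GG c d x : G c (G d x) = - G d (G c x).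
Proof. by rewrite !charge_GE ?lin cm_HH cm_II !cm_HI; modeq. Qed.
Lemma charge_MEw c d x : M c (E d x) = E d (M c x).
Proof. by rewrite !charge_ME ?lin LE. Qed.
Lemma charge_MG c d x : M c (G d x) = G d (M c x).
Proof. by rewrite !charge_ME !charge_GE ?lin LH LI ?lin; modeq. Qed.

Lemma charge_WEw d c x : W d (E c x) = E c (W d x).
Proof.
rewrite !charge_WE ?lin; congr (- _); apply: eq_bigr => b _; rewrite ?lin; apply: eq_bigr => e _.
by rewrite ?lin [E e (E c _)]cm_EE ?lin [E b (E c _)]cm_EE ?lin; modeq.
Qed.
Lemma charge_WW d c x : W d (W c x) = W c (W d x).
Proof.
rewrite [W c x]charge_WE [W c (W d x)]charge_WE ?lin'; congr (- _); apply: eq_bigr => b _; rewrite ?lin'.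
by apply: eq_bigr => e _; rewrite ?lin' !charge_WEw.
Qed.
Lemma charge_MW d c x : M d (W c x) = W c (M d x).
Proof.
rewrite !charge_WE ?lin'; congr (- _); apply: eq_bigr => b _; rewrite ?lin'.
by apply: eq_bigr => e _; rewrite ?lin' !charge_MEw.
Qed.

(** [W] contains two ghosts and [G] can be contracted with either; by antisymmetry the contributions
    agree, hence [kap] twice. *)
Lemma charge_GW d e x : G d (W e x) = W e (G d x) - (kap + kap) *: \sum_b t4 e d b *: E b x.
Proof.
have e1 : \sum_b \sum_c t4 e b c *: ((d == b)%:R *: E c x) = \sum_b t4 e d b *: E b x.
  rewrite -(sum_delta d (fun i => \sum_b t4 e i b *: E b x)); apply: eq_bigr => b _.
  by rewrite scaler_sumr; apply: eq_bigr => c _; rewrite !scalerA mulrC.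
have e2 : \sum_b \sum_c t4 e b c *: ((d == c)%:R *: E b x) = - \sum_b t4 e d b *: E b x.
  rewrite exchange_big -e1 -sumrN; apply: eq_bigr => b _.
  by rewrite -sumrN; apply: eq_bigr => c _; rewrite t4C scaleNr.
have -> : G d (W e x) = - (kap *: (\sum_b \sum_c t4 e b c *: ((d == b)%:R *: E c x))
   + - kap *: (\sum_b \sum_c t4 e b c *: ((d == c)%:R *: E b x))
   + 1 *: (\sum_b \sum_c t4 e b c *: E b (E c (G d x)))).
  rewrite charge_WE ?lin'; congr (- _); apply: sum_comb3 => b; rewrite ?lin'; apply: sum_comb3 => c.
  by rewrite ?lin' charge_GEw ?lin' charge_GEw ?lin'; modeq.
by rewrite e1 e2 !charge_WE; modeq.
Qed.

Definition charge_Q x : A := locked (\sum_d W d (G d x)).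
Definition charge_X x : A := locked (\sum_d E d (M d x)).
Local Notation Q := charge_Q.
Local Notation X := charge_X.

Lemma charge_QE x : Q x = \sum_d W d (G d x). Proof. by rewrite /charge_Q -lock. Qed.
Lemma charge_XE x : X x = \sum_d E d (M d x). Proof. by rewrite /charge_X -lock. Qed.

Lemma st_charge x : st brst_charge x = Q x + X x.
Proof.
rewrite /brst_charge /brst_Omega /brst_J /brst_chi ?lin -addrA charge_QE charge_XE; congr (_ + _).
  transitivity (- \sum_d \sum_b \sum_c t4 c d b *: E d (E b (G c x))).
    congr (- _); apply: eq_bigr => d _; rewrite ?lin; apply: eq_bigr => b _.
    by rewrite ?lin; apply: eq_bigr => c _; rewrite ?lin st_word charge_GE.
  by rewrite sum_rotate -sumrN; apply: eq_bigr => c _; rewrite charge_WE.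
rewrite scaler_sumr -big_split; apply: eq_bigr => d _.
by rewrite charge_ME /= ?lin !cm_stE stj cm_st1 ?lin; modeq.
Qed.

(** A product of three ghosts is invariant under cyclic rotation. Three times the sum therefore has
    the Jacobi expressions as coefficients, and three can be cancelled. *)
Lemma charge_W_jacobi e y : \sum_d \sum_b t4 e d b *: W d (E b y) = 0.
Proof.
pose J3 p q b := \sum_d t4 d p q * t4 e d b.
pose T := \sum_p \sum_q \sum_b J3 p q b *: E p (E q (E b y)).
have EEE p q b : E q (E b (E p y)) = E p (E q (E b y)).
  by rewrite [E b (E p y)]cm_EE ?lin [E q (E p _)]cm_EE ?lin; modeq.
have T2 : T = \sum_p \sum_q \sum_b J3 q b p *: E p (E q (E b y)).
  rewrite /T sum_rotate; apply: eq_bigr => p _; apply: eq_bigr => q _; apply: eq_bigr => b _.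
  by rewrite EEE.
have T3 : T = \sum_p \sum_q \sum_b J3 b p q *: E p (E q (E b y)).
  rewrite T2 sum_rotate; apply: eq_bigr => p _; apply: eq_bigr => q _; apply: eq_bigr => b _.
  by rewrite EEE.
have T0 : T = 0.
  apply: (torsion (k := 2)); rewrite !mulrS mulr0n addr0 {2}T2 {2}T3 /T.
  rewrite -!big_split; apply: big1 => p _; rewrite -!big_split; apply: big1 => q _.
  rewrite -!big_split; apply: big1 => b _ /=; rewrite -!scalerDl addrA -!big_split /=.
  by rewrite jacobi scale0r.
transitivity (- T); last by rewrite T0 oppr0.
transitivity (- \sum_d \sum_p \sum_q \sum_b (t4 d p q * t4 e d b) *: E p (E q (E b y))).
  rewrite -sumrN; apply: eq_bigr => d _.
  rewrite -(sum_rotate' (fun b p q => (t4 d p q * t4 e d b) *: E p (E q (E b y)))) -sumrN.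
  apply: eq_bigr => b _; rewrite charge_WE scalerN scaler_sumr; congr (- _); apply: eq_bigr => p _.
  by rewrite scaler_sumr; apply: eq_bigr => q _; rewrite scalerA mulrC.
congr (- _); rewrite exchange_big; apply: eq_bigr => p _; rewrite exchange_big.
apply: eq_bigr => q _; rewrite exchange_big; apply: eq_bigr => b _.
by rewrite scaler_suml.
Qed.

(** The term with two uncontracted [G] is symmetric in the [W] and antisymmetric in the [G]; what
    remains after one contraction is the Jacobi sum. *)
Lemma charge_QQ x : Q (Q x) = 0.
Proof.
rewrite [Q x]charge_QE charge_QE.
transitivity (1 *: (\sum_d \sum_e W d (W e (G d (G e x))))
  + - (kap + kap) *: (\sum_d \sum_e W d (\sum_b t4 e d b *: E b (G e x)))).
  apply: sum_comb2 => d; rewrite ?lin'; apply: sum_comb2 => e.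
  by rewrite charge_GW ?lin'; modeq.
rewrite (@eq_opp_eq0 (\sum_d \sum_e W d (W e (G d (G e x))))); last first.
  by apply: sum_swap_anti => d e; rewrite charge_WW [G d _]charge_GG ?lin'.
rewrite exchange_big scaler0 add0r [X in _ *: X]big1 ?scaler0 // => e _.
transitivity (\sum_d \sum_b t4 e d b *: W d (E b (G e x))); last exact: charge_W_jacobi.
by apply: eq_bigr => d _; rewrite ?lin'; apply: eq_bigr => b _; rewrite ?lin'.
Qed.

(** The shift of [L] by chi does not disturb the commutation relations, because chi vanishes on
    brackets. *)
Lemma charge_MM d b x : M d (M b x) - M b (M d x) = ilam *: \sum_c t c d b *: M c x.
Proof.
have -> : \sum_c t c d b *: M c x = \sum_c t c d b *: L c x + (ilam * \sum_c t c d b * ch c) *: x.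
  rewrite mulr_sumr scaler_suml -big_split; apply: eq_bigr => c _.
  by rewrite /= charge_ME; modeq.
by rewrite chE mulr0 scale0r addr0 -LL !charge_ME ?lin; modeq.
Qed.

(** Adding the sum to itself with the two ghosts exchanged turns the products of the [M] into
    commutators; hence the doubled statement. *)
Lemma charge_XX x :
  X (X x) *+ 2 = ilam *: \sum_c \sum_d \sum_b t c d b *: E d (E b (M c x)).
Proof.
have XXE : X (X x) = \sum_d \sum_b E d (E b (M d (M b x))).
  rewrite [X x]charge_XE charge_XE; apply: eq_bigr => d _; rewrite ?lin'.
  by apply: eq_bigr => b _; rewrite charge_MEw.
rewrite mulr2n {2}XXE.
rewrite (sum_swap_anti (psi := fun d b => E d (E b (M b (M d x))))); last first.
  by move=> d b; rewrite cm_EE.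
rewrite XXE -sumrB -[in RHS]sum_rotate scaler_sumr; apply: eq_bigr => d _.
rewrite -sumrB scaler_sumr; apply: eq_bigr => b _.
transitivity (E d (E b (M d (M b x) - M b (M d x)))); first by rewrite ?lin'.
by rewrite charge_MM ?lin'; congr (_ *: _); apply: eq_bigr => c _; rewrite ?lin'.
Qed.

Lemma charge_QX x : Q (X x) + X (Q x) = kap *: \sum_c W c (M c x).
Proof.
have QEw c y : Q (E c y) = kap *: W c y - E c (Q y).
  rewrite !charge_QE ?lin' -(sum_delta c (fun d => W d y)) scaler_sumr -sumrB.
  apply: eq_bigr => d _; rewrite charge_GEw ?lin' charge_WEw eq_sym; modeq.
have MQ c y : M c (Q y) = Q (M c y).
  rewrite !charge_QE ?lin'; apply: eq_bigr => d _.
  by rewrite charge_MW charge_MG.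
have Ql : linear Q.
  move=> k y z; rewrite !charge_QE scaler_sumr -big_split; apply: eq_bigr => d _ /=.
  by rewrite ?lin'.
rewrite [X x]charge_XE (lin_rulesP Ql) charge_XE -big_split scaler_sumr; apply: eq_bigr => c _ /=.
by rewrite QEw MQ; modeq.
Qed.

(** [Q] squares to zero by the Jacobi identity. The mixed terms cancel the square of [X], which is
    the noncommutativity of the momentum map: after doubling, the two are plus and minus 4 [ilam]
    times the sum of all W_c M_c. *)
Lemma brst_charge_sq x : st brst_charge (st brst_charge x) = 0.
Proof.
have Ql : linear Q.
  move=> k y z; rewrite !charge_QE scaler_sumr -big_split; apply: eq_bigr => d _ /=.
  by rewrite ?lin'.
have Xl : linear X.
  move=> k y z; rewrite !charge_XE scaler_sumr -big_split; apply: eq_bigr => d _ /=.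
  by rewrite ?lin'.
rewrite !st_charge (lin_rulesP Ql) (lin_rulesP Xl) charge_QQ add0r.
apply: (torsion (k := 1)); rewrite addrA charge_QX mulrnDl charge_XX.
have -> : \sum_c \sum_d \sum_b t c d b *: E d (E b (M c x)) = (\sum_c W c (M c x)) *- 4.
  rewrite -sumrMnl -sumrN; apply: eq_bigr => c _; rewrite charge_WE mulNrn opprK.
  rewrite -sumrMnl; apply: eq_bigr => d _; rewrite -sumrMnl; apply: eq_bigr => b _.
  by rewrite tE t2E !mulrS !mulr0n; modeq.
by rewrite !mulrS !mulr0n; modeq.
Qed.

End BrstCharge.

(** * The inner derivation defined by an odd element of square zero, and its splitting by degree *)

Section ChargeDifferential.
Variables (K : comNzRingType) (A : lmodType K) (ilam : K).
Implicit Types (x y z : A).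
Local Ltac modeq := module_eq K A.
Variables (st str : A -> {linear A -> A}) (par ag D delta dq : {linear A -> A}) (one Th : A).
Hypotheses (strE : forall x y, str y x = st x y)
  (stA : forall x y z, st x (st y z) = st (st x y) z)
  (st1 : forall x, st one x = x) (stx1 : forall x, st x one = x)
  (parK : forall x, par (par x) = x)
  (parM : forall x y, par (st x y) = st (par x) (par y)) (par1 : par one = one)
  (Th_sq : forall x, st Th (st Th x) = 0) (parTh : par Th = - Th)
  (DE : forall x, ilam *: D x = st Th x - st (par x) Th)
  (DdE : forall x, D x = delta x + dq x *+ 2)
  (ag_delta : forall x, ag (delta x) = delta (ag x))
  (ag_dq : forall x, ag (dq x) = dq (ag x) - dq x)
  (torsion : forall x k, x *+ k.+1 = 0 -> x = 0)
  (ilam_reg : forall x, ilam *: x = 0 -> x = 0).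

Lemma charge_linearl y : linear (fun x => st x y).
Proof. by move=> k x x'; rewrite -!strE linearP. Qed.
Definition charge_stl y := ltac:(lin_beta (charge_linearl y)).
Definition charge_str x := linear_rules (st x).
Local Notation lin := (charge_stl, charge_str, linear_rules par,
  linear_rules ag, linear_rules D, linear_rules delta, linear_rules dq).

Lemma ilam_inj x y : ilam *: x = ilam *: y -> x = y.
Proof. by move=> h; apply/eqP; rewrite -subr_eq0; apply/eqP/ilam_reg; rewrite scalerBr h subrr. Qed.

Lemma charge_D_sq x : D (D x) = 0.
Proof.
apply/ilam_reg/ilam_reg; rewrite DE.
have -> : ilam *: (st Th (D x) - st (par (D x)) Th) =
  st Th (ilam *: D x) - st (par (ilam *: D x)) Th by rewrite ?lin; modeq.
rewrite DE ?lin Th_sq !parM parTh parK ?lin -!stA.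
have -> : st Th Th = 0 by rewrite -{2}[Th]stx1 Th_sq.
by rewrite ?lin; modeq.
Qed.

Lemma charge_D_derivation x y : D (st x y) = st (D x) y + st (par x) (D y).
Proof.
apply: ilam_inj; rewrite DE.
have -> : ilam *: (st (D x) y + st (par x) (D y)) = st (ilam *: D x) y + st (par x) (ilam *: D y).
  by rewrite ?lin; modeq.
by rewrite !DE parM ?lin !stA; modeq.
Qed.

Lemma charge_D1 : D one = 0.
Proof. by apply: ilam_reg; rewrite DE par1 st1 stx1 subrr. Qed.

Lemma charge_DE x : D x = delta x + (dq x + dq x).
Proof. by rewrite DdE mulr2n. Qed.

Lemma charge_ag_D x : ag (D x) = D (ag x) - (dq x + dq x).
Proof. by rewrite !charge_DE ?lin ag_delta ?lin ag_dq; modeq. Qed.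

(* D^2 = 0 splits according to the degree [ag], which delta preserves and dq lowers
   by one. *)
Lemma charge_D_dq x : D (dq x) = - dq (D x).
Proof.
apply/eqP; rewrite -addr_eq0; apply/eqP; apply: (torsion (k := 1)).
have h := charge_ag_D (D x).
rewrite charge_D_sq charge_ag_D ?lin charge_D_sq in h.
by rewrite -[RHS]oppr0 {}h mulr2n; modeq.
Qed.

(** Commuting [D dq = - dq D] with [ag] isolates the part that lowers the degree twice. It comes
    with the factor four, two from either side. *)
Lemma charge_dq_sq x : dq (dq x) = 0.
Proof.
apply: (torsion (k := 3)).
have h := congr1 ag (charge_D_dq x).
rewrite charge_ag_D ?lin !ag_dq charge_ag_D ?lin !charge_D_dq in h.
apply/eqP; rewrite -oppr_eq0; apply/eqP.
by move/eqP: h; rewrite -subr_eq0 => /eqP <-; rewrite !mulrS !mulr0n; modeq.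
Qed.

Lemma charge_delta_dq x : delta (dq x) = - dq (delta x).
Proof.
have := charge_D_dq x.
by rewrite !charge_DE ?lin !charge_dq_sq !addr0.
Qed.

Lemma charge_delta_sq x : delta (delta x) = 0.
Proof.
have := charge_D_sq x; rewrite !charge_DE ?lin charge_delta_dq !charge_dq_sq => <-.
by modeq.
Qed.

Lemma charge_D_parity x : par (D x) = - D (par x).
Proof.
apply: ilam_inj; have -> : ilam *: par (D x) = par (ilam *: D x) by rewrite ?lin.
by rewrite scalerN DE ?lin !parM parTh ?lin !DE ?lin; modeq.
Qed.

End ChargeDifferential.

(** * Perturbation and transfer to cohomology *)

Section NilpotentInverse.
Variables (K : pzRingType) (V : lmodType K) (M : {linear V -> V}) (N : nat).
Hypothesis nilp : forall x, iter N M x = 0.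

Definition neumann (k : K) (x : V) : V := \sum_(i < N) k ^+ i *: iter i M x.

Lemma neumannP (k : K) x : neumann k x - k *: M (neumann k x) = x.
Proof.
(* For exponent zero the hypothesis says that the module is trivial. *)
rewrite /neumann; case: N nilp => [|m] nil.
  by rewrite !big_ord0 linear0 scaler0 subr0; have := nil x.
rewrite (linear_rules M) scaler_sumr [X in _ - X]big_ord_recr big_ord_recl /=.
rewrite expr0 scale1r (linear_rules M) (nil x : M (iter m M x) = 0) !scaler0 addr0.
rewrite -addrA -sumrB big1 ?addr0 // => i _.
by rewrite (linear_rules M) scalerA -exprS subrr.
Qed.

Lemma nilpotent_fixed (k : K) x : x = k *: M x -> x = 0.
Proof.
move=> h; have e i : x = k ^+ i *: iter i M x.
  elim: i => [|i IH]; first by rewrite expr0 scale1r.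
  by rewrite {1}h {1}IH (linear_rules M) scalerA exprS.
by rewrite (e N) nilp scaler0.
Qed.
End NilpotentInverse.

Lemma inverse_onP (V : zmodType) (Q : set V) (f : V -> V) y :
  set_bij Q Q f -> Q y -> Q (inverse_on Q f y) /\ f (inverse_on Q f y) = y.
Proof.
move=> [_ _ fs] Qy; rewrite /inverse_on; case: xgetP => [x _ //|noth].
by have [x Qx fx] := fs y Qy; have := noth x; case.
Qed.

Lemma inverse_on_eq (V : zmodType) (Q : set V) (f : V -> V) x :
  set_bij Q Q f -> Q x -> inverse_on Q f (f x) = x.
Proof.
move=> fb Qx; have [ff fi _] := fb.
have [Q1 e] := inverse_onP fb (ff _ Qx : Q (f x)).
by apply: fi => //; apply/mem_set.
Qed.

Section PerturbedComplex.
Variables (K : comNzRingType) (A E : lmodType K) (half : K) (N1 N2 : nat).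
Implicit Types (a : A) (c : E).
Variables (D delta dq h : {linear A -> A}) (iota : {linear A -> E}) (prol : {linear E -> A}).
Variable dC : {linear E -> E}.
Local Notation hatA := (E * A)%type.

Definition hat_delta (x : hatA) : hatA := (dC x.1, delta x.2).
Definition hat_h (x : hatA) : hatA := (0, prol x.1 + h x.2).
Definition hat_D (x : hatA) : hatA := (dC x.1 + iota x.2 *+ 2, D x.2).
Definition hat_comm (x : hatA) : hatA := hat_delta (hat_h x) + hat_h (hat_delta x).
Definition hat_op (x : hatA) : hatA := x + half *: hat_comm x.

(** A contraction of [(A, dq)] onto [E], perturbed by [delta]. The bounds [N1] and [N2] are kept
    apart because the extended complex needs one iteration more, to empty the component in [E]. *)
Record perturbation : Prop := Perturbation {
  pert_half : half + half = 1;
  pert_DdE : forall a, D a = delta a + dq a *+ 2;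
  pert_D_sq : forall a, D (D a) = 0;
  pert_delta_sq : forall a, delta (delta a) = 0;
  pert_delta_dq : forall a, delta (dq a) = - dq (delta a);
  pert_iota_prol : forall c, iota (prol c) = c;
  pert_iota_h : forall a, iota (h a) = 0;
  pert_iota_dq : forall a, iota (dq a) = 0;
  pert_dq_prol : forall c, dq (prol c) = 0;
  pert_htpy : forall a, prol (iota a) + dq (h a) + h (dq a) = a;
  pert_iota_delta : forall a, iota (delta a) = - dC (iota a);
  pert_hat_nil : forall x, iter N1 hat_comm x = 0;
  pert_h_nil : forall a, iter N2 (fun a => h (delta a)) a = 0 }.

Hypothesis pert : perturbation.
Let half2 := pert_half pert.
Let DdE := pert_DdE pert.
Let D_sq := pert_D_sq pert.
Let delta_sq := pert_delta_sq pert.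
Let delta_dq := pert_delta_dq pert.
Let iota_prol := pert_iota_prol pert.
Let iota_h := pert_iota_h pert.
Let iota_dq := pert_iota_dq pert.
Let dq_prol := pert_dq_prol pert.
Let htpyE := pert_htpy pert.
Let iota_delta := pert_iota_delta pert.
Let hat_nil := pert_hat_nil pert.
Let h_nil := pert_h_nil pert.

Local Notation lin := (linear_rules D, linear_rules delta, linear_rules dq, linear_rules h,
  linear_rules iota, linear_rules prol, linear_rules dC).
Local Ltac modA := module_eq K A.
Local Ltac modE := module_eq K E.

(** Every [c] is [iota (prol c)], and [iota] intertwines the two differentials up to sign, so this
    is inherited from [delta]. *)
Lemma dC_sq c : dC (dC c) = 0.
Proof.
rewrite -[c]iota_prol -[dC (iota _)]opprK -iota_delta ?lin; apply/eqP; rewrite oppr_eq0; apply/eqP.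
by rewrite -[LHS]opprK -iota_delta delta_sq ?lin oppr0.
Qed.

Lemma iota_D a : iota (D a) = - dC (iota a).
Proof. by rewrite DdE mulr2n ?lin iota_dq iota_delta !addr0. Qed.

Lemma hat_comm_linear : linear hat_comm.
Proof.
move=> k [x1 x2] [y1 y2]; rewrite /hat_comm /hat_delta /hat_h.
by apply: injective_projections; rewrite /= ?lin; [modE|modA].
Qed.
HB.instance Definition _ := GRing.isLinear.Build K hatA hatA _ hat_comm hat_comm_linear.

(** The 2 in front of [dq] and the 2 in front of [iota] combine through the contraction identity
    into twice the identity; the terms with [delta] and [dC] form [hat_comm]. *)
Lemma hat_DE x : hat_D (hat_h x) + hat_h (hat_D x) = hat_op x *+ 2.
Proof.
case: x => x1 x2; rewrite /hat_op /hat_comm /hat_D /hat_h /hat_delta !mulr2n.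
have e y : half *: y + half *: y = y :> A by rewrite -scalerDl half2 scale1r.
apply: injective_projections => /=.
  by rewrite ?lin iota_prol iota_h ?lin; modE.
rewrite addrACA e -[in X in _ = X + _](htpyE x2) !DdE !mulr2n ?lin dq_prol ?lin; modA.
Qed.

Lemma hat_op_bij : set_bij setT setT hat_op.
Proof.
split=> [//|x y _ _ xy|y _].
  apply/eqP; rewrite -subr_eq0; apply/eqP.
  apply: (nilpotent_fixed hat_nil (k := - half)).
  move/eqP: xy; rewrite -subr_eq0 /hat_op => /eqP xy.
  by rewrite linearB /= scalerBr !scaleNr; apply/eqP; rewrite -subr_eq0 -[X in _ == X]xy; apply/eqP;
    module_eq K (hatA : lmodType K).
exists (neumann hat_comm N1 (- half) y) => //.
rewrite -[RHS](neumannP hat_nil (- half)) /hat_op.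
by rewrite scaleNr opprK.
Qed.

Definition hat_h' (x : hatA) : hatA := half *: hat_h (inverse_on setT hat_op x).

Lemma hat_D_sq x : hat_D (hat_D x) = 0.
Proof.
case: x => x1 x2; rewrite /hat_D /= D_sq; congr (_, _).
by rewrite !mulr2n ?lin dC_sq iota_D; modE.
Qed.

Lemma hat_D_linear : linear hat_D.
Proof.
move=> k [x1 x2] [y1 y2]; rewrite /hat_D.
by apply: injective_projections; rewrite /= ?lin ?mulr2n; [modE|modA].
Qed.

Lemma hat_h_linear : linear hat_h.
Proof.
move=> k [x1 x2] [y1 y2]; rewrite /hat_h.
by apply: injective_projections; rewrite /= ?lin ?mulr2n; [modE|modA].
Qed.
Local Notation hlin := (lin_rulesP hat_D_linear, lin_rulesP hat_h_linear).

Lemma hat_two x : half *: x *+ 2 = x :> hatA.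
Proof. by rewrite mulr2n -scalerDl half2 scale1r. Qed.

(** Half an anticommutator with an operator of square zero commutes with that operator. So [hat_D]
    also commutes with the inverse of [hat_op], which makes [hat_h'] an exact homotopy. *)
Lemma hat_D_op x : hat_D (hat_op x) = hat_op (hat_D x).
Proof.
have e y : hat_op y = half *: (hat_D (hat_h y) + hat_h (hat_D y)).
  by rewrite hat_DE -{1}[hat_op y]hat_two scalerMnr.
by rewrite !e ?hlin !hat_D_sq ?hlin; module_eq K (hatA : lmodType K).
Qed.

Lemma hat_inverse x y : hat_op y = x -> inverse_on setT hat_op x = y.
Proof. by move=> <-; apply: (inverse_on_eq hat_op_bij). Qed.

Lemma hat_h'0 : hat_h' 0 = 0.
Proof.
rewrite /hat_h' (@hat_inverse _ 0) ?hlin ?scaler0 //.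
by rewrite /hat_op linear0 scaler0 addr0.
Qed.

Lemma hat_h'P x : hat_D (hat_h' x) + hat_h' (hat_D x) = x.
Proof.
rewrite /hat_h'; have [_] := inverse_onP hat_op_bij (Logic.I : setT x).
set y := inverse_on _ _ x => ey.
rewrite (@hat_inverse _ (hat_D y)) -?ey ?hat_D_op //.
by rewrite ?hlin -scalerDr hat_DE -[RHS]hat_two scalerMnr.
Qed.

Lemma closed_exact a c : D a = 0 -> iota a = dC c -> exists b, a = D b.
Proof.
move=> Da ia.
(* The first component is chosen to compensate the term [iota a *+ 2] of [hat_D]; a closed pair is
   exact by the homotopy. *)
have cl : hat_D (- c *+ 2, a) = 0.
  by rewrite /hat_D /= Da ia !mulr2n ?lin; congr (_, _); modE.
have := hat_h'P (- c *+ 2, a).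
rewrite cl hat_h'0 addr0 => /(congr1 snd) /= <-.
by exists (hat_h' (- c *+ 2, a)).2.
Qed.

Definition hat_hC c : A := (hat_h' (c, 0)).2.

(** The pair [(c, 0)] is closed, so [hat_D] maps its homotopy image back to it. That image lies in
    [A], and the two components of the equation are the two claims; the 2 is that of [hat_D]. *)
Lemma hat_hCP c : dC c = 0 -> D (hat_hC c *+ 2) = 0 /\ iota (hat_hC c *+ 2) = c.
Proof.
move=> cc.
have cl : hat_D (c, 0) = 0 by rewrite /hat_D /= ?lin mul0rn addr0 cc.
have := hat_h'P (c, 0).
rewrite cl hat_h'0 addr0 => e.
have e1 : (hat_h' (c, 0)).1 = 0 by rewrite /hat_h' /hat_h /= scaler0.
have eD : D (hat_hC c) = 0 := congr1 snd e.
have ei : iota (hat_hC c) *+ 2 = c.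
  have := congr1 fst e; rewrite -[fst (hat_D _)]/(dC (hat_h' (c, 0)).1 + iota (hat_hC c) *+ 2).
  by rewrite e1 linear0 add0r.
by split; [rewrite mulr2n linearD /= eD addr0|move: ei; rewrite !mulr2n linearD].
Qed.

Definition koszul_lift c : A := \sum_(k < N2) (- half) ^+ k *: iter k (fun a => h (delta a)) (prol c).

(** The finite series is the solution [z] of [z = prol c - half *: h (delta z)]. This equation and
    the contraction identity give [D z = - half *: h (delta (D z))], which nilpotence allows only
    for [D z = 0]. *)
Lemma koszul_liftP c : dC c = 0 -> D (koszul_lift c) = 0 /\ iota (koszul_lift c) = c.
Proof.
pose M := [the {linear A -> A} of h \o delta] => cc.
have MN a : iter N2 M a = 0 by exact: h_nil.
have e0 : koszul_lift c - (- half) *: h (delta (koszul_lift c)) = prol c.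
  exact: (neumannP MN (- half) (prol c)).
move: (koszul_lift c) e0 => z e0.
have e : z = prol c - half *: h (delta z) by rewrite -e0; modA.
have ic : iota z = c by rewrite e ?lin iota_prol iota_h scaler0 subr0.
split=> //.
apply: (nilpotent_fixed MN (k := - half)).
rewrite -[M _]/(h (delta (D z))).
have dz : dq z = - half *: dq (h (delta z)) by rewrite {1}e ?lin dq_prol; modA.
have hz := htpyE (delta z).
have iz : iota (delta z) = 0 by rewrite iota_delta ic cc oppr0.
rewrite iz ?lin add0r in hz.
have dz2 : dq (h (delta z)) = delta z - h (dq (delta z)) by rewrite -{2}hz; modA.
have Dz : D z = h (dq (delta z)).
  by rewrite DdE mulr2n dz -scalerDl -opprD half2 dz2; modA.
have -> : delta (D z) = - (dq (delta z) + dq (delta z)).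
  by rewrite DdE mulr2n ?lin delta_sq delta_dq; modA.
by rewrite Dz -[LHS]scale1r -half2 ?lin; modA.
Qed.

End PerturbedComplex.

(** * Classes as cosets *)

Section Cosets.
Variables (K : comNzRingType) (V : lmodType K) (B : set V).
Hypotheses (B0 : B 0) (BD : forall x y, B x -> B y -> B (x + y))
  (BN : forall x, B x -> B (- x)).
Implicit Types (x y v w : V).

Lemma vcosetP v w : vcoset B v w <-> B (w - v).
Proof.
split=> [[b Bb <-]|Bwv]; first by rewrite addrC addKr.
by exists (w - v) => //; rewrite addrC subrK.
Qed.

Lemma vcoset_refl v : vcoset B v v.
Proof. by apply/vcosetP; rewrite subrr. Qed.

Lemma vcoset_eq v w : vcoset B v = vcoset B w <-> B (v - w).
Proof.
split=> [e|Bvw]; first by apply/vcosetP; rewrite -e; exact: vcoset_refl.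
apply/seteqP; split=> u /vcosetP Bu; apply/vcosetP.
  by rewrite (_ : u - w = (u - v) + (v - w)); [exact: BD|module_eq K V].
by rewrite (_ : u - v = (u - w) + - (v - w)); [apply: BD => //; exact: BN|module_eq K V].
Qed.

Lemma vcoset0 : vcoset B 0 = B.
Proof. by apply/seteqP; split=> u; [move/vcosetP|move=> Bu; apply/vcosetP]; rewrite subr0. Qed.

Lemma class_opE (op : V -> V -> V) v w :
  (forall x y, B x -> B y -> B (op (v + x) (w + y) - op v w)) ->
  class_op B op (vcoset B v) (vcoset B w) = vcoset B (op v w).
Proof.
move=> h; apply/seteqP; split=> u.
  move=> [x [y [[x' Bx <-] [y' By <-] /vcosetP Bu]]]; apply/vcosetP.
  rewrite (_ : u - op v w = (u - op (v + x') (w + y')) + (op (v + x') (w + y') - op v w)).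
    by apply: BD => //; exact: h.
  by rewrite addrA subrK.
by move=> Bu; exists v, w; split=> //; exact: vcoset_refl.
Qed.

Lemma class_addE v w : class_add B (vcoset B v) (vcoset B w) = vcoset B (v + w).
Proof.
apply: class_opE => x y Bx By.
by rewrite (_ : _ - _ = x + y); [exact: BD|module_eq K V].
Qed.

Lemma class_sum (I : Type) (r : seq I) (f : I -> V) :
  \big[class_add B/B]_(i <- r) vcoset B (f i) = vcoset B (\sum_(i <- r) f i).
Proof.
elim: r => [|i r IH]; first by rewrite !big_nil vcoset0.
by rewrite !big_cons IH class_addE.
Qed.

Lemma class_mapE (W : lmodType K) (C : set W) (f : W -> V) (v : W) :
  (forall x : W, C x -> B (f (v + x) - f v)) -> C 0 ->
  class_map B f (vcoset C v) = vcoset B (f v).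
Proof.
move=> h C0; apply/seteqP; split=> u.
  move=> [x [[x' Cx <-] /vcosetP Bu]]; apply/vcosetP.
  rewrite (_ : u - f v = (u - f (v + x')) + (f (v + x') - f v)); last by rewrite addrA subrK.
  by apply: BD => //; exact: h.
by move=> Bu; exists v; split=> //; exists 0; rewrite ?addr0.
Qed.

End Cosets.

Section RangeSubmodule.
Variables (K : comNzRingType) (V W : lmodType K) (f : {linear V -> W}).
Lemma range0 : range f 0. Proof. by exists 0; rewrite // linear0. Qed.
Lemma rangeD x y : range f x -> range f y -> range f (x + y).
Proof. by move=> [a _ <-] [b _ <-]; exists (a + b); rewrite // linearD. Qed.
Lemma rangeN x : range f x -> range f (- x).
Proof. by move=> [a _ <-]; exists (- a); rewrite // linearN. Qed.
Lemma rangeZ k x : range f x -> range f (k *: x).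
Proof. by move=> [a _ <-]; exists (k *: a); rewrite // linearZ. Qed.
End RangeSubmodule.

(** * Transport of the product along a quasi-isomorphism, and the algebra in degree zero *)

Section CohomologyAlgebra.
Variables (K : comNzRingType) (A E : lmodType K) (N : nat).
Implicit Types (a b : A) (c x : E) (z w : int).
Variables (D : {linear A -> A}) (dC : {linear E -> E}) (iota : {linear A -> E}).
Variables (hC lift : E -> A) (st str : A -> {linear A -> A}) (par : A -> A) (one : A).
Variables (Agh : int -> set A) (Eh : int -> set E) (pr : int -> {linear E -> E}).
Hypotheses (D_sq : forall a, D (D a) = 0) (dC_sq : forall c, dC (dC c) = 0)
  (iota_D : forall a, iota (D a) = - dC (iota a))
  (closed_exact : forall a c, D a = 0 -> iota a = dC c -> exists b, a = D b)
  (hCP : forall c, dC c = 0 -> D (hC c *+ 2) = 0 /\ iota (hC c *+ 2) = c)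
  (liftP : forall c, dC c = 0 -> D (lift c) = 0 /\ iota (lift c) = c)
  (lift_gh : forall z c, Eh z c -> Agh z (lift c))
  (iota_gh : forall z a, Agh z a -> Eh z (iota a))
  (strE : forall a b, str b a = st a b)
  (stA : forall a b a', st a (st b a') = st (st a b) a')
  (st1 : forall a, st one a = a) (stx1 : forall a, st a one = a)
  (D_der : forall a b, D (st a b) = st (D a) b + st (par a) (D b))
  (parK : forall a, par (par a) = a) (D_par : forall a, D a = 0 -> D (par a) = 0)
  (D1 : D one = 0) (one_gh : Agh 0 one)
  (st_gh : forall z w a b, Agh z a -> Agh w b -> Agh (z + w) (st a b))
  (pr_gh : forall z x, Eh z (pr z x)) (pr_id : forall z x, Eh z x -> pr z x = x)
  (pr_other : forall z w x, z != w -> Eh w x -> pr z x = 0)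
  (pr_sum : forall x, x = \sum_(p < N) pr p%:Z x)
  (Eh_range : forall z x, Eh z x -> ~~ (0 <= z < N%:Z) -> x = 0)
  (pr_dC : forall z x, pr (z + 1) (dC x) = dC (pr z x)).

Local Notation clA := (vcoset (range D)).
Local Notation clE := (vcoset (range dC)).
Local Notation HA := (cohomology D).
Local Notation HE := (cohomology dC).
Definition coh_psi : set A -> set E := class_map (range dC) iota.
Definition coh_psi_inv : set E -> set A := class_map (range D) (fun c => hC c *+ 2).
Definition coh_mul := class_op (range D) st.
Definition coh_mulE (Y1 Y2 : set E) : set E := coh_psi (coh_mul (coh_psi_inv Y1) (coh_psi_inv Y2)).

Local Notation clA_eq := (vcoset_eq (range0 D) (@rangeD _ _ _ D) (@rangeN _ _ _ D)).
Local Notation clE_eq := (vcoset_eq (range0 dC) (@rangeD _ _ _ dC) (@rangeN _ _ _ dC)).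

Lemma coh_closed_iota a : D a = 0 -> dC (iota a) = 0.
Proof. by move=> Da; rewrite -[LHS]opprK -iota_D Da linear0 oppr0. Qed.

Lemma coh_psiE a : coh_psi (clA a) = clE (iota a).
Proof.
apply: class_mapE (range0 D); [exact: rangeD|] => y [b _ <-].
by rewrite linearD addrC addKr iota_D -linearN; exists (- iota b).
Qed.

Lemma coh_iota_inj a b : D a = 0 -> D b = 0 -> clE (iota a) = clE (iota b) -> clA a = clA b.
Proof.
move=> Da Db /clE_eq[c _ cE]; apply/clA_eq.
have [||b' ->] := @closed_exact (a - b) c; first by rewrite linearB /= Da Db subrr.
  by rewrite linearB cE.
by exists b'.
Qed.

Lemma coh_HA_closed X : HA X -> exists2 a, D a = 0 & X = clA a.
Proof. by move=> [a [_ Da] <-]; exists a. Qed.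
Lemma coh_HE_closed X : HE X -> exists2 c, dC c = 0 & X = clE c.
Proof. by move=> [a [_ Da] <-]; exists a. Qed.
Lemma coh_HAcl a : D a = 0 -> HA (clA a). Proof. by exists a. Qed.
Lemma coh_HEcl c : dC c = 0 -> HE (clE c). Proof. by exists c. Qed.

Lemma coh_HE_iota X : HE X -> exists2 a, D a = 0 & X = clE (iota a).
Proof.
by move=> /coh_HE_closed[c cc ->]; have [Dl il] := liftP cc; exists (lift c); rewrite ?il.
Qed.

(** [hC] is a mere function here; independence of the representative follows by comparing images
    under [iota], which is injective on classes. *)
Lemma coh_psi_invE c : dC c = 0 -> coh_psi_inv (clE c) = clA (hC c *+ 2).
Proof.
move=> cc; apply: class_mapE (range0 dC); [exact: rangeD|] => y [b _ <-].
have [Dh ih] := hCP cc.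
have cc' : dC (c + dC b) = 0 by rewrite linearD /= cc dC_sq addr0.
have [Dh' ih'] := hCP cc'.
apply/clA_eq/coh_iota_inj => //; apply/clE_eq; rewrite ih ih' addrC addKr.
by exists b.
Qed.

Lemma coh_psi_bij : set_bij HA HE coh_psi.
Proof.
split=> [X /coh_HA_closed[a Da ->]|X Y /set_mem/coh_HA_closed[a Da ->] /set_mem/coh_HA_closed[b Db ->]|Y].
- by rewrite coh_psiE; apply/coh_HEcl/coh_closed_iota.
- by rewrite !coh_psiE; exact: coh_iota_inj.
- by move=> /coh_HE_iota[a Da ->]; exists (clA a); [exact: coh_HAcl|exact: coh_psiE].
Qed.

(** Surjectivity is shown with [lift] rather than [hC], since the ghost number of [lift c] can be
    read off its explicit series. *)
Lemma coh_psi_deg z : coh_psi @` cohomology_of D (Agh z) = cohomology_of dC (Eh z).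
Proof.
apply/seteqP; split=> [_ [_ [a [az Da] <-] <-]|_ [c [cz cc] <-]].
  by exists (iota a); rewrite ?coh_psiE //; split; [exact: iota_gh|exact: coh_closed_iota].
have [Dl il] := liftP cc.
exists (clA (lift c)); last by rewrite coh_psiE il.
by exists (lift c) => //; split=> //; exact: lift_gh.
Qed.

Local Notation class_addA := (class_addE (range0 D) (@rangeD _ _ _ D)).
Local Notation class_addEE := (class_addE (range0 dC) (@rangeD _ _ _ dC)).

Lemma coh_psi_add X Y : HA X -> HA Y ->
  coh_psi (class_add (range D) X Y) = class_add (range dC) (coh_psi X) (coh_psi Y).
Proof.
move=> /coh_HA_closed[a Da ->] /coh_HA_closed[b Db ->].
by rewrite class_addA !coh_psiE class_addEE linearD.
Qed.

Lemma class_scaleE (V : lmodType K) (f : {linear V -> V}) (k : K) v :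
  class_scale (range f) k (vcoset (range f) v) = vcoset (range f) (k *: v).
Proof.
apply: class_mapE (range0 f); [exact: rangeD|] => x rx.
by rewrite scalerDr addrC addKr; exact: rangeZ.
Qed.

Lemma coh_psi_scale k X : HA X ->
  coh_psi (class_scale (range D) k X) = class_scale (range dC) k (coh_psi X).
Proof.
by move=> /coh_HA_closed[a Da ->]; rewrite class_scaleE !coh_psiE class_scaleE linearZ.
Qed.

Lemma coh_psiK X : HA X -> coh_psi_inv (coh_psi X) = X.
Proof.
move=> /coh_HA_closed[a Da ->]; have cc := coh_closed_iota Da.
rewrite coh_psiE coh_psi_invE //; have [Dh ih] := hCP cc.
by apply: coh_iota_inj => //; rewrite ih.
Qed.

Lemma coh_psi_invK Y : HE Y -> coh_psi (coh_psi_inv Y) = Y.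
Proof.
move=> /coh_HE_closed[c cc ->]; have [Dh ih] := hCP cc.
by rewrite coh_psi_invE // coh_psiE ih.
Qed.

Lemma coh_hC_lift c : dC c = 0 -> clA (hC c *+ 2) = clA (lift c).
Proof.
move=> cc; have [Dh ih] := hCP cc; have [Dl il] := liftP cc.
by apply: coh_iota_inj => //; rewrite ih il.
Qed.

Lemma st_bilinl b : linear (fun a => st a b).
Proof. by move=> k a a'; rewrite -!strE linearP. Qed.
Definition coh_lin := (fun b => ltac:(lin_beta (st_bilinl b)), fun a => linear_rules (st a)).

Lemma coh_st_closed a b : D a = 0 -> D b = 0 -> D (st a b) = 0.
Proof. by move=> Da Db; rewrite D_der Da Db -strE !linear0 addr0. Qed.

Lemma coh_mulP a b : D a = 0 -> D b = 0 -> coh_mul (clA a) (clA b) = clA (st a b).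
Proof.
move=> Da Db; apply: (class_opE (range0 D) (@rangeD _ _ _ D)).
(* [D x] is multiplied by the closed element [b + D y], so the product has primitive
   [st x (b + D y)]; in [st a (D y)] the sign of the derivation rule is undone by [par]. *)
move=> _ _ [x _ <-] [y _ <-]; exists (st x (b + D y) + st (par a) y) => //.
have e : st (D x) (b + D y) = D (st x (b + D y)).
  by rewrite D_der [D (_ + _)]linearD /= Db D_sq add0r linear0 addr0.
have e' : st a (D y) = D (st (par a) y).
  by rewrite D_der parK D_par // ?coh_lin add0r.
by rewrite linearD /= -e -e' ?coh_lin; module_eq K A.
Qed.

Lemma coh_psi_mul X Y : HA X -> HA Y -> coh_psi (coh_mul X Y) = coh_mulE (coh_psi X) (coh_psi Y).
Proof. by move=> HX HY; rewrite /coh_mulE !coh_psiK. Qed.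

Lemma coh_mulE_iota a b : D a = 0 -> D b = 0 ->
  coh_mulE (clE (iota a)) (clE (iota b)) = clE (iota (st a b)).
Proof.
move=> Da Db; rewrite -!coh_psiE -coh_psi_mul; try exact: coh_HAcl.
by rewrite coh_mulP.
Qed.

(** The lifts are [hC c *+ 2]; the 4 collects both doublings. *)
Lemma coh_mulE_hC c1 c2 : dC c1 = 0 -> dC c2 = 0 ->
  coh_mulE (clE c1) (clE c2) = clE (iota (st (hC c1) (hC c2)) *+ 4).
Proof.
move=> h1 h2; have [D1' i1] := hCP h1; have [D2' i2] := hCP h2.
rewrite -{1}i1 -{1}i2 coh_mulE_iota //; congr (clE _).
by rewrite !mulr2n ?coh_lin ?(linear_rules iota) !mulrS !mulr0n; module_eq K E.
Qed.

Lemma coh_deg_HE z X : cohomology_of dC (Eh z) X -> HE X.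
Proof. by move=> [c [_ cc] <-]; exact: coh_HEcl. Qed.

Lemma coh_pr_closed z c : dC c = 0 -> dC (pr z c) = 0.
Proof. by move=> cc; rewrite -pr_dC cc linear0. Qed.

Lemma coh_graded_algebra :
  graded_unital_algebra (range dC) N HE (fun z => cohomology_of dC (Eh z))
    coh_mulE (coh_psi (clA one)).
Proof.
split.
- exact: coh_deg_HE.
- move=> z X [c [cz cc] <-] zN; rewrite (Eh_range cz zN).
  exact: (vcoset0 (range dC)).
- move=> X /coh_HE_closed[c cc ->].
  have sumE f : \big[class_add (range dC)/range dC]_(p < N) clE (f p) = clE (\sum_(p < N) f p).
    exact: (class_sum (range0 dC) (@rangeD _ _ _ dC)).
  exists (fun p : 'I_N => clE (pr p%:Z c)); split.
    split; last by rewrite sumE -pr_sum.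
    by move=> p; exists (pr p%:Z c) => //; split=> //; exact: coh_pr_closed.
  move=> Y [Yp YE].
  have /choice[f fP] (p : 'I_N) : exists x, [/\ Eh p%:Z x, dC x = 0 & clE x = Y p].
    by have [x [xz xc] xE] := Yp p; exists x.
  apply/funext => p; have [fz fc fE] := fP p; rewrite -fE; apply/clE_eq.
  have : clE c = clE (\sum_(q < N) f q).
    by rewrite YE -sumE; apply: eq_bigr => q _; have [_ _ ->] := fP q.
  (* The component of degree [p] of a boundary has the component of degree [p - 1] as primitive;
     integer degrees make [p = 0] no exception. *)
  move=> /clE_eq[b _ bE]; exists (pr (p%:Z - 1) b) => //.
  rewrite -pr_dC subrK bE linearB /= linear_sum (bigD1 p) //= big1 ?addr0 ?(pr_id fz) //.
  move=> q qp; have [qz _ _] := fP q; apply: pr_other qz.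
  by rewrite eqz_nat eq_sym.
- move=> X Y /coh_HE_iota[a Da ->] /coh_HE_iota[b Db ->]; rewrite coh_mulE_iota //.
  exact/coh_HEcl/coh_closed_iota/coh_st_closed.
- move=> z w X Y [c [cz cc] <-] [d [dz dc] <-].
  have [Dl il] := liftP cc; have [Dl' il'] := liftP dc.
  rewrite -{1}il -{1}il' coh_mulE_iota //; exists (iota (st (lift c) (lift d))) => //; split.
    by apply/iota_gh/st_gh; exact: lift_gh.
  exact/coh_closed_iota/coh_st_closed.
- by rewrite coh_psiE; exists (iota one) => //; split; [exact: iota_gh|exact: coh_closed_iota].
- move=> X Y Z /coh_HE_iota[a Da ->] /coh_HE_iota[b Db ->] /coh_HE_iota[a' Da' ->].
  by rewrite !coh_mulE_iota ?stA //; exact: coh_st_closed.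
- by move=> X /coh_HE_iota[a Da ->]; rewrite coh_psiE !coh_mulE_iota ?st1 ?stx1.
- move=> X Y Z /coh_HE_iota[a Da ->] /coh_HE_iota[b Db ->] /coh_HE_iota[a' Da' ->].
  rewrite class_addEE -linearD !coh_mulE_iota ?class_addEE -?linearD ?coh_lin //.
  by rewrite linearD /= Da Db addr0.
- move=> X Y Z /coh_HE_iota[a Da ->] /coh_HE_iota[b Db ->] /coh_HE_iota[a' Da' ->].
  rewrite class_addEE -linearD !coh_mulE_iota ?class_addEE -?linearD ?coh_lin //.
  by rewrite linearD /= Da' Db addr0.
- move=> k X Y /coh_HE_iota[a Da ->] /coh_HE_iota[b Db ->].
  rewrite !class_scaleE -!linearZ !coh_mulE_iota ?class_scaleE -?linearZ ?coh_lin //;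
  by rewrite linearZ /= ?Da ?Db scaler0.
Qed.

Variables (F O : lmodType K) (fm fmr : F -> {linear F -> F}) (oneF : F) (zz : {linear A -> F}).
Variables (IC NC : set F) (iF : {linear F -> O}) (ev : {linear E -> O}) (e0E : {linear O -> E}).
Hypotheses (fmrE : forall f g, fmr g f = fm f g)
  (ICP : forall f, IC f <-> iF f = 0) (ev_iota : forall a, ev (iota a) = iF (zz a))
  (ev_dC : forall x, ev (dC x) = 0) (e0EK : forall o, ev (e0E o) = o)
  (e0E_deg : forall o, Eh 0 (e0E o)) (e0E_ev : forall c, Eh 0 c -> e0E (ev c) = c)
  (zz_st : forall a b, Agh 0 a -> Agh 0 b -> zz (st a b) = fm (zz a) (zz b))
  (zz1 : zz one = oneF)
  (NC_closed : forall a, Agh 0 a -> D a = 0 -> NC (zz a))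
  (NC_lift : forall f, NC f -> dC (e0E (iF f)) = 0)
  (NC_comm : forall f g, NC f -> IC g -> IC (fm f g - fm g f))
  (IC_left : forall f g, IC g -> IC (fm f g))
  (AghD : forall a b, Agh 0 a -> Agh 0 b -> Agh 0 (a + b))
  (AghZ : forall k a, Agh 0 a -> Agh 0 (k *: a)).

Local Notation HA0 := (cohomology_of D (Agh 0)).
Definition coh_red : set (set F) := [set vcoset IC f | f in NC].
Definition coh_L (Z : set A) : set F := class_map IC zz (Z `&` Agh 0).

Lemma IC0 : IC 0. Proof. by apply/ICP; rewrite linear0. Qed.
Lemma ICD f g : IC f -> IC g -> IC (f + g).
Proof. by move=> /ICP f0 /ICP g0; apply/ICP; rewrite linearD /= f0 g0 addr0. Qed.
Lemma ICN f : IC f -> IC (- f).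
Proof. by move=> /ICP f0; apply/ICP; rewrite linearN /= f0 oppr0. Qed.
Local Notation clF_eq := (vcoset_eq IC0 ICD ICN).

(** The zero part of an exact element lies in the ideal, because [iota] sends exact elements to
    boundaries and these have no component in degree zero. *)
Lemma coh_LE a : Agh 0 a -> coh_L (clA a) = vcoset IC (zz a).
Proof.
move=> az; apply/seteqP; split=> u.
  move=> [y [[[_ [b _ <-] <-] _] /vcosetP uy]]; apply/vcosetP.
  rewrite (_ : u - zz a = (u - zz (a + D b)) + zz (D b)); last by rewrite linearD /=; module_eq K F.
  apply: ICD => //; apply/ICP.
  by rewrite -ev_iota iota_D linearN /= ev_dC oppr0.
by move=> ua; exists a; split=> //; split=> //; exact: (vcoset_refl (range0 D)).
Qed.

Lemma coh_HA0 X : HA0 X -> exists a, [/\ Agh 0 a, D a = 0 & X = clA a].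
Proof. by move=> [a [az Da] <-]; exists a. Qed.

(** In degree zero [iota a] is determined by [iF (zz a)], so zero parts equal modulo the ideal give
    the same class. Conversely, for [f] in the normalizer [iF f] is closed, and its lift has a zero
    part differing from [f] by an element of the kernel of [iF]. *)
Lemma coh_L_bij : set_bij HA0 coh_red coh_L.
Proof.
split=> [X /coh_HA0[a [az Da ->]]|X Y /set_mem/coh_HA0[a [az Da ->]] /set_mem/coh_HA0[b [bz Db ->]]|_ [f Nf <-]].
- by rewrite coh_LE //; exists (zz a) => //; exact: NC_closed.
- rewrite !coh_LE // => /clF_eq /ICP; rewrite linearB /= -!ev_iota => /eqP; rewrite subr_eq0.
  move=> /eqP e; apply: coh_iota_inj => //; congr (clE _).
  by rewrite -[iota a]e0E_ev ?e ?e0E_ev //; exact: iota_gh.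
- have [Dl il] := liftP (NC_lift Nf).
  have lz := lift_gh (e0E_deg (iF f)).
  exists (clA (lift (e0E (iF f)))); first by exists (lift (e0E (iF f))).
  rewrite coh_LE //; apply/clF_eq/ICP.
  by rewrite linearB /= -ev_iota il e0EK subrr.
Qed.

Lemma coh_L_add X Y : HA0 X -> HA0 Y ->
  coh_L (class_add (range D) X Y) = class_add IC (coh_L X) (coh_L Y).
Proof.
move=> /coh_HA0[a [az Da ->]] /coh_HA0[b [bz Db ->]].
by rewrite class_addA !coh_LE ?(class_addE IC0 ICD) ?linearD //; exact: AghD.
Qed.

Lemma coh_L_scale k X : HA0 X -> coh_L (class_scale (range D) k X) = class_scale IC k (coh_L X).
Proof.
move=> /coh_HA0[a [az Da ->]]; rewrite class_scaleE !coh_LE //; last exact: AghZ.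
rewrite linearZ; symmetry; apply: class_mapE IC0; [exact: ICD|] => f If.
by rewrite scalerDr addrC addKr; apply/ICP; rewrite linearZ /= (proj1 (ICP f) If) scaler0.
Qed.

Lemma coh_fm_class f g : NC f -> NC g ->
  class_op IC (fun f g => fm f g) (vcoset IC f) (vcoset IC g) = vcoset IC (fm f g).
Proof.
move=> Nf Ng; apply: (class_opE IC0 ICD) => i j Ii Ij.
(* The ideal is only a left ideal: [fm i g] is reached through [fm g i] and a commutator, and the
   latter is where [g] in the normalizer is used. *)
have -> : fm (f + i) (g + j) - fm f g = fm (f + i) j + (fm g i - (fm g i - fm i g)).
  have l (p q r : F) : fm (p + q) r = fm p r + fm q r by rewrite -!fmrE linearD.
  by rewrite !l !(linear_rules (fm _)); module_eq K F.
apply: ICD; first exact: IC_left.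
apply: ICD; first exact: IC_left.
by apply: ICN; exact: NC_comm.
Qed.

Lemma coh_L_mul X Y : HA0 X -> HA0 Y ->
  coh_L (coh_mul X Y) = class_op IC (fun f g => fm f g) (coh_L X) (coh_L Y).
Proof.
move=> /coh_HA0[a [az Da ->]] /coh_HA0[b [bz Db ->]].
rewrite coh_mulP // !coh_LE //; last by have := st_gh az bz; rewrite addr0.
by rewrite zz_st // coh_fm_class //; exact: NC_closed.
Qed.

Lemma coh_L1 : coh_L (clA one) = vcoset IC oneF.
Proof. by rewrite coh_LE // zz1. Qed.

Variables (inv : set O) (pA : E -> A).
Hypotheses (invP : forall o, inv o <-> dC (e0E o) = 0)
  (pA_gh : forall c, Eh 0 c -> Agh 0 (pA c))
  (zz_lift : forall c, zz (lift c) = zz (pA c)).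

Lemma coh_inv_bij : set_bij inv (cohomology_of dC (Eh 0)) (fun o => clE (e0E o)).
Proof.
split=> [u /invP uc|u v _ _ /clE_eq[b _ e]|_ [c [cz cc] <-]].
- by exists (e0E u).
- apply/eqP; rewrite -subr_eq0 -[u]e0EK -[v]e0EK -linearB -e; apply/eqP; exact: ev_dC.
- by exists (ev c); rewrite ?e0E_ev //; apply/invP; rewrite e0E_ev.
Qed.

(** The class of a product is represented by the lifts, but in ghost number zero its image depends
    only on zero parts. Those of [lift c] and [pA c] agree, so the simple extension may replace the
    lift although it need not be closed. *)
Lemma coh_inv_mul o1 o2 : inv o1 -> inv o2 -> exists o3, [/\ inv o3,
  e0E o3 = iota (st (pA (e0E o1)) (pA (e0E o2))) &
  coh_mulE (clE (e0E o1)) (clE (e0E o2)) = clE (e0E o3)].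
Proof.
move=> /invP c1 /invP c2; have [D1' i1] := liftP c1; have [D2' i2] := liftP c2.
have l1 := lift_gh (e0E_deg o1); have l2 := lift_gh (e0E_deg o2).
have p1 := pA_gh (e0E_deg o1); have p2 := pA_gh (e0E_deg o2).
have gh0 a b : Agh 0 a -> Agh 0 b -> Agh 0 (st a b).
  by move=> az bz; have := st_gh az bz; rewrite addr0.
have e a b : Agh 0 a -> Agh 0 b -> e0E (iF (fm (zz a) (zz b))) = iota (st a b).
  by move=> az bz; rewrite -zz_st // -ev_iota e0E_ev //; exact/iota_gh/gh0.
exists (iF (fm (zz (pA (e0E o1))) (zz (pA (e0E o2))))).
split; first by apply/invP; rewrite -!zz_lift e //; exact/coh_closed_iota/coh_st_closed.
  exact: e.
by rewrite -[in LHS]i1 -[in LHS]i2 coh_mulE_iota // -e // !zz_lift.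
Qed.

End CohomologyAlgebra.

(** * Formal power series and the star product *)

Section SeriesCoefficients.
Variables (n : nat) (C : comNzRingType) (M : lmodType C).
Local Notation L := (ext n (fps_module M)).
Implicit Types (x y : L) (r : nat).

Definition series_coef r x : ext n M := [ffun I : {set 'I_n} => x I r].
Definition coef_lift (T : ext n M -> ext n M) x : L :=
  [ffun I : {set 'I_n} => fun r => T [ffun I' : {set 'I_n} => x I' r] I].

Lemma series_coefP x y : (forall r, series_coef r x = series_coef r y) -> x = y.
Proof.
move=> h; apply/ffunP => I; apply/funext => r.
by have := congr1 (fun f : ext n M => f I) (h r); rewrite !ffunE.
Qed.

Lemma series_coefD r x y : series_coef r (x + y) = series_coef r x + series_coef r y.
Proof. by apply/ffunP => I; rewrite !ffunE. Qed.
Lemma series_coefN r x : series_coef r (- x) = - series_coef r x.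
Proof. by apply/ffunP => I; rewrite !ffunE. Qed.
Lemma series_coef0 r : series_coef r 0 = 0.
Proof. by apply/ffunP => I; rewrite !ffunE. Qed.
Lemma series_coefB r x y : series_coef r (x - y) = series_coef r x - series_coef r y.
Proof. by rewrite series_coefD series_coefN. Qed.
Lemma series_coef_sum r (I : Type) (s : seq I) (P : pred I) (f : I -> L) :
  series_coef r (\sum_(i <- s | P i) f i) = \sum_(i <- s | P i) series_coef r (f i).
Proof. exact: (big_morph _ (series_coefD r) (series_coef0 r)). Qed.

Lemma series_coefZ r (k : fps C) x :
  series_coef r (k *: x) = \sum_(a < r.+1) k a *: series_coef (r - a) x.
Proof.
apply/ffunP => I; rewrite !ffunE sum_ffunE; apply: eq_bigr => a _.
by rewrite !ffunE.
Qed.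

Lemma series_coef_lift r T x : series_coef r (coef_lift T x) = T (series_coef r x).
Proof. by apply/ffunP => I; rewrite !ffunE. Qed.

Lemma coef_lift_linear (T : {linear ext n M -> ext n M}) : linear (coef_lift T).
Proof.
move=> k x y; apply: series_coefP => r.
rewrite series_coefD series_coefZ !series_coef_lift series_coefD series_coefZ linearD linear_sum.
by congr (_ + _); apply: eq_bigr => a _; rewrite linearZ series_coef_lift.
Qed.

Section AdicInverse.
Variable V : {linear L -> L}.
Hypothesis V_adic : forall r x, (forall i, (i < r)%N -> series_coef i x = 0) ->
  series_coef r (V x) = 0.

Lemma adic_iter j x i : (i < j)%N -> series_coef i (iter j V x) = 0.
Proof.
elim: j i => // j IH i; rewrite ltnS => ij; apply: V_adic => k ki.
by apply: IH; exact: leq_trans ki ij.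
Qed.

Lemma adic_inj x : x = V x -> x = 0.
Proof.
move=> xV; apply: series_coefP => r; rewrite series_coef0.
elim/ltn_ind: r => r IH; rewrite xV; exact: V_adic.
Qed.

(** The geometric series converges coefficientwise, since each application of [V] raises the order
    in lambda. *)
Lemma adic_surj y : exists x, x - V x = y.
Proof.
pose s k := \sum_(j < k) iter j V y.
(* Coefficient [r] no longer changes from the partial sum with [r.+1] terms on. *)
pose x : L := [ffun I => fun r => series_coef r (s r.+1) I].
have sS k : s k - V (s k) = y - iter k V y.
  elim: k => [|k IH]; first by rewrite /s big_ord0 linear0 subr0 subrr.
  have -> : s k.+1 = s k + iter k V y by rewrite /s big_ord_recr.
  rewrite linearD /= opprD addrACA IH.
  by module_eq (fps C) (L : lmodType (fps C)).
have sstab i k : (i < k)%N -> series_coef i (s k) = series_coef i (s i.+1).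
  elim: k => // k IH; rewrite ltnS leq_eqVlt => /predU1P[->//|ik].
  by rewrite /s big_ord_recr series_coefD -/(s k) IH //= adic_iter ?addr0.
have xs i r : (i <= r)%N -> series_coef i (x - s r.+1) = 0.
  move=> ir; rewrite series_coefB (sstab i r.+1) //; apply/eqP; rewrite subr_eq0; apply/eqP.
  by apply/ffunP => I; rewrite !ffunE.
exists x; apply: series_coefP => r.
have -> : x - V x = (x - s r.+1) - V (x - s r.+1) + (s r.+1 - V (s r.+1)).
  by rewrite linearB /=; module_eq (fps C) (L : lmodType (fps C)).
have h1 : series_coef r (x - s r.+1) = 0 by exact: xs.
have h2 : series_coef r (V (x - s r.+1)) = 0 by apply: V_adic => q /ltnW; exact: xs.
have h3 : series_coef r (iter r.+1 V y) = 0 by exact: adic_iter.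
rewrite sS series_coefD series_coefB [X in _ + X]series_coefB h1 h2 h3.
by rewrite !subr0 add0r.
Qed.

Lemma adic_bij : set_bij setT setT (fun x => x - V x).
Proof.
split=> [//|x y _ _ /= xy|y _]; last by have [x xE] := adic_surj y; exists x.
apply/eqP; rewrite -subr_eq0; apply/eqP/adic_inj; rewrite linearB /=.
apply/eqP; rewrite -subr_eq0; apply/eqP; move/eqP: xy; rewrite -subr_eq0 => /eqP <-.
by module_eq (fps C) (L : lmodType (fps C)).
Qed.

End AdicInverse.
End SeriesCoefficients.

(** * Perturbing a contraction by inverting its homotopy operator *)

Section HomologicalPerturbation.
Variables (K : comNzRingType) (L O : lmodType K).
Variables (d h p0 : {linear L -> L}) (pr : {linear O -> L}) (io : {linear L -> O}) (Qi : L -> L).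
Let Q x : L := pr (io x) + d (h x) + h (d x).
Hypotheses (d_sq : forall x, d (d x) = 0) (io_pr : forall c, io (pr c) = c)
  (h_pr : forall c, h (pr c) = 0) (d_pr : forall c, d (pr c) = 0)
  (io_p0 : forall x, io (p0 x) = io x) (p0_h : forall x, p0 (h x) = 0)
  (p0_Q : forall x, p0 (Q x) = Q (p0 x))
  (QiK : forall x, Q (Qi x) = x) (QK : forall x, Qi (Q x) = x).

Local Notation lin := (linear_rules d, linear_rules h, linear_rules pr, linear_rules io).
Local Ltac modL := module_eq K L.

Let Q_linear : linear Q.
Proof. by move=> k x y; rewrite /Q ?lin; modL. Qed.

Lemma perturbed_inverse_linear : linear Qi.
Proof. by move=> k x y; rewrite -{1}[x]QiK -{1}[y]QiK -Q_linear QK. Qed.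

Let Qi0 : Qi 0 = 0.
Proof. by rewrite -{1}(lin_rulesP Q_linear) QK. Qed.

Definition io_pert x := io (Qi x).
Definition h_pert x := h (Qi x).

Lemma io_pert_linear : linear io_pert.
Proof. by move=> k x y; rewrite /io_pert perturbed_inverse_linear linearP. Qed.
Lemma h_pert_linear : linear h_pert.
Proof. by move=> k x y; rewrite /h_pert perturbed_inverse_linear linearP. Qed.

Let Qi_pr c : Qi (pr c) = pr c.
Proof.
have e : Q (pr c) = pr c by rewrite /Q io_pr h_pr d_pr ?lin !addr0.
by rewrite -{1}e QK.
Qed.

(** [d] commutes with [Q] except for the term [pr (io (d x))], and [Q] fixes the image of [pr]. The
    defect is killed by [h] and turned by [io] into exactly what is needed in [io_pert_d]. *)
Let Qi_d x : Qi (d x) = d (Qi x) - pr (io (d (Qi x))).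
Proof.
rewrite -{1}[x]QiK -[RHS]QK; congr (Qi _); rewrite /Q.
by rewrite ?lin !(d_sq, d_pr, h_pr, io_pr) ?lin; modL.
Qed.

Lemma io_pert_d x : io_pert (d x) = 0.
Proof. by rewrite /io_pert Qi_d ?lin io_pr subrr. Qed.

Lemma io_pert_pr c : io_pert (pr c) = c.
Proof. by rewrite /io_pert Qi_pr io_pr. Qed.

Lemma homotopy_pert x : pr (io_pert x) + d (h_pert x) + h_pert (d x) = x.
Proof.
by rewrite -[RHS]QiK /Q /io_pert /h_pert Qi_d ?lin h_pr; modL.
Qed.

Lemma p0_Qi x : p0 (Qi x) = Qi (p0 x).
Proof. by rewrite -[LHS]QK -p0_Q QiK. Qed.

Lemma io_pert_p0 x : io_pert (p0 x) = io_pert x.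
Proof. by rewrite /io_pert -p0_Qi io_p0. Qed.

(** [io] sees only the part selected by [p0], the inverse of [Q] respects that selection, and values
    of [h] have no such part. *)
Lemma io_pert_h x : io_pert (h_pert x) = 0.
Proof. by rewrite /io_pert /h_pert -io_p0 p0_Qi p0_h Qi0 linear0. Qed.

End HomologicalPerturbation.

(** * Bilinearity of the star product *)

Section DerivativesLinear.
Variables (R : realType) (m : nat) (U : set 'rV[R]_m).
Hypothesis oU : open U.

(** Three terms, because the real and the imaginary part of [z * c + d] combine both parts of [c]
    with one part of [d]. *)
Lemma pders_comb3 (s : seq 'I_m) (a b c : R) (f g h : 'rV[R]_m -> R) :
  smooth_on U f -> smooth_on U g -> smooth_on U h -> forall x, U x ->
  pders s (fun y => a * f y + b * g y + c * h y) x =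
  a * pders s f x + b * pders s g x + c * pders s h x.
Proof.
move=> sf sg sh; elim: s => [//|i s IH] x Ux.
have [_ df] := sf s x Ux; have [_ dg] := sg s x Ux; have [_ dh] := sh s x Ux.
(* The next derivative depends on a neighbourhood of [x]; openness of [U] spreads the pointwise
   induction hypothesis over one. *)
have e : \near x, pders s (fun y => a * f y + b * g y + c * h y) x =
    ((a \*: pders s f) \+ (b \*: pders s g) \+ (c \*: pders s h)) x.
  by apply: (filterS IH); exact: open_nbhs_nbhs.
rewrite /= /pder (near_eq_derive _ e).
rewrite deriveD; last exact: derivableZ.
  rewrite deriveD ?deriveZ //; exact: derivableZ.
by apply: derivableD; exact: derivableZ.
Qed.

Lemma cpders_linear (s : seq 'I_m) (z : R[i]) (c d : 'rV[R]_m -> R[i]) :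
  csmooth_on U c -> csmooth_on U d -> forall x, U x ->
  cpders s (fun y => z * c y + d y) x = z * cpders s c x + cpders s d x.
Proof.
case: z => a b [cr ci] [dr di] x Ux; rewrite /cpders.
have -> : (@complex.Re R) \o (fun y => Complex a b * c y + d y) = fun y =>
    a * (@complex.Re R \o c) y + (- b) * (@complex.Im R \o c) y + 1 * (@complex.Re R \o d) y.
  by apply/funext => y /=; case: (c y) (d y) => [? ?] [? ?] /=; rewrite mul1r mulNr.
have -> : (@complex.Im R) \o (fun y => Complex a b * c y + d y) = fun y =>
    a * (@complex.Im R \o c) y + b * (@complex.Re R \o c) y + 1 * (@complex.Im R \o d) y.
  by apply/funext => y /=; case: (c y) (d y) => [? ?] [? ?] /=; rewrite mul1r.
by rewrite !pders_comb3 // !mul1r mulNr.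
Qed.

End DerivativesLinear.

Section StarLinear.
Variables (R : realType) (m : nat) (X : manifold R m) (om : symplectic_form X).
Variable S : star_product om.
Local Notation OM := (Cinfty X).
Local Notation K := (fps R[i]).
Local Notation F := (fps_module OM).
Implicit Types (f g : OM) (z : R[i]).

Lemma Cinfty_chart_smooth f c : atlas c -> csmooth_on (img c) (f \o bwd c).
Proof. by move=> Ac; exact: (asboolP _ (valP f) c Ac). Qed.

(** Linearity is local: it is read off the bidifferential expression in a chart around each
    point. *)
Lemma star_coef_linearl r z f f' g :
  star_coef S r (z *: f + f') g = z *: star_coef S r f g + star_coef S r f' g.
Proof.
apply/val_inj/funext => p; have [c Ac cp] := atlas_cover p.
have [ix px] := fwdK cp; have [N bd] := star_bidifferential S r.
have [a [_ aE]] := bd c Ac.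
change (star_coef S r (z *: f + f') g p = z * star_coef S r f g p + star_coef S r f' g p).
rewrite -px !aE // mulr_sumr -big_split; apply: eq_bigr => al _.
rewrite /= mulr_sumr -big_split; apply: eq_bigr => be _.
have -> : ((z *: f + f') : OM) \o bwd c = fun y => z * (f \o bwd c) y + (f' \o bwd c) y by [].
rewrite /= (cpders_linear (img_open (c := c))) //; try exact: Cinfty_chart_smooth.
by rewrite mulrDr mulrDl !mulrA; congr (_ + _); rewrite -!mulrA mulrCA.
Qed.

Lemma star_coef_linearr r z f g g' :
  star_coef S r f (z *: g + g') = z *: star_coef S r f g + star_coef S r f g'.
Proof.
apply/val_inj/funext => p; have [c Ac cp] := atlas_cover p.
have [ix px] := fwdK cp; have [N bd] := star_bidifferential S r.
have [a [_ aE]] := bd c Ac.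
change (star_coef S r f (z *: g + g') p = z * star_coef S r f g p + star_coef S r f g' p).
rewrite -px !aE // mulr_sumr -big_split; apply: eq_bigr => al _.
rewrite /= mulr_sumr -big_split; apply: eq_bigr => be _.
have -> : ((z *: g + g') : OM) \o bwd c = fun y => z * (g \o bwd c) y + (g' \o bwd c) y by [].
rewrite /= (cpders_linear (img_open (c := c))) //; try exact: Cinfty_chart_smooth.
by rewrite mulrDr mulrCA.
Qed.

End StarLinear.

Lemma sum_triangleC (M : nmodType) (r : nat) (G : nat -> nat -> M) :
  \sum_(i < r.+1) \sum_(j < (r - i).+1) G i j = \sum_(j < r.+1) \sum_(i < (r - j).+1) G i j.
Proof.
have e (H : nat -> nat -> M) : \sum_(i < r.+1) \sum_(j < (r - i).+1) H i j =
    \sum_(i < r.+1) \sum_(j < r.+1 | (i + j <= r)%N) H i j.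
  apply: eq_bigr => i _; rewrite (big_ord_widen r.+1) ?ltnS ?leq_subr //.
  by apply: eq_bigl => j; rewrite ltnS leq_subRL // -ltnS.
rewrite e (e (fun j i => G i j)) (exchange_big_dep xpredT) //=; apply: eq_bigr => j _.
by apply: eq_bigl => i; rewrite addnC.
Qed.

Definition cauchy (C : comNzRingType) (M : lmodType C) (B : nat -> M -> M -> M)
    (f g : fps_module M) : fps_module M :=
  fun r => \sum_(i < r.+1) \sum_(j < (r - i).+1) B (r - i - j)%N (f i) (g j).

Lemma cauchy_linearl (C : comNzRingType) (M : lmodType C) (B : nat -> M -> M -> M)
    (Bl : forall r z f f' g, B r (z *: f + f') g = z *: B r f g + B r f' g)
    (g : fps_module M) : linear (fun f => cauchy B f g).
Proof.
move=> k f f'; apply/funext => r; rewrite [RHS]/GRing.add /= /cauchy.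
have BD r' u w v : B r' (u + w) v = B r' u v + B r' w v by rewrite -[u]scale1r Bl !scale1r.
have Bs r' i (z : nat -> C) (h : nat -> M) v :
    B r' (\sum_(a < i) z a *: h a) v = \sum_(a < i) z a *: B r' (h a) v.
  elim: i => [|i IH]; last by rewrite !big_ord_recr /= addrC Bl addrC IH.
  by rewrite !big_ord0; apply: (addIr (B r' 0 v)); rewrite -BD !add0r.
pose T i a := k a *: \sum_(j < (r - i).+1) B (r - i - j)%N (f (i - a)%N) (g j).
have -> : \sum_(i < r.+1) \sum_(j < (r - i).+1) B (r - i - j)%N ((k *: f + f') i) (g j) =
  \sum_(i < r.+1) \sum_(a < i.+1) T i a +
  \sum_(i < r.+1) \sum_(j < (r - i).+1) B (r - i - j)%N (f' i) (g j).
  rewrite -big_split; apply: eq_bigr => i _ /=; rewrite /T.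
  have -> : \sum_(a < i.+1) k a *: \sum_(j < (r - i).+1) B (r - i - j)%N (f (i - a)%N) (g j) =
      \sum_(j < (r - i).+1) \sum_(a < i.+1) k a *: B (r - i - j)%N (f (i - a)%N) (g j).
    by rewrite exchange_big; apply: eq_bigr => a _; rewrite scaler_sumr.
  rewrite -big_split; apply: eq_bigr => j _ /=.
  by rewrite -(Bs _ _ k (fun a => f (i - a)%N)) -BD.
congr (_ + _); rewrite sum_triangle; apply: eq_bigr => a _; rewrite scaler_sumr.
by apply: eq_bigr => b _; rewrite /T addKn subnDA.
Qed.

(** Reduces linearity in the second argument to linearity in the first. *)
Lemma cauchy_flip (C : comNzRingType) (M : lmodType C) (B : nat -> M -> M -> M) (f g : fps_module M) :
  cauchy B f g = cauchy (fun r x y => B r y x) g f.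
Proof.
apply/funext => r; rewrite /cauchy (sum_triangleC _ (fun i j => B (r - i - j)%N (f i) (g j))).
by apply: eq_bigr => j _; apply: eq_bigr => i _; rewrite subnAC.
Qed.

Lemma cauchy_linearr (C : comNzRingType) (M : lmodType C) (B : nat -> M -> M -> M)
    (Br : forall r z f g g', B r f (z *: g + g') = z *: B r f g + B r f g')
    (f : fps_module M) : linear (cauchy B f).
Proof.
by move=> k g g'; rewrite !(cauchy_flip B); apply: cauchy_linearl.
Qed.

Section Star.
Variables (R : realType) (m : nat) (X : manifold R m) (om : symplectic_form X).
Variable S : star_product om.
Local Notation OM := (Cinfty X).
Local Notation K := (fps R[i]).
Local Notation F := (fps_module OM).
Implicit Types (f g : F).

Lemma star_linearl g : linear (fun f => star S f g).
Proof. exact: (cauchy_linearl (@star_coef_linearl _ _ _ _ S)). Qed.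

Lemma star_linearr f : linear (star S f).
Proof. exact: (cauchy_linearr (@star_coef_linearr _ _ _ _ S)). Qed.

Definition star_left f : F -> F := star S f.
Definition star_right g : F -> F := fun f => star S f g.
HB.instance Definition _ f := GRing.isLinear.Build K F F _ (star_left f) (star_linearr f).
HB.instance Definition _ g := GRing.isLinear.Build K F F _ (star_right g) (star_linearl g).

Lemma star_coef0l r (g : OM) : star_coef S r 0 g = 0.
Proof.
by have := star_coef_linearl S r (-1) 0 0 g; rewrite scaleN1r oppr0 addr0 scaleN1r addNr.
Qed.
Lemma star_coef0r r (f : OM) : star_coef S r f 0 = 0.
Proof.
by have := star_coef_linearr S r (-1) f 0 0; rewrite scaleN1r oppr0 addr0 scaleN1r addNr.
Qed.

(** Lowest-order behaviour is the pointwise product. It makes star commutators divisible by lambda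
    and ties the quantum Koszul operator to the classical one. *)
Lemma star_lead r f g : (forall i, (i < r)%N -> f i = 0) -> star S f g r = f r * g 0%N.
Proof.
move=> f0; rewrite /star /star_of big_ord_recr big1 ?add0r; last first.
  by move=> i _; apply: big1 => j _; rewrite (f0 _ (ltn_ord i)) star_coef0l.
by rewrite /= subnn big_ord1 star_coef0 ?add0r.
Qed.

Lemma star1l f : star S (one_F X) f = f.
Proof.
apply/funext => r; rewrite /star /star_of big_ord_recl [X in _ + X]big1 ?addr0; last first.
  by move=> i _; apply: big1 => j _; rewrite star_coef0l.
rewrite subn0 big_ord_recr /= subnn star_coef0 mul1r big1 ?add0r // => j _.
have rj : (0 < r - j)%N by rewrite subn_gt0.
have [e _] := star_coef_cst S (f j) 1 rj.
by rewrite scale1r in e.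
Qed.

Lemma star1r f : star S f (one_F X) = f.
Proof.
apply/funext => r; rewrite /star /star_of.
have -> : \sum_(i < r.+1) \sum_(j < (r - i).+1) star_coef S (r - i - j)%N (f i) (one_F X j) =
    \sum_(i < r.+1) star_coef S (r - i)%N (f i) 1.
  apply: eq_bigr => i _; rewrite big_ord_recl big1 ?addr0 ?subn0 // => j _.
  by rewrite star_coef0r.
rewrite big_ord_recr /= subnn star_coef0 mulr1 big1 ?add0r // => j _.
have rj : (0 < r - j)%N by rewrite subn_gt0.
have [_ e] := star_coef_cst S (f j) 1 rj.
by rewrite scale1r in e.
Qed.

Lemma starA f g h : star S f (star S g h) = star S (star S f g) h.
Proof. exact: star_assoc. Qed.

Lemma ilamE (V : lmodType R[i]) (v : fps_module V) r :
  (ilam R *: v) r = if r is r'.+1 then iC R *: v r' else 0.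
Proof.
have iE k : ilam R k = if k == 1%N then iC R else 0.
  rewrite /ilam /GRing.mul /= /fps_mul big_ord_recl /= big1 ?addr0 => [|i _]; last first.
    by rewrite /fpsC /= mul0r.
  by rewrite subn0 /lam; case: eqP => _; rewrite ?mulr1 ?mulr0.
rewrite /GRing.scale /= /fps_scale; case: r => [|r].
  by rewrite big_ord1 iE scale0r.
rewrite big_ord_recl iE scale0r add0r big_ord_recl iE /= subSS subn0 big1 ?addr0 // => i _.
by rewrite iE scale0r.
Qed.

Lemma fpsCZ (V : lmodType R[i]) (z : R[i]) (v : fps_module V) r : (fpsC z *: v) r = z *: v r.
Proof.
rewrite /GRing.scale /= /fps_scale big_ord_recl big1 ?addr0 ?subn0 // => i _.
by rewrite scale0r.
Qed.

Lemma iC_neq0 : iC R != 0.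
Proof. by rewrite /iC eq_complex /= oner_eq0 andbF. Qed.

Lemma div_ilamK f : div_ilam (ilam R *: f) = f.
Proof.
by apply/funext => r; rewrite /div_ilam fpsCZ /sdiv_lam ilamE scalerA mulVf ?iC_neq0 // scale1r.
Qed.

Lemma ilam_div f : f 0%N = 0 -> ilam R *: div_ilam f = f.
Proof.
move=> f0; apply/funext => -[|r]; rewrite ilamE ?f0 // /div_ilam fpsCZ /sdiv_lam.
by rewrite scalerA mulfV ?iC_neq0 // scale1r.
Qed.

Lemma fps_torsion (V : lmodType R[i]) (v : fps_module V) k : v *+ k.+1 = 0 -> v = 0.
Proof.
move=> h; apply/funext => r.
have e j : (v *+ j) r = v r *+ j by elim: j => [|j IH]; rewrite ?mulr0n // !mulrS -IH.
have : v r *+ k.+1 = 0 by rewrite -e h.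
move=> /(congr1 (fun w => (k.+1%:R : R[i])^-1 *: w)).
rewrite scaler0 -[v r *+ _]scaler_nat scalerA mulVf ?scale1r // pnatr_eq0.
Qed.

Lemma ilam_reg f : ilam R *: f = 0 -> f = 0.
Proof.
move=> h; rewrite -[f]div_ilamK h; apply/funext => r.
by rewrite /div_ilam fpsCZ /sdiv_lam scaler0.
Qed.

Definition starl_lin g := ltac:(lin_beta (star_linearl g)).
Definition starr_lin f := lin_rulesP (star_linearr f).

End Star.

(** * Signs of the undeformed product *)

Section WedgeStar.
Variables (R : realType) (m : nat) (X : manifold R m) (om : symplectic_form X).
Variables (S : star_product om) (n : nat).
Local Notation OM := (Cinfty X).
Local Notation K := (fps R[i]).
Local Notation F := (fps_module OM).
Local Notation A := (ext n (ext n F)).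
Implicit Types (a b : A) (c : 'I_n) (I L : {set 'I_n}).

Lemma sum_powersetU1 (V : nmodType) c L (f : {set 'I_n} -> V) :
  (forall I, c \notin I -> f I = 0) ->
  \sum_(I in powerset L) f I =
  if c \in L then \sum_(I in powerset (L :\ c)) f (c |: I) else 0.
Proof.
move=> f0; case: ifP => cL; last first.
  apply: big1 => I; rewrite powersetE => /fintype.subsetP IL; apply: f0.
  by apply/negP => /IL; rewrite cL.
rewrite (bigID (fun I => c \in I)) /= [X in _ + X]big1 ?addr0; last by move=> I /andP[_ /f0].
rewrite (reindex_onto (fun I => c |: I) (fun I => I :\ c)) /=; last first.
  by move=> I /andP[_ cI]; rewrite finset.setD1K.
apply: eq_bigl => I; rewrite !powersetE finset.subUset finset.sub1set cL setU11 /= andbT.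
apply/andP/idP => [[IL /eqP <-]|].
  by rewrite finset.setDUl finset.setDv finset.set0U; exact: finset.setSD.
by rewrite finset.subsetD1 => /andP[-> cI]; rewrite finset.setU1K.
Qed.

Lemma inversionsE I L :
  #|[pred p : 'I_n * 'I_n | [&& p.1 \in I, p.2 \in L & (p.2 < p.1)%N]]| =
  (\sum_(i in I) position i L)%N.
Proof.
rewrite -sum1_card -(pair_big_dep (mem I) (fun i j => (j \in L) && (j < i)%N) (fun _ _ => 1%N)) /=.
by apply: eq_bigr => i _; rewrite sum1_card.
Qed.

(** The elements of [L] below [c] are counted in [I] by one sign and in the complement of [I] by the
    other. *)
Lemma shuffle_signU1 c I L : c \notin I -> I \subset L :\ c -> c \in L ->
  shuffle_sign R (c |: I) (L :\: (c |: I)) * (-1) ^+ position c (c |: I) =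
  (-1) ^+ position c L * shuffle_sign R I ((L :\ c) :\: I).
Proof.
move=> cI IL cL; have e : L :\: (c |: I) = (L :\ c) :\: I by rewrite finset.setDDl.
rewrite /shuffle_sign -!exprD !inversionsE e big_setU1 //=.
have eL : position c (L :\ c) = (position c I + position c ((L :\ c) :\: I))%N.
  by rewrite !positionE (big_setID I) /= (finset.setIidPr IL).
rewrite (positionU1 _ cI) (positionD1 _ cL) ltnn !add0n eL; congr (_ ^+ _).
by rewrite addnC addnA.
Qed.

Lemma wedge_starE a b (K1 K2 : {set 'I_n}) : wedge_star S a b K1 K2 =
  \sum_(I1 in powerset K1) \sum_(I2 in powerset K2)
      ((-1) ^+ (#|I2| * #|K1 :\: I1|)%N * shuffle_sign R I1 (K1 :\: I1)
        * shuffle_sign R I2 (K2 :\: I2))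
      *: star S (a I1 I2) (b (K1 :\: I1) (K2 :\: I2)).
Proof. by rewrite /wedge_star ffunE ffunE. Qed.

Lemma wedge_star_coef f b : wedge_star S (ext0 n (ext0 n f)) b = coef_op (star S f) b.
Proof.
apply/ffunP => K1; apply/ffunP => K2; rewrite wedge_starE.
rewrite (bigD1 finset.set0) ?powersetE ?finset.sub0set //= [X in _ + X]big1 ?addr0; last first.
  move=> I1 /andP[_ I10]; apply: big1 => I2 _.
  by rewrite ffunE (negPf I10) ffunE starl_lin scaler0.
rewrite (bigD1 finset.set0) ?powersetE ?finset.sub0set //= [X in _ + X]big1 ?addr0; last first.
  by move=> I2 /andP[_ I20]; rewrite ffunE eqxx ffunE (negPf I20) starl_lin scaler0.
rewrite !ffunE !eqxx !finset.setD0 cards0 mul0n expr0 /shuffle_sign !inversionsE !big_set0.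
by rewrite !expr0 !mul1r scale1r ffunE eqxx.
Qed.

Lemma wedge_star_wedge c a b : wedge_star S (ext_wedge c a) b = ext_wedge c (wedge_star S a b).
Proof.
apply/ffunP => K1; apply/ffunP => K2; rewrite wedge_starE [X in _ = fun_of_fin X _]ffunE.
rewrite (sum_powersetU1 (c := c)); last first.
  by move=> I1 /negPf cI1; apply: big1 => I2 _; rewrite ffunE cI1 ffunE starl_lin scaler0.
case: ifP => cK; last by rewrite ffunE.
rewrite [RHS]ffunE wedge_starE scaler_sumr; apply: eq_bigr => I1.
rewrite powersetE => I1K; rewrite scaler_sumr; apply: eq_bigr => I2 _.
have cI1 : c \notin I1 by move: I1K; rewrite finset.subsetD1 => /andP[].
rewrite ffunE setU11 ffunE starl_lin !scalerA finset.setDDl finset.setU1K //; congr (_ *: _).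
have := shuffle_signU1 cI1 I1K cK; rewrite finset.setDDl => h.
by rewrite mulrAC -[X in X * _]mulrA h; ring.
Qed.

Lemma wedge_star_inner_wedge c a b :
  wedge_star S (inner_wedge c a) b = inner_wedge c (wedge_star S a b).
Proof.
apply/ffunP => K1; apply/ffunP => K2; rewrite wedge_starE [X in _ = fun_of_fin X _]ffunE.
rewrite [RHS]ffunE [X in _ *: X]ffunE.
under eq_bigr => I1 _.
  rewrite (sum_powersetU1 (c := c)); last first.
    move=> I2 /negPf cI2; rewrite /inner_wedge ffunE [X in star S X _]ffunE.
    by rewrite [X in star S (_ *: X) _]ffunE cI2 scaler0 starl_lin scaler0.
  over.
case: ifP => cK; last by rewrite big1 ?scaler0.
rewrite wedge_starE !scaler_sumr; apply: eq_bigr => I1.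
rewrite powersetE => I1K; rewrite !scaler_sumr; apply: eq_bigr => I2; rewrite powersetE => I2K.
have cI2 : c \notin I2 by move: I2K; rewrite finset.subsetD1 => /andP[].
rewrite /inner_wedge ffunE [X in star S X _]ffunE [X in star S (_ *: X) _]ffunE setU11.
rewrite !starl_lin !scalerA finset.setDDl finset.setU1K //; congr (_ *: _).
have h := shuffle_signU1 cI2 I2K cK; rewrite finset.setDDl in h.
(* The extra antighost passes the ghosts of the second factor as well; this splits the sign of
   [inner_wedge] on the product into that on the first factor and that of the passage. *)
have cI1 : #|K1| = (#|I1| + #|K1 :\: I1|)%N by rewrite cardsDS // subnKC // subset_leq_card.
rewrite cardsU1 cI2 cI1 mulnDl mul1n !exprD.
rewrite [LHS](_ : _ = (-1) ^+ #|K1 :\: I1| * (-1) ^+ (#|I2| * #|K1 :\: I1|) * (-1) ^+ #|I1| *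
  shuffle_sign R I1 (K1 :\: I1) * (shuffle_sign R (c |: I2) (K2 :\: (c |: I2)) * (-1) ^+ position c (c |: I2)));
  last by ring.
by rewrite h; ring.
Qed.

End WedgeStar.

(** * The standard ordered product *)

Lemma sum_tuple_cons (V : nmodType) (T : finType) r (f : seq T -> V) :
  \sum_(s : r.+1.-tuple T) f s = \sum_d \sum_(s : r.-tuple T) f (d :: s).
Proof.
rewrite (reindex (fun p : T * r.-tuple T => [tuple of p.1 :: p.2])) /=; last first.
  exists (fun t => (thead t, [tuple of behead t])) => [[d s] _|t _] /=.
    by rewrite theadE; congr (_, _); apply/val_inj.
  by rewrite [t in RHS]tuple_eta.
by rewrite pair_big.
Qed.

Section TupleContraction.
Variables (K : comNzRingType) (A : lmodType K) (n : nat) (kap : K).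
Implicit Types (x y : A) (c d : 'I_n).
Variables (phi phir : A -> {linear A -> A}) (E I H J : 'I_n -> {linear A -> A}) (par : {linear A -> A}).
Variable Z : A -> Prop.
Hypotheses (phirE : forall x y, phir y x = phi x y)
  (phi_E : forall c x y, phi (E c x) y = E c (phi x y))
  (phi_H : forall c x y, phi (H c x) y = H c (phi x y))
  (JE : forall d c x, J d (E c x) = E c (J d x))
  (JH : forall d c x, J d (H c x) = (d == c)%:R *: par x + H c (J d x))
  (J_par : forall d x, J d (par x) = - par (J d x))
  (II : forall c d x, I c (I d x) = - I d (I c x))
  (ZJ : forall d x, Z x -> Z (J d x))
  (phi_Z : forall c x y, Z x -> phi (par x) (I c y) = I c (phi x y))
  (I_top : forall (s : seq 'I_n) y, (n < size s)%N -> foldr I y s = 0).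

(** Applies the [r]-th power of the contraction before [phi], one index at a time, so that
    inductions on [r] replace manipulations of tuples. *)
Fixpoint insert_contraction r x y : A :=
  if r is r'.+1 then \sum_d insert_contraction r' (J d x) (I d y) else phi x y.
Local Notation T := insert_contraction.

Local Notation opl := (fun c => linear_rules (E c), fun c => linear_rules (I c), fun c => linear_rules (H c),
  fun c => linear_rules (J c), linear_rules par).

Lemma contraction_sum r x y :
  \sum_(s : r.-tuple 'I_n) phi (foldr J x s) (foldr I y s) = T r x y.
Proof.
transitivity (\sum_(s : r.-tuple 'I_n) phi (foldl (fun x d => J d x) x s) (foldl (fun x d => I d x) y s)).
  (* [foldr] applies the last entry first, the recursion the first one; the sum over all tuples is
     invariant under reversal. *)
  rewrite (reindex_inj (h := fun s : r.-tuple 'I_n => [tuple of rev s])) /=.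
    by apply: eq_bigr => s _; rewrite -!foldl_rev !revK.
  by move=> s t /(congr1 (fun u : r.-tuple 'I_n => rev u)); rewrite /= !revK => /val_inj.
elim: r x y => [|r IH] x y /=.
  by rewrite (big_pred1 [tuple]) // => s; apply/esym/eqP; rewrite (tuple0 s).
rewrite (sum_tuple_cons r (fun s => phi (foldl (fun x d => J d x) x s) (foldl (fun x d => I d x) y s))).
by apply: eq_bigr => d _; rewrite -IH.
Qed.

Lemma contraction_linearl r y : linear (fun x => T r x y).
Proof.
elim: r y => [|r IH] y k x x' /=; first by rewrite -!phirE linearP.
rewrite scaler_sumr -big_split; apply: eq_bigr => d _ /=.
by rewrite -IH ?opl.
Qed.
Definition contraction_linl r y := ltac:(lin_beta (contraction_linearl r y)).

Lemma contraction_linearr r x : linear (T r x).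
Proof.
elim: r x => [|r IH] x k y y' /=; first by rewrite linearP.
rewrite scaler_sumr -big_split; apply: eq_bigr => d _ /=.
by rewrite -IH ?opl.
Qed.
Definition contraction_linr r x := lin_rulesP (contraction_linearr r x).

Lemma contraction_E r c x y : T r (E c x) y = E c (T r x y).
Proof.
elim: r x y => [|r IH] x y /=; first exact: phi_E.
by rewrite ?opl; apply: eq_bigr => d _; rewrite JE IH.
Qed.

(** Each of the [r] contractions may hit the new antighost. The hits give equal terms, since the
    signs from [par] and from exchanging insertions cancel. *)
Lemma contraction_H r c x y :
  T r (H c x) y = H c (T r x y) + T r.-1 (par x) (I c y) *+ r.
Proof.
elim: r x y => [|r IH] x y /=; first by rewrite phi_H mulr0n addr0.
transitivity (\sum_d ((c == d)%:R *: T r (par x) (I d y) + (H c (T r (J d x) (I d y))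
    + T r.-1 (par (J d x)) (I c (I d y)) *+ r))).
  by apply: eq_bigr => d _; rewrite JH ?contraction_linl IH eq_sym.
rewrite !big_split /= sum_delta ?opl mulrS addrCA; congr (_ + (_ + _)).
rewrite sumrMnl; case: r {IH} => [|r]; first by rewrite !mulr0n.
congr (_ *+ _); apply: eq_bigr => d _.
change (T r (par (J d x)) (I c (I d y)) = T r (J d (par x)) (I d (I c y))).
by rewrite J_par [I d (I c y)]II ?contraction_linl ?contraction_linr opprK.
Qed.

Lemma contraction_Z r c x y : Z x -> T r (par x) (I c y) = I c (T r x y).
Proof.
elim: r x y => [|r IH] x y Zx /=; first exact: phi_Z.
rewrite ?opl; apply: eq_bigr => d _.
rewrite J_par II ?contraction_linl ?contraction_linr opprK IH //; exact: ZJ.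
Qed.

Lemma contraction_top r c x y : (n <= r)%N -> T r x (I c y) = 0.
Proof.
move=> nr; rewrite -contraction_sum big1 // => s _.
have -> : foldr I (I c y) s = foldr I y (rcons s c) by rewrite foldr_rcons.
by rewrite I_top ?linear0 // size_rcons size_tuple.
Qed.

Lemma contraction_killed r x y : (forall d, J d x = 0) -> T r.+1 x y = 0.
Proof. by move=> Jx; rewrite /= big1 // => d _; rewrite Jx contraction_linl. Qed.

Variable coef : nat -> K.
Hypotheses (coef0 : coef 0 = 1) (coefS : forall r, coef r.+1 *+ r.+1 = coef r * kap).

Definition contraction_exp x y : A := \sum_(r < n.+1) coef r *: T r x y.

Lemma contraction_exp_E c x y : contraction_exp (E c x) y = E c (contraction_exp x y).
Proof.
by rewrite /contraction_exp ?opl; apply: eq_bigr => r _; rewrite contraction_E ?opl.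
Qed.

(** The derivative of the exponential is [kap] times the exponential, by [coefS]. Differentiating
    the truncated series loses the term of order [n], which vanishes as it contains [n.+1]
    insertions. *)
Lemma contraction_exp_H c x y : Z x ->
  contraction_exp (H c x) y = H c (contraction_exp x y) + kap *: I c (contraction_exp x y).
Proof.
move=> Zx; rewrite /contraction_exp ?opl.
transitivity (\sum_(r < n.+1) H c (coef r *: T r x y) +
    \sum_(r < n.+1) coef r *: (T r.-1 (par x) (I c y) *+ r)).
  by rewrite -big_split; apply: eq_bigr => r _; rewrite /= contraction_H ?opl scalerDr.
congr (_ + _); rewrite big_ord_recl mulr0n scaler0 add0r.
rewrite big_ord_recr /= ?opl -contraction_Z // contraction_top // scaler0 addr0.
rewrite scaler_sumr; apply: eq_bigr => r _; rewrite ?opl -contraction_Z //=.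
by rewrite -scalerMnr scalerMnl /bump /= add1n coefS scalerA mulrC.
Qed.

Lemma contraction_exp0 x y : (forall d, J d x = 0) -> contraction_exp x y = phi x y.
Proof.
move=> Jx; rewrite /contraction_exp big_ord_recl coef0 scale1r big1 ?addr0 // => r _.
by rewrite contraction_killed // scaler0.
Qed.

(** Every contraction lowers the degree of the second factor, and [h] detects products only for
    second factors of degree zero; so only the uncontracted term survives. *)
Lemma contraction_exp_head (V : lmodType K) (h : {linear A -> V}) (G : int -> set A) x y :
  (forall d z y, G z y -> G (z - 1) (I d y)) ->
  (forall z x y, G z y -> z != 0 -> h (phi x y) = 0) -> G 0 y ->
  h (contraction_exp x y) = h (phi x y).
Proof.
move=> GI Gphi Gy.
have T0 r : forall z x y, G z y -> z - r%:Z != 0 -> h (T r x y) = 0.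
  elim: r => [|r IH] z x' y' Gz zr; first by rewrite (Gphi z) //; rewrite subr0 in zr.
  rewrite /= linear_sum big1 // => d _; apply: (IH (z - 1)); first exact: GI.
  by rewrite -addrA -opprD -PoszD add1n.
rewrite /contraction_exp linear_sum big_ord_recl big1 => [|r _]; first by rewrite coef0 scale1r addr0.
by rewrite (linear_rules h) (T0 _ 0) ?scaler0.
Qed.

Lemma contraction_exp_linearl y : linear (fun x => contraction_exp x y).
Proof.
move=> k x x'; rewrite /contraction_exp scaler_sumr -big_split; apply: eq_bigr => r _ /=.
by rewrite ?contraction_linl scalerDr !scalerA mulrC.
Qed.

Lemma contraction_exp_linearr x : linear (contraction_exp x).
Proof.
move=> k y y'; rewrite /contraction_exp scaler_sumr -big_split; apply: eq_bigr => r _ /=.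
by rewrite ?contraction_linr scalerDr !scalerA mulrC.
Qed.

End TupleContraction.

Section RealCoefficients.
Variable R : realType.
Implicit Types a b : R.

Lemma fpsC_is_additive (C : comNzRingType) : zmod_morphism (@fpsC C).
Proof. by move=> x y; apply/funext => -[|r] //; symmetry; exact: subrr. Qed.

Lemma fpsC_is_multiplicative (C : comNzRingType) : monoid_morphism (@fpsC C).
Proof.
split; first by apply/funext => -[].
move=> x y; apply/funext => r; rewrite [RHS]/GRing.mul /= /fps_mul big_ord_recl.
rewrite big1 ?addr0 ?subn0 => [|i _]; last by rewrite mul0r.
by case: r => //= r; rewrite mulr0.
Qed.

HB.instance Definition _ (C : comNzRingType) :=
  GRing.isZmodMorphism.Build C (fps C) (@fpsC C) (@fpsC_is_additive C).
HB.instance Definition _ (C : comNzRingType) :=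
  GRing.isMonoidMorphism.Build C (fps C) (@fpsC C) (@fpsC_is_multiplicative C).

Definition rc_morphism : {rmorphism R -> fps R[i]} := [the {rmorphism R -> fps R[i]} of
  (@fpsC R[i] \o (fun t : R => t%:C%C))].

Lemma rcE a : rc a = rc_morphism a. Proof. by []. Qed.
Lemma rcD a b : rc (a + b) = rc a + rc b. Proof. by rewrite !rcE rmorphD. Qed.
Lemma rcN a : rc (- a) = - rc a. Proof. by rewrite !rcE rmorphN. Qed.
Lemma rcM a b : rc (a * b) = rc a * rc b. Proof. by rewrite !rcE rmorphM. Qed.
Lemma rcX a k : rc (a ^+ k) = rc a ^+ k. Proof. by rewrite !rcE rmorphXn. Qed.
Lemma rcMn a k : rc (a *+ k) = rc a *+ k. Proof. by rewrite !rcE rmorphMn. Qed.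
Lemma rc0 : rc (0 : R) = 0. Proof. by rewrite !rcE rmorph0. Qed.
Lemma rc1 : rc (1 : R) = 1. Proof. by rewrite !rcE rmorph1. Qed.
Lemma rc_sum (I : Type) (r : seq I) (P : pred I) (f : I -> R) :
  rc (\sum_(i <- r | P i) f i) = \sum_(i <- r | P i) rc (f i).
Proof. exact: (big_morph _ rcD rc0). Qed.
Lemma rc_half : rc (2^-1 : R) + rc 2^-1 = 1.
Proof. by rewrite -rcD -rc1 [1 in RHS]splitr !mul1r. Qed.

Lemma exp_coef0 (k : fps R[i]) : rc ((0`!)%:R : R)^-1 * (2 * k) ^+ 0 = 1.
Proof. by rewrite fact0 invr1 rc1 mul1r. Qed.

Lemma exp_coefS (k : fps R[i]) r :
  (rc (r.+1`!%:R)^-1 * (2 * k) ^+ r.+1) *+ r.+1 =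
  rc (r`!%:R)^-1 * (2 * k) ^+ r * (k + k).
Proof.
rewrite -mulrnAl -rcMn factS natrM.
have -> : ((r.+1%:R * r`!%:R)^-1 *+ r.+1 : R) = (r`!%:R)^-1.
  by rewrite invfM -mulrnAl -[_^-1 *+ _]mulr_natr mulVf ?mul1r // pnatr_eq0.
by rewrite (exprS (2 * k)); ring.
Qed.

End RealCoefficients.

Section ExponentialProduct.
Variables (n : nat) (K : comNzRingType) (F : lmodType K) (kap : K).
Local Notation A := (ext n (ext n F)).
Implicit Types (a b x y : A) (c d : 'I_n) (f g : F).
Local Ltac mod_A := module_eq K (A : lmodType K).
Local Notation lin := (calculus_lin n F).

Definition right_insert d x : A := locked (- inner_insert d (ext_parity x)).
Lemma right_insertE d x : right_insert d x = - inner_insert d (ext_parity x).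
Proof. by rewrite /right_insert -lock. Qed.
Lemma right_insert_linear d : linear (right_insert d).
Proof. by move=> k x y; rewrite !right_insertE ?lin; mod_A. Qed.
HB.instance Definition _ d := GRing.isLinear.Build K A A _ (right_insert d) (right_insert_linear d).

Lemma right_insert_wedge d c x : right_insert d (ext_wedge c x) = ext_wedge c (right_insert d x).
Proof. by rewrite !right_insertE ext_parity_wedge ?lin inner_insert_outer_wedge opprK. Qed.

Lemma right_insert_inner_wedge d c x :
  right_insert d (inner_wedge c x) = (d == c)%:R *: ext_parity x + inner_wedge c (right_insert d x).
Proof.
by rewrite !right_insertE ext_parity_inner_wedge ?lin inner_insert_wedge; mod_A.
Qed.

Lemma right_insert_parity d x : right_insert d (ext_parity x) = - ext_parity (right_insert d x).
Proof. by rewrite !right_insertE ?lin ext_parity_inner_insert ext_parityK opprK. Qed.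

Lemma right_insert0 d f : right_insert d (ext0 n (ext0 n f)) = 0.
Proof. by rewrite right_insertE ext_parity0 inner_insert0 oppr0. Qed.

Definition antighost x := exists y : ext n F, x = ext0 n y.

Lemma right_insert_antighost d x : antighost x -> antighost (right_insert d x).
Proof.
move=> [y ->]; exists (- ext_insert d (ext_smap idfun y)).
by rewrite right_insertE ext_parity_ext0 /inner_insert ext_smap0 ?lin.
Qed.

Lemma ext_insert_top (V : lmodType K) (s : seq 'I_n) (y : ext n V) :
  (n < size s)%N -> foldr (@ext_insert n K V) y s = 0.
Proof.
have h (L : {set 'I_n}) : (n < #|L| + size s)%N -> foldr (@ext_insert n K V) y s L = 0.
  elim: s L => [|c s IH] L /=.
    by rewrite addn0 ltnNge (leq_trans (max_card _)) ?card_ord.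
  move=> nL; rewrite ffunE; case: ifP => // cL.
  by rewrite IH ?scaler0 // cardsU1 cL add1n addSnnS.
move=> ns; suff e : foldr (@ext_insert n K V) y s = 0 :> ext n V by exact: e.
by apply/ffunP => L; rewrite h ?ffunE // ltn_addl.
Qed.

Variables (mul mulr : F -> {linear F -> F}) (one : F) (phi phir : A -> {linear A -> A}).
Variable coef : nat -> K.
Hypotheses (phirE : forall x y, phir y x = phi x y)
  (phi_E : forall c x y, phi (ext_wedge c x) y = ext_wedge c (phi x y))
  (phi_H : forall c x y, phi (inner_wedge c x) y = inner_wedge c (phi x y))
  (phi_coef : forall f y, phi (ext0 n (ext0 n f)) y = coef_op (mul f) y)
  (coef0 : coef 0 = 1) (coefS : forall r, coef r.+1 *+ r.+1 = coef r * kap)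
  (mulrE : forall f g, mulr g f = mul f g)
  (mulA : forall f g h, mul f (mul g h) = mul (mul f g) h)
  (mul1 : forall f, mul one f = f) (mulx1 : forall f, mul f one = f).

Let phi_linear y : linear (fun x => phi x y).
Proof. by move=> k a a'; rewrite -!phirE linearP. Qed.
Let phi_lin y := ltac:(lin_beta (phi_linear y)).

(** The graded Leibniz rule for an insertion, whose other term is absent because [x] has no ghosts
    to insert into. *)
Lemma antighost_phi c x y : antighost x ->
  phi (ext_parity x) (ext_insert c y) = ext_insert c (phi x y).
Proof.
move=> [z ->]; elim/ext_ind: z => [z z' IH IH'|f|d z IH].
- by rewrite ?lin !phi_lin IH IH' ?lin.
- by rewrite ext_parity0 !phi_coef coef_op_insert.
- rewrite -inner_wedge0 ext_parity_inner_wedge !phi_lin !phi_H IH inner_wedge_insert.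
  by rewrite opprK.
Qed.

Definition exp_insert c : {linear A -> A} := @ext_insert n K (ext n F) c.
Definition exp_right_insert c : {linear A -> A} := right_insert c.
Definition exp_product x y : A := contraction_exp phi exp_insert exp_right_insert coef x y.
Definition exp_product_right y x : A := exp_product x y.
HB.instance Definition _ x := GRing.isLinear.Build K A A _ (exp_product x)
  (contraction_exp_linearr phi exp_insert exp_right_insert coef x).
HB.instance Definition _ y := GRing.isLinear.Build K A A _ (exp_product_right y)
  (contraction_exp_linearl exp_insert exp_right_insert phirE coef y).

(** Kept transparent, since its projections are later identified by conversion with the concrete
    products. *)
Definition exp_clifford_product : clifford_product n F kap.
Proof.
exists mul mulr one (fun x => exp_product x : {linear A -> A})
  (fun y => exp_product_right y : {linear A -> A}) => //.
- move=> c a b; apply: (contraction_exp_E (phi := phi) (E := fun c => @ext_wedge n K (ext n F) c : {linear A -> A}) exp_insert phi_E) => d x y.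
  exact: right_insert_wedge.
- move=> c x b; rewrite clifford_wedgeE.
  have JH d c' z : exp_right_insert d (inner_wedge c' z) =
      (d == c')%:R *: ext_parity z + inner_wedge c' (exp_right_insert d z).
    exact: right_insert_inner_wedge.
  have Jp d z : exp_right_insert d (ext_parity z) = - ext_parity (exp_right_insert d z).
    exact: right_insert_parity.
  have II c' d z : exp_insert c' (exp_insert d z) = - exp_insert d (exp_insert c' z).
    exact: ext_insertC.
  have It (s : seq 'I_n) (y : A) : (n < size s)%N -> foldr exp_insert y s = 0.
    by move=> ns; apply: ext_insert_top.
  have Zx : antighost (ext0 n x) by exists x.
  exact: (@contraction_exp_H K A n kap phi phir exp_insert
    (fun c => inner_wedge c : {linear A -> A}) exp_right_insert (@ext_parity n K F : {linear A -> A})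
    antighost phirE phi_H JH Jp II right_insert_antighost antighost_phi It coef coefS c _ b Zx).
- move=> f b; rewrite -phi_coef; apply: (contraction_exp0 exp_insert (J := exp_right_insert) phirE coef0 b).
  by move=> d; exact: right_insert0.
Defined.

End ExponentialProduct.

Section StandardOrderedProduct.
Variables (R : realType) (m : nat) (X : manifold R m) (om : symplectic_form X).
Variables (S : star_product om) (n : nat).
Local Notation OM := (Cinfty X).
Local Notation K := (fps R[i]).
Local Notation F := (fps_module OM).
Local Notation A := (ext n (ext n F)).
Implicit Types (a b x y : A) (c d : 'I_n).
Local Ltac mod_A := module_eq (fps R[i]) (ext n (ext n (fps_module (Cinfty X))) : lmodType (fps R[i])).
Local Ltac mod_F := module_eq (fps R[i]) (fps_module (Cinfty X) : lmodType (fps R[i])).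

Lemma parityE a : parity a = ext_parity a.
Proof.
apply/ffunP => I; apply/ffunP => L.
by rewrite /parity !ffunE scalerA exprD.
Qed.

Lemma bigraded_coef k a b (I L : {set 'I_n}) : (k *: a + b) I L = k *: a I L + b I L.
Proof. by rewrite !ffunE. Qed.

Lemma wedge_star_linearl b : linear (fun a => wedge_star S a b).
Proof.
move=> k a a'; apply/ffunP => I; apply/ffunP => L; rewrite bigraded_coef !wedge_starE.
rewrite scaler_sumr -big_split; apply: eq_bigr => I1 _ /=.
rewrite scaler_sumr -big_split; apply: eq_bigr => I2 _ /=.
by rewrite bigraded_coef ?starl_lin; mod_F.
Qed.

Lemma wedge_star_linearr a : linear (wedge_star S a).
Proof.
move=> k b b'; apply/ffunP => I; apply/ffunP => L; rewrite bigraded_coef !wedge_starE.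
rewrite scaler_sumr -big_split; apply: eq_bigr => I1 _ /=.
rewrite scaler_sumr -big_split; apply: eq_bigr => I2 _ /=.
by rewrite bigraded_coef ?starr_lin; mod_F.
Qed.

Definition wedge_star_right b : A -> A := fun a => wedge_star S a b.
HB.instance Definition _ a := GRing.isLinear.Build K A A _ (wedge_star S a) (wedge_star_linearr a).
HB.instance Definition _ b := GRing.isLinear.Build K A A _ (wedge_star_right b) (wedge_star_linearl b).

Lemma starSE a b : starS S a b = exp_product (fun a => wedge_star S a : {linear A -> A})
  (fun r => rc (r`!%:R)^-1 * (2%:R * ilam R) ^+ r) a b.
Proof.
apply: eq_bigr => r _; congr (_ *: _).
rewrite -(@contraction_sum (fps R[i]) (ext n (ext n (fps_module (Cinfty X)))) n (fun a => wedge_star S a : {linear A -> A})).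
apply: eq_bigr => s _; congr (wedge_star S _ _).
elim: (val s) => //= c s' ->.
by rewrite /rinsert_covec /= /exp_right_insert /= right_insertE parityE.
Qed.

Definition standard_product : clifford_product n F (ilam R + ilam R).
Proof.
exact: (@exp_clifford_product n (fps R[i]) (fps_module (Cinfty X)) (ilam R + ilam R)
  (star_left S) (star_right S) (one_F X) (fun a => wedge_star S a : {linear A -> A})
  (fun b => wedge_star_right b : {linear A -> A}) (fun r => rc (r`!%:R)^-1 * (2%:R * ilam R) ^+ r)
  (fun x y => erefl) (@wedge_star_wedge _ _ _ _ S n) (@wedge_star_inner_wedge _ _ _ _ S n)
  (@wedge_star_coef _ _ _ _ S n) (exp_coef0 _) (exp_coefS _) (fun f g => erefl) (@starA _ _ _ _ S)
  (@star1l _ _ _ _ S) (@star1r _ _ _ _ S)).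
Defined.

Lemma standard_productE a b : cl_st standard_product a b = starS S a b.
Proof. by rewrite starSE. Qed.

End StandardOrderedProduct.

(** * The BRST operator *)

Section LinearSums.
Variables (K : pzRingType) (U V : lmodType K).

Lemma sum_linear (I : Type) (r : seq I) (P : pred I) (f : I -> U -> V) :
  (forall i, linear (f i)) -> linear (fun x => \sum_(i <- r | P i) f i x).
Proof.
by move=> lf k x y; rewrite scaler_sumr -big_split; apply: eq_bigr => i _; exact: lf.
Qed.

Lemma add_linear (f g : U -> V) : linear f -> linear g -> linear (fun x => f x + g x).
Proof. by move=> lf lg k x y; rewrite lf lg scalerDr addrACA. Qed.

Lemma opp_linear (f : U -> V) : linear f -> linear (fun x => - f x).
Proof. by move=> lf k x y; rewrite lf opprD scalerN. Qed.

End LinearSums.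

Lemma scale_linear (K : comPzRingType) (U V : lmodType K) (t : K) (f : U -> V) :
  linear f -> linear (fun x => t *: f x).
Proof. by move=> lf k x y; rewrite lf scalerDr !scalerA mulrC. Qed.

Section ProductModule.
Variables (n : nat) (K : comNzRingType) (F : lmodType K) (ilam : K).
Variable P : clifford_product n F (ilam + ilam).
Local Notation A := (ext n (ext n F)).

Definition product_module : clifford_module n (A : lmodType K) ilam.
Proof.
exists (fun c => @ext_wedge n K (ext n F) c : {linear A -> A})
  (fun c => @ext_insert n K (ext n F) c : {linear A -> A})
  (fun c => @inner_wedge n K F c : {linear A -> A}) (fun c => @inner_insert n K F c : {linear A -> A})
  (@ext_parity n K F : {linear A -> A}) (cl_st P) (cl_str P) (ext0 n (ext0 n (cl_one P))).
- exact: ext_wedgeC.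
- exact: ext_insertC.
- exact: inner_wedgeC.
- exact: inner_insertC.
- exact: ext_insert_wedge.
- exact: inner_wedge_wedge.
- exact: inner_wedge_insert.
- exact: inner_insert_outer_wedge.
- exact: ext_parity_wedge.
- exact: ext_parity_inner_insert.
- exact: ext_parityK.
- exact: cl_strE.
- exact: cl_st_wedge.
- exact: st1.
- exact: stx1.
- by move=> c a; rewrite cl_st_inner0 st1 clifford_wedgeE.
- by move=> c a b; rewrite st_par_wedge coclifford_wedgeE.
- exact: st_par_inner1.
Defined.

End ProductModule.

Section ChargeComplex.
Variables (n : nat) (K : comNzRingType) (F : lmodType K) (ilam : K).
Variable P : clifford_product n F (ilam + ilam).
Variables (t t2 t4 : 'I_n -> 'I_n -> 'I_n -> K) (ch : 'I_n -> K) (jF : 'I_n -> F).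
Variable (rhoF : 'I_n -> {linear F -> F}).
Hypotheses (t2E : forall c d b, t2 c d b = t4 c d b + t4 c d b)
  (tE : forall c d b, t c d b = t2 c d b + t2 c d b)
  (t4C : forall c d b, t4 c d b = - t4 c b d) (t4xx : forall c d, t4 c d d = 0)
  (jacobi : forall e b c d, \sum_i (t4 i b c * t4 e i d + t4 i c d * t4 e i b
                                   + t4 i d b * t4 e i c) = 0)
  (chE : forall d b, \sum_c t c d b * ch c = 0)
  (rhoFE : forall d f, cl_mul P (jF d) f = cl_mulr P (jF d) f + ilam *: rhoF d f)
  (jFC : forall d b, cl_mul P (jF d) (jF b) - cl_mul P (jF b) (jF d) =
    ilam *: \sum_c t c d b *: jF c)
  (torsionF : forall (f : F) k, f *+ k.+1 = 0 -> f = 0)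
  (ilam_regF : forall f : F, ilam *: f = 0 -> f = 0).
Local Notation A := (ext n (ext n F)).
Implicit Types (a x y : A) (b c d : 'I_n) (f g : F).
Local Ltac mod_A := module_eq K (A : lmodType K).
Local Notation M := (product_module P).
Local Notation lin := (calculus_lin n F).
Local Notation st := (cl_st P).

Definition charge_jv d : A := ext0 n (ext0 n (jF d)).
Definition charge_L d : {linear A -> A} := coef_op (cl_mul P (jF d)).
Definition charge_R d : {linear A -> A} := coef_op (cl_mulr P (jF d)).
Definition charge_rho d : {linear A -> A} := coef_op (rhoF d).

Definition brst_element : A := brst_charge M t4 ch charge_jv.
(* The locks keep unification from exposing the sums. *)
Definition charge_ce a : A := locked (ce_op M t t2 charge_rho a).
Definition charge_koszul a : A := locked (koszul_op M t ch charge_R a).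
Lemma charge_ceE a : charge_ce a = ce_op M t t2 charge_rho a.
Proof. by rewrite /charge_ce -lock. Qed.
Lemma charge_koszulE a : charge_koszul a = koszul_op M t ch charge_R a.
Proof. by rewrite /charge_koszul -lock. Qed.
Definition charge_diff a : A := charge_ce a + charge_koszul a *+ 2.

Lemma brst_elementE : brst_element =
  - (\sum_d \sum_b \sum_c t4 c d b *:
       ext_wedge d (ext_wedge b (ext0 n (ext_wedge c (ext0 n (cl_one P))))))
  + \sum_d ext_wedge d (ext0 n (ext0 n (jF d)))
  + ilam *: \sum_d ch d *: ext_wedge d (ext0 n (ext0 n (cl_one P))).
Proof.
have -> : brst_element = brst_Omega M t4 + brst_J M charge_jv + ilam *: brst_chi M ch by [].
suff -> : brst_Omega M t4 = - (\sum_d \sum_b \sum_c t4 c d b *: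
       ext_wedge d (ext_wedge b (ext0 n (ext_wedge c (ext0 n (cl_one P)))))) by [].
rewrite /brst_Omega.
congr (- _); apply: eq_bigr => d _; apply: eq_bigr => b _; apply: eq_bigr => c _.
by rewrite /= inner_wedge0.
Qed.

(** An inner wedge and an inner insertion carry two equal signs, so the adjoint action enters
    through [ext_map]. *)
Lemma charge_ce_CE a : charge_ce a =
  - (\sum_d \sum_b \sum_c t2 c d b *: ext_wedge d (ext_wedge b (ext_insert c a)))
  + \sum_d ext_wedge d (ext_map (fun x : ext n F =>
      \sum_b \sum_c t c d b *: ext_wedge c (ext_insert b x) + ext_map (rhoF d) x) a).
Proof.
rewrite charge_ceE /ce_op -addrA -big_split /=; congr (- _ + _); apply: eq_bigr => d _.
rewrite -(linearD (ext_wedge d)) /=; congr (ext_wedge d _); apply/ffunP => I.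
rewrite ffunE [RHS]ffunE [X in _ + X]ffunE; congr (_ + _).
rewrite sum_ffunE; apply: eq_bigr => b _; rewrite sum_ffunE; apply: eq_bigr => c _.
by rewrite /inner_wedge /inner_insert ext_smap_smap ffunE [X in _ *: X]ffunE.
Qed.

(** Each summand has one or three inner operators; an odd number of equal signs leaves the single
    sign of [ext_smap]. *)
Lemma charge_koszul_smap a : charge_koszul a = ext_smap (fun x : ext n F =>
  \sum_d ext_map (fun f => cl_mulr P (jF d) f) (ext_insert d x)
  + ilam *: (\sum_d ch d *: ext_insert d x)
  - ilam *: (\sum_(d : 'I_n) \sum_(b : 'I_n | (d < b)%N) \sum_c
      t c d b *: ext_wedge c (ext_insert b (ext_insert d x)))) a.
Proof.
rewrite charge_koszulE /koszul_op; apply/ffunP => I; symmetry.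
have sE (I0 : finType) (Q : pred I0) (phi : I0 -> A) :
  (\sum_(i | Q i) phi i) I = \sum_(i | Q i) phi i I by rewrite sum_ffunE.
rewrite !(ffunE (fun _ => _ *: _)) scalerBr scalerDr.
rewrite [RHS]ffunE [X in _ = X + _]ffunE; congr (_ + _ + _).
- rewrite sE scaler_sumr; apply: eq_bigr => d _ /=.
  by rewrite /inner_insert !(ffunE (fun _ => _ *: _)) ext_map_insert /charge_R /= /coef_op ffunE.
- rewrite [RHS]ffunE sE scalerA mulrC -scalerA; congr (_ *: _); rewrite scaler_sumr.
  apply: eq_bigr => d _; rewrite [RHS]ffunE /= /inner_insert !(ffunE (fun _ => _ *: _)).
  by rewrite !scalerA mulrC.
- rewrite [RHS]ffunE ?scalerN; congr (- _).
  rewrite [RHS]ffunE sE scalerA mulrC -scalerA; congr (_ *: _); rewrite scaler_sumr.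
  apply: eq_bigr => d _; rewrite sE scaler_sumr.
  apply: eq_bigr => b _; rewrite sE scaler_sumr.
  apply: eq_bigr => c _; rewrite [RHS]ffunE.
  rewrite /= /inner_wedge /inner_insert ext_smap_smap (ffunE (fun _ => (_ \o _) _)) /=.
  rewrite !(ffunE (fun _ => _ *: _)) ?(ext_wedge_lin, ext_insert_lin).
  by rewrite !scalerA mulrC.
Qed.

Lemma bigradedP (a b : A) : (forall I L : {set 'I_n}, a I L = b I L) -> a = b.
Proof. by move=> h; apply/ffunP => I; apply/ffunP => L. Qed.

Lemma bigraded0 (I L : {set 'I_n}) : (0 : A) I L = 0.
Proof. by rewrite !ffunE. Qed.
Lemma bigradedD (a b : A) (I L : {set 'I_n}) : (a + b) I L = a I L + b I L.
Proof. by rewrite !ffunE. Qed.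
Lemma bigradedZ k a (I L : {set 'I_n}) : (k *: a) I L = k *: a I L.
Proof. by rewrite !ffunE. Qed.
Lemma bigradedN a (I L : {set 'I_n}) : (- a) I L = - a I L.
Proof. by rewrite !ffunE. Qed.
Lemma bigradedMn a k (I L : {set 'I_n}) : (a *+ k) I L = a I L *+ k.
Proof. by elim: k => [|k IH]; rewrite ?mulr0n ?ffunE ?ffunE // !mulrS bigradedD IH. Qed.
Lemma bigraded_sum (J : Type) (r : seq J) (Q : pred J) (h : J -> A) (I L : {set 'I_n}) :
  (\sum_(i <- r | Q i) h i) I L = \sum_(i <- r | Q i) h i I L.
Proof. by apply: (big_morph (fun a : A => a I L)) => [a b|]; rewrite ?bigradedD // !ffunE. Qed.
Lemma bigraded_coef_op (f : F -> F) a (I L : {set 'I_n}) : coef_op f a I L = f (a I L).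
Proof. by rewrite !ffunE. Qed.
Definition bigradedE := (bigradedD, bigradedZ, bigradedN, bigradedMn, bigraded_sum, bigraded_coef_op).

Lemma torsionA a k : a *+ k.+1 = 0 -> a = 0.
Proof.
move=> h; apply: bigradedP => I L; rewrite bigraded0; apply: (torsionF (k := k)).
by have := bigradedMn a k.+1 I L; rewrite h bigraded0.
Qed.

Lemma ilam_regA a : ilam *: a = 0 -> a = 0.
Proof.
move=> h; apply: bigradedP => I L; rewrite bigraded0; apply: ilam_regF.
by have := bigradedZ ilam a I L; rewrite h bigraded0.
Qed.

Lemma charge_LrhoE d a : charge_L d a = charge_R d a + ilam *: charge_rho d a.
Proof. by apply: bigradedP => I L; rewrite ?bigradedE rhoFE. Qed.

Lemma charge_LL (d b : 'I_n) a : charge_L d (charge_L b a) - charge_L b (charge_L d a) =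
  ilam *: \sum_c t c d b *: charge_L c a.
Proof.
apply: bigradedP => I L; rewrite ?bigradedE !cl_mulA.
have ml g := linear_rules (cl_mulr P g).
transitivity (cl_mul P (cl_mul P (jF d) (jF b) - cl_mul P (jF b) (jF d)) (a I L)).
  by rewrite -!cl_mulrE ?ml.
rewrite jFC -cl_mulrE ?ml; congr (_ *: _).
by apply: eq_bigr => c _; rewrite bigradedZ ?ml cl_mulrE /charge_L bigraded_coef_op.
Qed.

Lemma charge_commutator a : st brst_element a - st (ext_parity a) brst_element = ilam *: charge_diff a.
Proof.
rewrite /charge_diff charge_ceE charge_koszulE.
apply: (@brst_commutator n K A ilam M t t2 t4 ch charge_jv charge_L charge_R charge_rho) => //.
- by move=> d b; exact: cl_st_coef.
- by move=> d b; exact: st_coefr.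
- exact: charge_LrhoE.
- by move=> d c x; exact: coef_op_wedge.
- by move=> d c x; exact: coef_op_inner_insert.
Qed.

Lemma charge_sq a : st brst_element (st brst_element a) = 0.
Proof.
apply: (@brst_charge_sq n K A ilam M t t2 t4 ch charge_jv charge_L) => //.
- by move=> d b; exact: cl_st_coef.
- by move=> d c x; exact: coef_op_wedge.
- by move=> d c x; exact: coef_op_inner_wedge.
- by move=> d c x; exact: coef_op_insert.
- exact: charge_LL.
- exact: torsionA.
Qed.

Lemma charge_parity : ext_parity brst_element = - brst_element.
Proof.
have e1 : ext_parity (brst_Omega M t4) = - brst_Omega M t4.
  rewrite /brst_Omega ?lin; congr (- _); rewrite -sumrN; apply: eq_bigr => d _.
  rewrite ?lin -sumrN; apply: eq_bigr => b _; rewrite ?lin -sumrN; apply: eq_bigr => c _.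
  by rewrite ?lin /= !ext_parity_wedge ext_parity_inner_wedge ext_parity0 ?lin; mod_A.
have e2 : ext_parity (brst_J M charge_jv) = - brst_J M charge_jv.
  rewrite /brst_J ?lin -sumrN; apply: eq_bigr => d _.
  by rewrite /= ext_parity_wedge ext_parity0.
have e3 : ext_parity (brst_chi M ch) = - brst_chi M ch.
  rewrite /brst_chi ?lin -sumrN; apply: eq_bigr => d _.
  by rewrite /= ?lin ext_parity_wedge ext_parity0 scalerN.
rewrite /brst_element /brst_charge; move: e1 e2 e3.
by move: (brst_Omega _ _) (brst_J _ _) (brst_chi _ _) => x y z e1 e2 e3; rewrite ?lin e1 e2 e3; mod_A.
Qed.

Definition antighost_num a : A := locked (ext_map (@ext_num n K F) a).
Lemma antighost_numE a : antighost_num a = ext_map (@ext_num n K F) a.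
Proof. by rewrite /antighost_num -lock. Qed.
Lemma antighost_num_linear : linear antighost_num.
Proof. by move=> k x y; rewrite !antighost_numE linearP. Qed.
HB.instance Definition _ := GRing.isLinear.Build K A A _ antighost_num antighost_num_linear.
Definition antighost_num_lin := lin_rulesP antighost_num_linear.

Lemma antighost_num_wedge c a : antighost_num (ext_wedge c a) = ext_wedge c (antighost_num a).
Proof. by rewrite !antighost_numE ext_map_wedge. Qed.
Lemma antighost_num_insert c a : antighost_num (ext_insert c a) = ext_insert c (antighost_num a).
Proof. by rewrite !antighost_numE ext_map_insert. Qed.
Lemma antighost_num_inner_wedge c a :
  antighost_num (inner_wedge c a) = inner_wedge c (antighost_num a) + inner_wedge c a.
Proof.
rewrite !antighost_numE /inner_wedge ext_map_smap ext_smap_map; apply/ffunP => I.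
rewrite [RHS]ffunE !(ffunE (fun _ => _ *: _)) /= -scalerDr; congr (_ *: _).
exact: ext_num_wedge.
Qed.
Lemma antighost_num_inner_insert c a :
  antighost_num (inner_insert c a) = inner_insert c (antighost_num a) - inner_insert c a.
Proof.
rewrite !antighost_numE /inner_insert ext_map_smap ext_smap_map; apply/ffunP => I.
rewrite [RHS]ffunE [X in _ = _ + X]ffunE !(ffunE (fun _ => _ *: _)) /= -scalerBr; congr (_ *: _).
exact: ext_num_insert.
Qed.
Lemma antighost_num_coef_op (f : {linear F -> F}) a :
  antighost_num (coef_op f a) = coef_op f (antighost_num a).
Proof.
rewrite !antighost_numE /coef_op !ext_map_map; apply/ffunP => I; rewrite !ffunE /=.
exact: ext_num_map.
Qed.

Lemma charge_ce_linear : linear charge_ce.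
Proof.
suff h : linear (ce_op M t t2 charge_rho) by move=> k x y; rewrite !charge_ceE h.
apply: add_linear; first apply: add_linear.
- apply: opp_linear; do 3 (apply: sum_linear => ?); apply: scale_linear => k x y.
  by rewrite /= ?lin.
- apply: sum_linear => d.
  have h : linear (fun a : A => \sum_b \sum_c t c d b *: inner_wedge c (inner_insert b a)).
    do 2 (apply: sum_linear => ?); apply: scale_linear => k' x' y'; by rewrite ?lin.
  by move=> k x y; rewrite /= h ?lin.
- by apply: sum_linear => d k x y; rewrite /= ?lin.
Qed.

Lemma charge_koszul_linear : linear charge_koszul.
Proof.
suff h : linear (koszul_op M t ch charge_R) by move=> k x y; rewrite !charge_koszulE h.
apply: add_linear; first apply: add_linear.
- by apply: sum_linear => d k x y; rewrite /= ?lin.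
- apply: scale_linear; apply: sum_linear => d; apply: scale_linear => k x y.
  by rewrite /= ?lin.
- apply: opp_linear; apply: scale_linear; do 3 (apply: sum_linear => ?).
  by apply: scale_linear => k x y; rewrite /= ?lin.
Qed.
HB.instance Definition _ := GRing.isLinear.Build K A A _ charge_ce charge_ce_linear.
HB.instance Definition _ := GRing.isLinear.Build K A A _ charge_koszul charge_koszul_linear.

Lemma charge_diff_linear : linear charge_diff.
Proof.
apply: add_linear; first exact: charge_ce_linear.
by move=> k x y; rewrite charge_koszul_linear mulrnDl scalerMnr.
Qed.
HB.instance Definition _ := GRing.isLinear.Build K A A _ charge_diff charge_diff_linear.

Lemma antighost_num_ce a : antighost_num (charge_ce a) = charge_ce (antighost_num a).
Proof.
rewrite !charge_ceE /ce_op ?(antighost_num_lin); congr (- _ + _ + _).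
- apply: eq_bigr => d _; rewrite ?antighost_num_lin; apply: eq_bigr => b _.
  rewrite ?antighost_num_lin; apply: eq_bigr => c _; rewrite ?antighost_num_lin /=.
  by rewrite !antighost_num_wedge antighost_num_insert.
- apply: eq_bigr => d _; rewrite /= antighost_num_wedge ?antighost_num_lin; congr (ext_wedge d _).
  apply: eq_bigr => b _; rewrite ?antighost_num_lin; apply: eq_bigr => c _.
  rewrite ?antighost_num_lin antighost_num_inner_wedge antighost_num_inner_insert ?lin.
  by congr (_ *: _); mod_A.
- by apply: eq_bigr => d _; rewrite /= antighost_num_wedge antighost_num_coef_op.
Qed.

Lemma antighost_num_koszul a :
  antighost_num (charge_koszul a) = charge_koszul (antighost_num a) - charge_koszul a.
Proof.
rewrite !charge_koszulE /koszul_op.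
pose S1 a := \sum_d cmY M d (charge_R d a); pose S2 a := \sum_d ch d *: cmY M d a.
pose S3 a := \sum_(d : 'I_n) \sum_(b : 'I_n | (d < b)%N) \sum_c t c d b *: cmH M c (cmY M b (cmY M d a)).
have e1 : antighost_num (S1 a) = S1 (antighost_num a) - S1 a.
  rewrite /S1 ?antighost_num_lin -sumrB; apply: eq_bigr => d _ /=.
  by rewrite antighost_num_inner_insert antighost_num_coef_op.
have e2 : antighost_num (S2 a) = S2 (antighost_num a) - S2 a.
  rewrite /S2 ?antighost_num_lin -sumrB; apply: eq_bigr => d _ /=.
  by rewrite ?antighost_num_lin antighost_num_inner_insert scalerBr.
have e3 : antighost_num (S3 a) = S3 (antighost_num a) - S3 a.
  rewrite /S3 ?antighost_num_lin -sumrB; apply: eq_bigr => d _.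
  rewrite ?antighost_num_lin -sumrB; apply: eq_bigr => b _.
  rewrite ?antighost_num_lin -sumrB; apply: eq_bigr => c _ /=.
  rewrite ?antighost_num_lin antighost_num_inner_wedge !antighost_num_inner_insert ?lin.
  mod_A.
have ag3 x y z : antighost_num (x + ilam *: y - ilam *: z) =
    antighost_num x + ilam *: antighost_num y - ilam *: antighost_num z by rewrite ?antighost_num_lin.
change (antighost_num (S1 a + ilam *: S2 a - ilam *: S3 a) = S1 (antighost_num a) +
  ilam *: S2 (antighost_num a) - ilam *: S3 (antighost_num a) - (S1 a + ilam *: S2 a - ilam *: S3 a)).
rewrite ag3 e1 e2 e3; move: (S1 _) (S1 _) (S2 _) (S2 _) (S3 _) (S3 _) => *; mod_A.
Qed.

Lemma charge_diffE a : charge_diff a = charge_ce a + charge_koszul a *+ 2.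
Proof. by []. Qed.

Local Notation D := (charge_diff : {linear A -> A}).
Local Notation dl := (charge_ce : {linear A -> A}).
Local Notation dq := (charge_koszul : {linear A -> A}).
Local Notation par := (@ext_parity n K F : {linear A -> A}).
Local Notation ag := (antighost_num : {linear A -> A}).
Local Notation oneA := (ext0 n (ext0 n (cl_one P))).

Let DE a : ilam *: charge_diff a = st brst_element a - st (ext_parity a) brst_element.
Proof. by rewrite charge_commutator. Qed.

Lemma charge_diff_sq a : charge_diff (charge_diff a) = 0.
Proof.
exact: (@charge_D_sq K A ilam (cl_st P) (cl_str P) par D oneA brst_element (@cl_strE _ _ _ _ P) (stA P)
  (stx1 P) (@ext_parityK n K F) (st_parity P) charge_sq charge_parity DE ilam_regA).
Qed.

Lemma charge_diff_derivation (a b : A) :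
  charge_diff (st a b) = st (charge_diff a) b + st (ext_parity a) (charge_diff b).
Proof.
exact: (@charge_D_derivation K A ilam (cl_st P) (cl_str P) par D brst_element (@cl_strE _ _ _ _ P) (stA P)
  (st_parity P) DE ilam_regA).
Qed.

Lemma charge_diff1 : charge_diff oneA = 0.
Proof.
exact: (@charge_D1 K A ilam (cl_st P) par D oneA brst_element (st1 P) (stx1 P) (ext_parity0 n _) DE ilam_regA).
Qed.

Lemma charge_koszul_sq a : charge_koszul (charge_koszul a) = 0.
Proof.
exact: (@charge_dq_sq K A ilam (cl_st P) (cl_str P) par ag D dl dq oneA brst_element (@cl_strE _ _ _ _ P) (stA P)
  (stx1 P) (@ext_parityK n K F) (st_parity P) charge_sq charge_parity DE charge_diffE antighost_num_ce
  antighost_num_koszul torsionA ilam_regA).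
Qed.

Lemma charge_ce_koszul a : charge_ce (charge_koszul a) = - charge_koszul (charge_ce a).
Proof.
exact: (@charge_delta_dq K A ilam (cl_st P) (cl_str P) par ag D dl dq oneA brst_element (@cl_strE _ _ _ _ P) (stA P)
  (stx1 P) (@ext_parityK n K F) (st_parity P) charge_sq charge_parity DE charge_diffE antighost_num_ce
  antighost_num_koszul torsionA ilam_regA).
Qed.

Lemma charge_ce_sq a : charge_ce (charge_ce a) = 0.
Proof.
exact: (@charge_delta_sq K A ilam (cl_st P) (cl_str P) par ag D dl dq oneA brst_element (@cl_strE _ _ _ _ P) (stA P)
  (stx1 P) (@ext_parityK n K F) (st_parity P) charge_sq charge_parity DE charge_diffE antighost_num_ce
  antighost_num_koszul torsionA ilam_regA).
Qed.

Lemma charge_diff_parity a : ext_parity (charge_diff a) = - charge_diff (ext_parity a).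
Proof.
exact: (@charge_D_parity K A ilam (cl_st P) (cl_str P) par D brst_element (@cl_strE _ _ _ _ P)
  (st_parity P) charge_parity DE ilam_regA).
Qed.

End ChargeComplex.

(** * Structure constants and the trace of the adjoint representation *)

Section LieStructure.
Variables (R : realType) (g : lieAlgebra R) (n : nat) (e : n.-tuple g).
Implicit Types x y z : g.
Local Notation s := (struct_const e).
Local Notation Le := (tnth e).
Local Notation crd := (coord e).
Hypothesis he : basis_of (fullv : {vspace g}) e.

Definition liel_lin y := ltac:(lin_beta (@lie_linearl R g y)).
Definition lier_lin x := lin_rulesP (@lie_linearr R g x).

Lemma lieC x y : lie x y = - lie y x.
Proof.
have := lie_alternating (x + y); rewrite liel_lin !lier_lin !lie_alternating add0r addr0.
by move/eqP; rewrite addr_eq0 => /eqP.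
Qed.

Lemma basis_expansion x : x = \sum_c crd c x *: Le c.
Proof.
rewrite {1}(coord_basis he (memvf x)); apply: eq_bigr => c _.
by rewrite (tnth_nth 0).
Qed.

Lemma struct_constC c a b : s c a b = - s c b a.
Proof. by rewrite /struct_const lieC linearN. Qed.

Lemma struct_const_xx c a : s c a a = 0.
Proof. by rewrite /struct_const lie_alternating linear0. Qed.

Lemma struct_const_comp c a b x : \sum_i s i a b * crd c (lie (Le i) x) = crd c (lie (lie (Le a) (Le b)) x).
Proof.
rewrite [lie (Le a) (Le b)]basis_expansion liel_lin linear_sum; apply: eq_bigr => i _.
by rewrite liel_lin linearZ.
Qed.

Lemma struct_const_jacobi f b c d :
  \sum_i (s i b c * s f i d + s i c d * s f i b + s i d b * s f i c) = 0.
Proof.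
rewrite !big_split /= !struct_const_comp -!linearD /= -[RHS](linear0 (crd f)); congr (crd f _).
rewrite [lie (lie (Le b) _) _]lieC [lie (lie (Le c) _) _]lieC [lie (lie (Le d) _) _]lieC -!opprD.
by rewrite -[RHS]oppr0 -(lie_jacobi (Le d) (Le b) (Le c)).
Qed.

(** By the Jacobi identity ad is a representation, and the trace of a commutator vanishes: [tr]
    writes the two traces as double sums that differ by exchanging the indices. *)
Lemma chi_lie x y : chi e (lie x y) = 0.
Proof.
have lieE z : lie (lie x y) z = lie x (lie y z) - lie y (lie x z).
  have := lie_jacobi x y z; rewrite [lie z (lie x y)]lieC => /eqP; rewrite subr_eq0 => /eqP <-.
  by rewrite [lie z x]lieC lier_lin.
have tr (p q : g) : \sum_b crd b (lie p (lie q (Le b))) =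
    \sum_b \sum_c crd c (lie q (Le b)) * crd b (lie p (Le c)).
  apply: eq_bigr => b _; rewrite {1}[lie q (Le b)]basis_expansion lier_lin linear_sum.
  by apply: eq_bigr => c _; rewrite lier_lin linearZ.
rewrite /chi; have -> : \sum_b crd b (lie (lie x y) (Le b)) = 0; last by rewrite mulr0.
transitivity (\sum_b crd b (lie x (lie y (Le b))) - \sum_b crd b (lie y (lie x (Le b)))).
  by rewrite -sumrB; apply: eq_bigr => b _; rewrite lieE linearB.
rewrite !tr [X in _ - X]exchange_big; apply/eqP; rewrite subr_eq0; apply/eqP.
by apply: eq_bigr => b _; apply: eq_bigr => c _; rewrite mulrC.
Qed.

Lemma struct_const_chi a b : \sum_c s c a b * chi e (Le c) = 0.
Proof.
rewrite -[RHS](chi_lie (Le a) (Le b)).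
transitivity (2^-1 * \sum_d \sum_c s c a b * crd d (lie (Le c) (Le d))).
  rewrite exchange_big mulr_sumr; apply: eq_bigr => c _.
  by rewrite /chi mulrCA; congr (_ * _); rewrite mulr_sumr.
congr (_ * _); apply: eq_bigr => d _.
rewrite [lie (Le a) (Le b)]basis_expansion liel_lin linear_sum.
by apply: eq_bigr => c _; rewrite liel_lin linearZ.
Qed.

End LieStructure.

Section QuantumBrst.
Variables (R : realType) (m : nat) (X : manifold R m) (om : symplectic_form X).
Variables (S : star_product om) (g : lieAlgebra R) (n : nat) (e : n.-tuple g).
Variable J : quantum_momentum_map S g.
Hypothesis he : basis_of (fullv : {vspace g}) e.
Local Notation OM := (Cinfty X).
Local Notation K := (fps R[i]).
Local Notation F := (fps_module OM).
Local Notation Lg := (ext n F).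
Local Notation A := (ext n Lg).
Local Notation il := (ilam R).
Local Notation lin := (calculus_lin n (fps_module (Cinfty X))).
Implicit Types (a : A) (f : F) (b c d : 'I_n).

(** [div_ilam] discards the constant coefficient; nothing is lost here, because the product is
    commutative at order zero. *)
Lemma rhoM_ilam xi f : il *: rhoM J xi f = star S (pairing J xi) f - star S f (pairing J xi).
Proof.
apply: ilam_div; change (star S (pairing J xi) f 0%N - star S f (pairing J xi) 0%N = 0).
by rewrite !star_lead // mulrC subrr.
Qed.

Lemma ilam_injF f f' : il *: f = il *: f' -> f = f'.
Proof. by move=> h; rewrite -[f]div_ilamK h div_ilamK. Qed.

Lemma rhoM_linear xi : linear (rhoM J xi).
Proof.
move=> k f f'; apply: ilam_injF; rewrite rhoM_ilam.
have -> : il *: (k *: rhoM J xi f + rhoM J xi f') = k *: (il *: rhoM J xi f) + il *: rhoM J xi f'.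
  by module_eq (fps R[i]) (fps_module (Cinfty X) : lmodType (fps R[i])).
rewrite !rhoM_ilam ?(starl_lin, starr_lin).
by module_eq (fps R[i]) (fps_module (Cinfty X) : lmodType (fps R[i])).
Qed.
HB.instance Definition _ xi := GRing.isLinear.Build K F F _ (rhoM J xi) (rhoM_linear xi).

Lemma pairing_comb (t : R) x y : pairing J (t *: x + y) = rc t *: pairing J x + pairing J y.
Proof.
apply/funext => r; rewrite [RHS]/GRing.add /= /rc fpsCZ; apply/val_inj/funext => p.
change ((momentum J r p (t *: x + y) : R)%:C%C =
  t%:C%C * (momentum J r p x : R)%:C%C + (momentum J r p y : R)%:C%C).
by rewrite linearP /= rmorphD rmorphM.
Qed.

Lemma pairing0 : pairing J 0 = 0.
Proof.
have h := pairing_comb 1 0 0; rewrite rc1 !scale1r addr0 in h.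
by apply: (addIr (pairing J 0)); rewrite add0r -h.
Qed.

Lemma pairing_sum (h : 'I_n -> R) :
  pairing J (\sum_c h c *: tnth e c) = \sum_c rc (h c) *: pairing J (tnth e c).
Proof.
elim/big_rec2: _ => [|c f x _ <-]; first exact: pairing0.
exact: pairing_comb.
Qed.

Definition momentum_t (c a b : 'I_n) : K := rc (struct_const e c a b).
Definition momentum_t2 (c a b : 'I_n) : K := rc (2^-1 * struct_const e c a b).
Definition momentum_t4 (c a b : 'I_n) : K := rc (4^-1 * struct_const e c a b).
Definition momentum_chi (a : 'I_n) : K := rc (chi e (tnth e a)).
Definition momentum_J (a : 'I_n) : F := pairing J (tnth e a).
Definition momentum_rho (a : 'I_n) : {linear F -> F} := rhoM J (tnth e a).
Local Notation P := (standard_product S n).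

Lemma momentum_t2E c d b : momentum_t2 c d b = momentum_t4 c d b + momentum_t4 c d b.
Proof. by rewrite -rcD -mulrDl; congr (rc (_ * _)); field. Qed.
Lemma momentum_tE c d b : momentum_t c d b = momentum_t2 c d b + momentum_t2 c d b.
Proof. by rewrite -rcD -mulrDl; congr rc; rewrite -[LHS]mul1r; congr (_ * _); field. Qed.
Lemma momentum_t4C c d b : momentum_t4 c d b = - momentum_t4 c b d.
Proof. by rewrite -rcN -mulrN -struct_constC. Qed.
Lemma momentum_t4xx c d : momentum_t4 c d d = 0.
Proof. by rewrite /momentum_t4 struct_const_xx mulr0 rc0. Qed.
Lemma momentum_jacobi (f b c d : 'I_n) : \sum_i (momentum_t4 i b c * momentum_t4 f i d +
  momentum_t4 i c d * momentum_t4 f i b + momentum_t4 i d b * momentum_t4 f i c) = 0.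
Proof.
rewrite -[RHS](mulr0 (rc (4^-1 * 4^-1))) -[in RHS]rc0 -(struct_const_jacobi he f b c d) rc_sum mulr_sumr.
by apply: eq_bigr => i _; rewrite /momentum_t4 -!rcM -!rcD; congr rc; ring.
Qed.
Lemma momentum_chiE d b : \sum_c momentum_t c d b * momentum_chi c = 0.
Proof.
rewrite -[RHS]rc0 -[in RHS](struct_const_chi he d b) rc_sum; apply: eq_bigr => c _.
by rewrite rcM.
Qed.
Lemma momentum_rhoE d f :
  cl_mul P (momentum_J d) f = cl_mulr P (momentum_J d) f + il *: momentum_rho d f.
Proof.
change (star S (momentum_J d) f = star S f (momentum_J d) + il *: rhoM J (tnth e d) f).
by rewrite rhoM_ilam addrC subrK.
Qed.
Lemma momentum_JC d b :
  cl_mul P (momentum_J d) (momentum_J b) - cl_mul P (momentum_J b) (momentum_J d) =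
  il *: \sum_c momentum_t c d b *: momentum_J c.
Proof.
rewrite -[LHS]/(star S _ _ - star S _ _) momentum_quantum; congr (_ *: _).
by rewrite -pairing_sum; congr pairing; exact: basis_expansion.
Qed.

Local Notation ch := (brst_element P momentum_t4 momentum_chi momentum_J).
Local Notation ce := (charge_ce P momentum_t momentum_t2 momentum_rho).
Local Notation kz := (charge_koszul P momentum_t momentum_chi momentum_J).

Lemma ThetaE : Theta J e = ch.
Proof.
symmetry; exact: (brst_elementE P momentum_t4 momentum_chi momentum_J).
Qed.

Lemma deltaE a : delta J e a = ce a.
Proof. symmetry; exact: (charge_ce_CE P momentum_t momentum_t2 momentum_rho a). Qed.

Lemma quantum_koszulE a : quantum_koszul J e a = kz a.
Proof. symmetry; exact: (charge_koszul_smap P momentum_t momentum_chi momentum_J a). Qed.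

Lemma brst_chargeE a : brst J e a = charge_diff P momentum_t momentum_t2 momentum_chi momentum_J momentum_rho a.
Proof.
rewrite /brst parityE -!standard_productE ThetaE.
rewrite (charge_commutator momentum_chi momentum_t2E momentum_tE momentum_t4C momentum_t4xx momentum_rhoE).
by apply: bigradedP => I L; rewrite bigraded_coef_op bigradedZ div_ilamK.
Qed.

Lemma brstE a : brst J e a = delta J e a + quantum_koszul J e a *+ 2.
Proof. by rewrite brst_chargeE deltaE quantum_koszulE. Qed.

Lemma brst_linear : linear (brst J e).
Proof. by move=> k x y; rewrite !brst_chargeE charge_diff_linear. Qed.
Lemma delta_linear : linear (delta J e).
Proof. by move=> k x y; rewrite !deltaE charge_ce_linear. Qed.
Lemma quantum_koszul_linear : linear (quantum_koszul J e).
Proof. by move=> k x y; rewrite !quantum_koszulE charge_koszul_linear. Qed.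
HB.instance Definition _ := GRing.isLinear.Build K A A _ (brst J e) brst_linear.
HB.instance Definition _ := GRing.isLinear.Build K A A _ (delta J e) delta_linear.
HB.instance Definition _ := GRing.isLinear.Build K A A _ (quantum_koszul J e) quantum_koszul_linear.

Lemma starS_linearl (b : A) : linear (fun a => starS S a b).
Proof. by move=> k x y; rewrite -!standard_productE st_linearl. Qed.
Lemma starS_linearr a : linear (starS S a).
Proof. by move=> k x y; rewrite -!standard_productE linearP. Qed.
Definition starS_right (b a : A) : A := starS S a b.
HB.instance Definition _ a := GRing.isLinear.Build K A A _ (starS S a) (@starS_linearr a).
HB.instance Definition _ (b : A) := GRing.isLinear.Build K A A _ (starS_right b) (@starS_linearl b).

Lemma starS_assoc (a b a' : A) : starS S a (starS S b a') = starS S (starS S a b) a'.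
Proof. by rewrite -!standard_productE stA. Qed.
Lemma starS1l a : starS S (one_A X n) a = a.
Proof. by rewrite -!standard_productE (st1 P). Qed.
Lemma starS1r a : starS S a (one_A X n) = a.
Proof. by rewrite -!standard_productE (stx1 P). Qed.
Lemma torsionF f k : f *+ k.+1 = 0 -> f = 0. Proof. exact: fps_torsion. Qed.

Lemma brst_sq a : brst J e (brst J e a) = 0.
Proof.
rewrite !brst_chargeE; apply: (charge_diff_sq momentum_t2E momentum_tE momentum_t4C momentum_t4xx
  momentum_jacobi momentum_chiE momentum_rhoE momentum_JC torsionF); exact: ilam_reg.
Qed.

Lemma brst_derivation (a b : A) :
  brst J e (starS S a b) = starS S (brst J e a) b + starS S (ext_parity a) (brst J e b).
Proof.
rewrite !brst_chargeE -!standard_productE.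
apply: (charge_diff_derivation momentum_chi momentum_t2E momentum_tE momentum_t4C momentum_t4xx momentum_rhoE).
exact: ilam_reg.
Qed.

Lemma brst1 : brst J e (one_A X n) = 0.
Proof.
rewrite brst_chargeE.
apply: (charge_diff1 momentum_chi momentum_t2E momentum_tE momentum_t4C momentum_t4xx momentum_rhoE).
exact: ilam_reg.
Qed.

Lemma brst_parity a : ext_parity (brst J e a) = - brst J e (ext_parity a).
Proof.
rewrite !brst_chargeE.
apply: (charge_diff_parity momentum_chi momentum_t2E momentum_tE momentum_t4C momentum_t4xx momentum_rhoE).
exact: ilam_reg.
Qed.

Lemma quantum_koszul_sq a : quantum_koszul J e (quantum_koszul J e a) = 0.
Proof.
rewrite !quantum_koszulE; apply: (charge_koszul_sq momentum_t2E momentum_tE momentum_t4C momentum_t4xx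
  momentum_jacobi momentum_chiE momentum_rhoE momentum_JC torsionF); exact: ilam_reg.
Qed.

Lemma delta_koszul a : delta J e (quantum_koszul J e a) = - quantum_koszul J e (delta J e a).
Proof.
rewrite !quantum_koszulE !deltaE; apply: (charge_ce_koszul momentum_t2E momentum_tE momentum_t4C momentum_t4xx
  momentum_jacobi momentum_chiE momentum_rhoE momentum_JC torsionF); exact: ilam_reg.
Qed.

Lemma delta_sq a : delta J e (delta J e a) = 0.
Proof.
rewrite !deltaE; apply: (charge_ce_sq momentum_t2E momentum_tE momentum_t4C momentum_t4xx
  momentum_jacobi momentum_chiE momentum_rhoE momentum_JC torsionF); exact: ilam_reg.
Qed.

End QuantumBrst.

(** * The quantum Koszul complex *)

Section ExteriorDegree.
Variables (n : nat) (K : comNzRingType) (V : lmodType K).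
Implicit Types (x y : ext n V) (i j : nat).

Definition ext_proj i x : ext n V := [ffun I : {set 'I_n} => if #|I| == i then x I else 0].

Lemma ext_proj_linear i : linear (ext_proj i).
Proof.
move=> k x y; apply/ffunP => I; rewrite !ffunE; case: ifP => // _.
by rewrite scaler0 addr0.
Qed.
HB.instance Definition _ i := GRing.isLinear.Build K (ext n V) (ext n V) _
  (ext_proj i) (ext_proj_linear i).
Definition ext_proj_lin i := lin_rulesP (ext_proj_linear i).

Lemma ext_proj_sum x : \sum_(i < n.+1) ext_proj i x = x.
Proof.
apply/ffunP => I; rewrite sum_ffunE.
have In : (#|I| < n.+1)%N by rewrite ltnS (leq_trans (max_card _)) ?card_ord.
rewrite (bigD1 (Ordinal In)) //= ffunE eqxx big1 ?addr0 // => j jI.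
by rewrite ffunE; case: eqP => // e; case/eqP: jI; apply/val_inj.
Qed.

Lemma ext_proj_homog i x : ext_homog i%:Z (ext_proj i x).
Proof. by move=> I; rewrite eqz_nat ffunE => /negPf ->. Qed.

Lemma ext_homog_proj i j x : ext_homog i%:Z x -> ext_proj j x = if j == i then x else 0.
Proof.
move=> xi; apply/ffunP => I; rewrite ffunE; case: (eqVneq j i) => [->|ji].
  by case: eqP => // /eqP Ii; rewrite xi // eqz_nat.
by rewrite [RHS]ffunE; case: eqP => // Ij; rewrite xi // eqz_nat Ij.
Qed.

Lemma ext_proj_proj i j x : ext_proj j (ext_proj i x) = if j == i then ext_proj i x else 0.
Proof. exact/ext_homog_proj/ext_proj_homog. Qed.

Lemma ext_proj_large i x : (n < i)%N -> ext_proj i x = 0.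
Proof.
move=> ni; apply/ffunP => I; rewrite !ffunE; case: eqP => // e.
by move: ni; rewrite -e ltnNge (leq_trans (max_card _)) ?card_ord.
Qed.

Lemma ext_proj_zero x : ext_proj 0 x = ext0 n (x finset.set0).
Proof. by apply/ffunP => I; rewrite !ffunE cards_eq0; case: eqP => [->|]. Qed.

Lemma ext_proj_insert i a x : ext_proj i (ext_insert a x) = ext_insert a (ext_proj i.+1 x).
Proof.
apply/ffunP => I; rewrite !ffunE; case: ifP => [Ii|Ii]; case: ifP => // aI.
  by rewrite cardsU1 aI add1n eqSS Ii.
by rewrite cardsU1 aI add1n eqSS Ii scaler0.
Qed.

Lemma ext_proj_wedge i a x : ext_proj i.+1 (ext_wedge a x) = ext_wedge a (ext_proj i x).
Proof.
apply/ffunP => I; rewrite !ffunE; case: (boolP (a \in I)) => aI; last by rewrite if_same.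
have e : (#|I| == i.+1) = (#|I :\ a| == i) by rewrite (cardsD1 a I) aI add1n eqSS.
by rewrite e; case: ifP => // _; rewrite scaler0.
Qed.

Lemma ext_proj_wedge0 a x : ext_proj 0 (ext_wedge a x) = 0.
Proof.
apply/ffunP => I; rewrite !ffunE cards_eq0; case: eqP => // ->.
by rewrite finset.in_set0.
Qed.

Lemma ext_insert_proj0 a x : ext_insert a (ext_proj 0 x) = 0.
Proof. by rewrite ext_proj_zero ext_insert0. Qed.

Section Shift.
Variable T : {linear ext n V -> ext n V}.

Lemma ext_proj_raise : (forall i x, ext_homog i%:Z x -> ext_homog i.+1%:Z (T x)) ->
  (forall i x, ext_proj i.+1 (T x) = T (ext_proj i x)) /\ (forall x, ext_proj 0 (T x) = 0).
Proof.
move=> Td; have e x i : ext_proj i (T x) = \sum_(j < n.+1) if i == j.+1 then T (ext_proj j x) else 0.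
  rewrite -{1}[x]ext_proj_sum linear_sum linear_sum; apply: eq_bigr => j _.
  exact/ext_homog_proj/Td/ext_proj_homog.
split=> [i x|x]; last by rewrite e big1.
(* Above degree [n] both sides vanish, and the sum has no matching term. *)
have [ni|] := ltnP n i; first by rewrite !(ext_proj_large _) ?linear0 // ltnW.
rewrite -ltnS => ni; rewrite e (bigD1 (Ordinal ni)) //= eqxx big1 ?addr0 // => j ji.
by rewrite eqSS; case: eqP => // ij; case/eqP: ji; apply/val_inj.
Qed.
End Shift.

End ExteriorDegree.

Lemma ext_map_proj n (K : comNzRingType) (V W : lmodType K) (f : {linear V -> W}) i (x : ext n V) :
  ext_map f (ext_proj i x) = ext_proj i (ext_map f x).
Proof. by apply/ffunP => I; rewrite !ffunE; case: ifP => // _; rewrite linear0. Qed.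

Section SeriesMap.
Variables (C : comNzRingType) (V W : lmodType C).

Lemma smap_linear (f : {linear V -> W}) : linear (smap f : fps_module V -> fps_module W).
Proof.
move=> k x y; apply/funext => r; rewrite [RHS]/GRing.add /= /smap.
have -> : (k *: x + y) r = \sum_(a < r.+1) k a *: x (r - a)%N + y r by [].
by rewrite linearD linear_sum; congr (_ + _); apply: eq_bigr => a _; rewrite linearZ.
Qed.
HB.instance Definition _ (f : {linear V -> W}) :=
  GRing.isLinear.Build (fps C) (fps_module V) (fps_module W) _ (smap f) (smap_linear f).

Lemma lam_scale (v : fps_module V) r : (lam C *: v) r = if r is r'.+1 then v r' else 0.
Proof.
rewrite /GRing.scale /= /fps_scale; case: r => [|r]; first by rewrite big_ord1 /lam scale0r.
rewrite big_ord_recl /lam scale0r add0r big_ord_recl /= scale1r subSS subn0 big1 ?addr0 // => i _.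
by rewrite scale0r.
Qed.

Lemma lam_sdiv (v : fps_module V) : v 0%N = 0 -> lam C *: sdiv_lam v = v.
Proof. by move=> v0; apply/funext => -[|r]; rewrite lam_scale ?v0. Qed.

Lemma fps_sign (v : fps_module V) p r : ((-1) ^+ p *: v) r = (-1) ^+ p *: v r.
Proof.
rewrite -[X in (X *: v) r]signr_odd -[X in _ = X *: _]signr_odd; case: (odd p).
  by rewrite !expr1 (scaleN1r v) (scaleN1r (v r)).
by rewrite !expr0 (scale1r v) (scale1r (v r)).
Qed.

End SeriesMap.

Section KoszulPerturbation.
Variables (n : nat) (C : comNzRingType) (M O : lmodType C).
Local Notation K := (fps C).
Local Notation FM := (fps_module M).
Local Notation FO := (fps_module O).
Local Notation L := (ext n FM).
Variables (hm k0 : {linear ext n M -> ext n M}) (pl : {linear O -> M}) (rs : {linear M -> O}).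
Variable dg : {linear L -> L}.
Hypotheses (rsK : forall c, rs (pl c) = c)
  (hm_degree : forall i x, ext_homog i%:Z x -> ext_homog i.+1%:Z (hm x))
  (contract0 : forall f, ext0 n (pl (rs f)) + k0 (hm (ext0 n f)) = ext0 n f)
  (contract : forall i x, (0 < i)%N -> ext_homog i%:Z x -> hm (k0 x) + k0 (hm x) = x)
  (hm_pl : forall c, hm (ext0 n (pl c)) = 0)
  (k0_ext0 : forall f, k0 (ext0 n f) = 0)
  (dg_ext0 : forall f, dg (ext0 n f) = 0)
  (dg_proj : forall i x, ext_proj i (dg x) = dg (ext_proj i.+1 x))
  (dg_sq : forall x, dg (dg x) = 0)
  (dg_lead : forall r x, (forall i, (i < r)%N -> series_coef i x = 0) ->
     series_coef r (dg x) = k0 (series_coef r x)).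
Implicit Types (x y : L) (i : nat).

Definition kp_h x : L := coef_lift hm x.
HB.instance Definition _ := GRing.isLinear.Build K L L _ kp_h (coef_lift_linear hm).
Definition kp_pr (c : FO) : L := ext0 n (smap pl c).
Lemma kp_pr_linear : linear kp_pr.
Proof. by move=> k x y; rewrite /kp_pr !linearP. Qed.
HB.instance Definition _ := GRing.isLinear.Build K FO L _ kp_pr kp_pr_linear.
Definition kp_io x : FO := smap rs (x finset.set0).
Lemma kp_io_linear : linear kp_io.
Proof. by move=> k x y; rewrite /kp_io !ffunE linearP. Qed.
HB.instance Definition _ := GRing.isLinear.Build K L FO _ kp_io kp_io_linear.

(** One operator for all degrees: [kp_io] vanishes in positive degree and [dg] in degree zero, so
    its restrictions are the two kinds of homotopy operators that are to be inverted. *)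
Definition kp_Q x : L := kp_pr (kp_io x) + dg (kp_h x) + kp_h (dg x).

Lemma kp_Q_linear : linear kp_Q.
Proof.
move=> k x y; rewrite /kp_Q ?(linear_rules (kp_pr : {linear FO -> L}), linear_rules (kp_io : {linear L -> FO}),
  linear_rules dg, linear_rules (kp_h : {linear L -> L})).
by module_eq (fps C) (ext n (fps_module M) : lmodType (fps C)).
Qed.

Lemma contract_all (x : ext n M) : ext0 n (pl (rs (x finset.set0))) + k0 (hm x) + hm (k0 x) = x.
Proof.
have -> : x finset.set0 = ext_proj 0 x finset.set0 by rewrite ffunE cards0 eqxx.
rewrite -{2 3 4}[x]ext_proj_sum !linear_sum !big_ord_recl /= [ext_proj 0 x]ext_proj_zero.
rewrite ffunE eqxx k0_ext0 linear0 add0r addrA contract0 -addrA; congr (_ + _).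
rewrite -big_split; apply: eq_bigr => i _ /=; rewrite addrC.
by apply: (contract (i := i.+1)) => //; exact: ext_proj_homog.
Qed.

(** At the lowest order of [x] the operator [dg] acts as the classical Koszul operator, for which
    the contraction identity is exact. *)
Lemma kp_adic r x : (forall i, (i < r)%N -> series_coef i x = 0) -> series_coef r (x - kp_Q x) = 0.
Proof.
move=> x0; have hx0 i : (i < r)%N -> series_coef i (kp_h x) = 0.
  by move=> ir; rewrite series_coef_lift x0 // linear0.
have h1 : series_coef r (dg (kp_h x)) = k0 (hm (series_coef r x)).
  by rewrite dg_lead // series_coef_lift.
have h2 : series_coef r (kp_h (dg x)) = hm (k0 (series_coef r x)).
  by rewrite series_coef_lift dg_lead.
have h3 : series_coef r (kp_pr (kp_io x)) = ext0 n (pl (rs (series_coef r x finset.set0))).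
  by apply/ffunP => I; rewrite !ffunE; case: eqP.
by rewrite series_coefB /kp_Q !series_coefD h1 h2 h3 contract_all subrr.
Qed.

Definition kp_V x : L := x - kp_Q x.
Lemma kp_V_linear : linear kp_V.
Proof. by move=> k x y; rewrite /kp_V kp_Q_linear; module_eq (fps C) (ext n (fps_module M) : lmodType (fps C)). Qed.
HB.instance Definition _ := GRing.isLinear.Build K L L _ kp_V kp_V_linear.

Lemma kp_Q_bij : set_bij setT setT kp_Q.
Proof.
have e : kp_Q = fun x => x - kp_V x by apply/funext => x; rewrite /kp_V subKr.
by rewrite e; apply: (@adic_bij _ _ _ (kp_V : {linear L -> L})) => r x; exact: kp_adic.
Qed.

Definition kp_Qi : L -> L := inverse_on setT kp_Q.
Lemma kp_QiK x : kp_Q (kp_Qi x) = x.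
Proof. by have [] := inverse_onP kp_Q_bij (Logic.I : setT x). Qed.
Lemma kp_QK x : kp_Qi (kp_Q x) = x.
Proof. exact: (inverse_on_eq kp_Q_bij). Qed.

Lemma series_coef_proj r i x : series_coef r (ext_proj i x) = ext_proj i (series_coef r x).
Proof. by apply/ffunP => I; rewrite !ffunE; case: ifP. Qed.

Lemma kp_h_proj i x : ext_proj i.+1 (kp_h x) = kp_h (ext_proj i x).
Proof.
apply: series_coefP => r; rewrite series_coef_proj !series_coef_lift series_coef_proj.
by have [-> _] := ext_proj_raise hm_degree.
Qed.

Lemma kp_h_proj0 x : ext_proj 0 (kp_h x) = 0.
Proof.
apply: series_coefP => r; rewrite series_coef_proj !series_coef_lift series_coef0.
by have [_ ->] := ext_proj_raise hm_degree.
Qed.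

Lemma dg_proj0 x : dg (ext_proj 0 x) = 0.
Proof. by rewrite ext_proj_zero dg_ext0. Qed.

Lemma kp_io_proj i x : kp_io (ext_proj i x) = if i == 0%N then kp_io x else 0.
Proof.
rewrite /kp_io ffunE cards0 eq_sym; case: ifP => // _.
exact: (linear0 (smap rs : {linear FM -> FO})).
Qed.

Lemma kp_pr_proj i c : ext_proj i (kp_pr c) = if i == 0%N then kp_pr c else 0.
Proof.
apply: (ext_homog_proj (i := 0)) => I; rewrite eqz_nat cards_eq0 /kp_pr ffunE => /negPf -> //.
Qed.

Lemma kp_Q_proj i x : ext_proj i (kp_Q x) = kp_Q (ext_proj i x).
Proof.
rewrite /kp_Q !linearD /= kp_pr_proj kp_io_proj dg_proj kp_h_proj; congr (_ + _ + _).
  by case: eqP => // _; rewrite linear0.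
case: i => [|i]; first by rewrite kp_h_proj0 dg_proj0 linear0.
by rewrite kp_h_proj dg_proj.
Qed.

Lemma kp_Qi_proj i x : ext_proj i (kp_Qi x) = kp_Qi (ext_proj i x).
Proof. by rewrite -[LHS]kp_QK -kp_Q_proj kp_QiK. Qed.

Lemma kp_io_pr c : kp_io (kp_pr c) = c.
Proof. by rewrite /kp_io /kp_pr ffunE eqxx; apply/funext => r; rewrite /smap rsK. Qed.
Lemma kp_h_pr c : kp_h (kp_pr c) = 0.
Proof.
apply: series_coefP => r; rewrite series_coef_lift series_coef0 -(hm_pl (c r)); congr (hm _).
by apply/ffunP => I; rewrite !ffunE; case: ifP.
Qed.
Lemma kp_d_pr c : dg (kp_pr c) = 0. Proof. exact: dg_ext0. Qed.
Lemma kp_io_proj0 x : kp_io (ext_proj 0 x) = kp_io x. Proof. by rewrite kp_io_proj. Qed.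
Lemma kp_proj0_Q x : ext_proj 0 (kp_Q x) = kp_Q (ext_proj 0 x). Proof. exact: kp_Q_proj. Qed.

Definition kp_iota x : FO := io_pert (kp_io : {linear L -> FO}) kp_Qi x.
Definition kp_hq x : L := h_pert (kp_h : {linear L -> L}) kp_Qi x.

Local Notation cdg := (dg : {linear L -> L}).
Local Notation ch := (kp_h : {linear L -> L}).
Local Notation cp0 := (@ext_proj n K FM 0 : {linear L -> L}).
Local Notation cpr := (kp_pr : {linear FO -> L}).
Local Notation cio := (kp_io : {linear L -> FO}).

Lemma kp_Qi_linear : linear kp_Qi.
Proof. exact: (@perturbed_inverse_linear K L FO cdg ch cpr cio kp_Qi kp_QiK kp_QK). Qed.
Lemma kp_iota_linear : linear kp_iota.
Proof. exact: (@io_pert_linear K L FO cdg ch cpr cio kp_Qi kp_QiK kp_QK). Qed.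
Lemma kp_hq_linear : linear kp_hq.
Proof. exact: (@h_pert_linear K L FO cdg ch cpr cio kp_Qi kp_QiK kp_QK). Qed.
HB.instance Definition _ := GRing.isLinear.Build K L L _ kp_Qi kp_Qi_linear.
HB.instance Definition _ := GRing.isLinear.Build K L FO _ kp_iota kp_iota_linear.
HB.instance Definition _ := GRing.isLinear.Build K L L _ kp_hq kp_hq_linear.

Lemma kp_iota_d x : kp_iota (dg x) = 0.
Proof. exact: (@io_pert_d K L FO cdg ch cpr cio kp_Qi dg_sq kp_io_pr kp_h_pr kp_d_pr kp_QiK kp_QK). Qed.
Lemma kp_iota_pr c : kp_iota (kp_pr c) = c.
Proof. exact: (@io_pert_pr K L FO cdg ch cpr cio kp_Qi kp_io_pr kp_h_pr kp_d_pr kp_QK). Qed.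
Lemma kp_homotopy x : kp_pr (kp_iota x) + dg (kp_hq x) + kp_hq (dg x) = x.
Proof. exact: (@homotopy_pert K L FO cdg ch cpr cio kp_Qi dg_sq kp_io_pr kp_h_pr kp_d_pr kp_QiK kp_QK). Qed.
Lemma kp_iota_proj0 x : kp_iota (ext_proj 0 x) = kp_iota x.
Proof. exact: (@io_pert_p0 K L FO cdg ch cp0 cpr cio kp_Qi kp_io_proj0 kp_proj0_Q kp_QiK kp_QK). Qed.
Lemma kp_iota_hq x : kp_iota (kp_hq x) = 0.
Proof.
exact: (@io_pert_h K L FO cdg ch cp0 cpr cio kp_Qi kp_io_proj0 kp_h_proj0 kp_proj0_Q kp_QiK kp_QK).
Qed.
Lemma kp_hq_proj i x : ext_proj i.+1 (kp_hq x) = kp_hq (ext_proj i x).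
Proof. by rewrite /kp_hq /h_pert kp_h_proj kp_Qi_proj. Qed.
Lemma kp_hq_proj0 x : ext_proj 0 (kp_hq x) = 0.
Proof. exact: kp_h_proj0. Qed.

End KoszulPerturbation.

Section InverseOnDegree.
Variables (n : nat) (K : comNzRingType) (V : lmodType K).
Local Notation L := (ext n V).
Local Notation A := (ext n L).
Variables (Q Qi : {linear L -> L}).
Hypotheses (Q_proj : forall i x, ext_proj i (Q x) = Q (ext_proj i x))
  (Qi_proj : forall i x, ext_proj i (Qi x) = Qi (ext_proj i x))
  (QiK : forall x, Q (Qi x) = x) (QK : forall x, Qi (Q x) = x).

Definition antighost_degree (l : nat) : set A :=
  [set a : A | forall I1 I2 : {set 'I_n}, #|I2| != l -> a I1 I2 = 0].
Definition antighost_proj (l : nat) (a : A) : A :=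
  [ffun I1 : {set 'I_n} => [ffun I2 : {set 'I_n} =>
    if #|I2| == l then a I1 I2 else 0]].

Lemma antighost_projE l a : antighost_proj l a = ext_map (ext_proj l) a.
Proof. by apply/ffunP => I; apply/ffunP => J; rewrite !ffunE. Qed.

Lemma antighost_degreeP l a : antighost_degree l a <-> ext_map (ext_proj l) a = a.
Proof.
rewrite -antighost_projE; split=> [al|<- I J /negPf Jl]; last by rewrite !ffunE Jl.
by apply/ffunP => I; apply/ffunP => J; rewrite !ffunE; case: eqP => // /eqP Jl; rewrite al.
Qed.

Lemma ext_map_comp_proj (T : {linear L -> L}) l (a : A) :
  (forall x, ext_proj l (T x) = T (ext_proj l x)) ->
  ext_map (ext_proj l) (ext_map T a) = ext_map T (ext_map (ext_proj l) a).
Proof. by move=> h; rewrite !ext_map_map; apply/ffunP => I; rewrite !(ffunE (fun _ => (_ \o _) _)) /= h. Qed.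

(** [inverse_on] chooses a preimage inside one degree; as [Q] and [Qi] preserve degrees, the choice
    is forced to be [Qi]. *)
Lemma inverse_degree (f : A -> A) l :
  (forall a, antighost_degree l a -> f a = ext_map Q a) ->
  set_bij (antighost_degree l) (antighost_degree l) f /\
  forall a, inverse_on (antighost_degree l) f (antighost_proj l a) = ext_map Qi (ext_map (ext_proj l) a).
Proof.
move=> fQ.
have stabQ a : antighost_degree l a -> antighost_degree l (ext_map Q a).
  by move=> /antighost_degreeP al; apply/antighost_degreeP; rewrite ext_map_comp_proj ?al.
have stabQi a : antighost_degree l a -> antighost_degree l (ext_map Qi a).
  by move=> /antighost_degreeP al; apply/antighost_degreeP; rewrite ext_map_comp_proj ?al.
have QQi a : ext_map Q (ext_map Qi a) = a.
  by apply/ffunP => I; rewrite ffunE ffunE QiK.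
have QiQ a : ext_map Qi (ext_map Q a) = a.
  by apply/ffunP => I; rewrite ffunE ffunE QK.
have fb : set_bij (antighost_degree l) (antighost_degree l) f.
  split=> [a al|a b /set_mem al /set_mem bl|a al]; first by rewrite fQ //; exact: stabQ.
    by rewrite !fQ // => ab; rewrite -[a]QiQ ab QiQ.
  by exists (ext_map Qi a); [exact: stabQi|rewrite fQ ?QQi //; exact: stabQi].
split=> // a; have pl : antighost_degree l (ext_map (ext_proj l) a).
  apply/antighost_degreeP; rewrite ext_map_map; apply/ffunP => I; rewrite ffunE [RHS]ffunE.
  by rewrite /= ext_proj_proj eqxx.
rewrite antighost_projE -{1}[ext_map (ext_proj l) a]QQi -fQ; last exact: stabQi.
by apply: inverse_on_eq => //; exact: stabQi.
Qed.

End InverseOnDegree.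

(** * Identification of the homotopy operators with the perturbed contraction *)

Section KoszulOperators.
Variables (R : realType) (m : nat) (X : manifold R m) (om : symplectic_form X).
Variables (S : star_product om) (g : lieAlgebra R) (n : nat) (e : n.-tuple g).
Variable J : quantum_momentum_map S g.
Hypothesis he : basis_of (fullv : {vspace g}) e.
Local Notation OM := (Cinfty X).
Local Notation OC := (sub_Cinfty (constraint J)).
Local Notation K := (fps R[i]).
Local Notation F := (fps_module OM).
Local Notation FO := (fps_module OC).
Local Notation Lg := (ext n F).
Local Notation A := (ext n Lg).
Local Notation restr := (restrict_to (constraint J)).
Implicit Types (x : Lg) (f : F) (a b c : 'I_n).

Lemma restrict_linear : linear (restr : OM -> OC).
Proof. by move=> k x y; apply/val_inj/funext. Qed.
HB.instance Definition _ := GRing.isLinear.Build R[i] OM OC _ (restr : OM -> OC) restrict_linear.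

Definition cinfty_mul (p f : OM) : OM := p * f.
Lemma cinfty_mul_linear p : linear (cinfty_mul p).
Proof.
move=> k x y; apply/val_inj/funext => q.
change (p q * (k * x q + y q) = k * (p q * x q) + p q * y q).
by rewrite mulrDr mulrCA.
Qed.
HB.instance Definition _ p := GRing.isLinear.Build R[i] OM OM _ (cinfty_mul p) (cinfty_mul_linear p).

Local Notation J0 a := (pairing J (tnth e a) 0%N).

Lemma koszul_gE (x : ext n OM) :
  koszul_g J e x = \sum_a ext_map (cinfty_mul (J0 a)) (ext_insert a x).
Proof. by []. Qed.

Lemma koszul_g_linear : linear (koszul_g J e).
Proof.
move=> k x y; rewrite !koszul_gE scaler_sumr -big_split; apply: eq_bigr => a _ /=.
by rewrite !linearP.
Qed.
HB.instance Definition _ := GRing.isLinear.Build R[i] (ext n OM) (ext n OM) _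
  (koszul_g J e) koszul_g_linear.

Lemma koszul_g0 (f0 : OM) : koszul_g J e (ext0 n f0) = 0.
Proof. by rewrite koszul_gE big1 // => a _; rewrite ext_insert0 linear0. Qed.

Lemma quantum_koszul0 x : quantum_koszul J e (ext0 n x) finset.set0 = quantum_koszul_g J e x.
Proof. by rewrite !ffunE cards0 expr0 scale1r eqxx. Qed.

Lemma quantum_koszul_g_linear : linear (quantum_koszul_g J e).
Proof.
have l := quantum_koszul_linear e J.
move=> k x y; rewrite -!quantum_koszul0 (linearP (@ext0 n K Lg)) l ffunE.
by congr (_ + _); rewrite ffunE.
Qed.
HB.instance Definition _ := GRing.isLinear.Build K Lg Lg _ (quantum_koszul_g J e) quantum_koszul_g_linear.

Lemma quantum_koszul_ext0 x : quantum_koszul J e (ext0 n x) = ext0 n (quantum_koszul_g J e x).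
Proof. exact: ext_smap0. Qed.

Lemma quantum_koszul_g_sq x : quantum_koszul_g J e (quantum_koszul_g J e x) = 0.
Proof.
by rewrite -quantum_koszul0 -quantum_koszul_ext0 quantum_koszul_sq // ffunE.
Qed.

Lemma quantum_koszul_gE x : quantum_koszul_g J e x =
  \sum_a ext_map (star_right S (pairing J (tnth e a))) (ext_insert a x)
  + ilam R *: (\sum_a rc (chi e (tnth e a)) *: ext_insert a x)
  - ilam R *: (\sum_(a : 'I_n) \sum_(b : 'I_n | (a < b)%N) \sum_c
      rc (struct_const e c a b) *: ext_wedge c (ext_insert b (ext_insert a x))).
Proof. by []. Qed.

Lemma quantum_koszul_g0 f : quantum_koszul_g J e (ext0 n f) = 0.
Proof.
rewrite quantum_koszul_gE big1 ?add0r => [|a _]; last by rewrite ext_insert0 linear0.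
rewrite big1 ?scaler0 ?add0r => [|a _]; last by rewrite ext_insert0 scaler0.
rewrite big1 ?scaler0 ?oppr0 // => a _; apply: big1 => b _; apply: big1 => c _.
by rewrite ext_insert0 !linear0.
Qed.

Lemma quantum_koszul_g_proj i x :
  ext_proj i (quantum_koszul_g J e x) = quantum_koszul_g J e (ext_proj i.+1 x).
Proof.
have pl (y z w : Lg) (k : K) :
    ext_proj i (y + k *: z - k *: w) = ext_proj i y + k *: ext_proj i z - k *: ext_proj i w.
  by rewrite ?ext_proj_lin.
pose S1 x := \sum_a ext_map (star_right S (pairing J (tnth e a))) (ext_insert a x).
pose S2 x := \sum_a rc (chi e (tnth e a)) *: ext_insert a x.
pose S3 x := \sum_(a : 'I_n) \sum_(b : 'I_n | (a < b)%N) \sum_c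
      rc (struct_const e c a b) *: ext_wedge c (ext_insert b (ext_insert a x)).
have e1 : ext_proj i (S1 x) = S1 (ext_proj i.+1 x).
  by rewrite /S1 ext_proj_lin; apply: eq_bigr => a _; rewrite -ext_map_proj ext_proj_insert.
have e2 : ext_proj i (S2 x) = S2 (ext_proj i.+1 x).
  by rewrite /S2 ext_proj_lin; apply: eq_bigr => a _; rewrite ext_proj_lin ext_proj_insert.
have e3 : ext_proj i (S3 x) = S3 (ext_proj i.+1 x).
  rewrite /S3 ext_proj_lin; apply: eq_bigr => a _; rewrite ext_proj_lin; apply: eq_bigr => b _.
  rewrite ext_proj_lin; apply: eq_bigr => c _; rewrite ext_proj_lin; congr (_ *: _).
  case: i {pl e1 e2} => [|i]; last by rewrite ext_proj_wedge !ext_proj_insert.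
  by rewrite ext_proj_wedge0 -ext_proj_insert ext_insert_proj0 linear0.
have ek y : quantum_koszul_g J e y = S1 y + ilam R *: S2 y - ilam R *: S3 y by [].
clearbody S1 S2 S3; rewrite !ek pl e1 e2 e3 //.
Qed.

Lemma series_coef_insert r a x : series_coef r (ext_insert a x) = ext_insert a (series_coef r x).
Proof. by apply/ffunP => I; rewrite !ffunE; case: ifP => // _; rewrite fps_sign. Qed.
Lemma series_coef_wedge r a x : series_coef r (ext_wedge a x) = ext_wedge a (series_coef r x).
Proof. by apply/ffunP => I; rewrite !ffunE; case: ifP => // _; rewrite fps_sign. Qed.
Lemma series_coef_rc r t x : series_coef r (rc t *: x) = t%:C%C *: series_coef r x.
Proof. by apply/ffunP => I; rewrite !ffunE fpsCZ. Qed.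
Lemma series_coef_ilam r x : (forall i, (i < r)%N -> series_coef i x = 0) ->
  series_coef r (ilam R *: x) = 0.
Proof.
move=> h; apply/ffunP => I; rewrite !ffunE ilamE; case: r h => // r /(_ r (ltnSn r)) /ffunP /(_ I).
by rewrite !ffunE => ->; rewrite scaler0.
Qed.

(** The corrections carry a factor [ilam] and start one order later, while the star product reduces
    to the pointwise one. *)
Lemma quantum_koszul_g_lead r x : (forall i, (i < r)%N -> series_coef i x = 0) ->
  series_coef r (quantum_koszul_g J e x) = koszul_g J e (series_coef r x).
Proof.
move=> x0; rewrite quantum_koszul_gE !series_coefD series_coefN !series_coef_ilam.
- rewrite oppr0 !addr0 series_coef_sum koszul_gE; apply: eq_bigr => a _.
  apply/ffunP => I; rewrite ffunE ffunE [RHS]ffunE -series_coef_insert [in RHS]ffunE /cinfty_mul mulrC.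
  apply: star_lead => i ir.
  have := congr1 (fun y : ext n OM => y I) (series_coef_insert i a x).
  by rewrite /= x0 // linear0 !ffunE.
- move=> i ir; rewrite series_coef_sum big1 // => a _; rewrite series_coef_sum big1 // => b _.
  rewrite series_coef_sum big1 // => c _.
  by rewrite series_coef_rc series_coef_wedge !series_coef_insert x0 // !linear0.
- move=> i ir; rewrite series_coef_sum big1 // => a _.
  by rewrite series_coef_rc series_coef_insert x0 // !linear0.
Qed.

Variable H : koszul_contraction J e.
Local Notation dg := (quantum_koszul_g J e : {linear Lg -> Lg}).
Local Notation k0 := (koszul_g J e : {linear ext n OM -> ext n OM}).
Local Notation rs := (restr : {linear OM -> OC}).

Definition quantum_iota : Lg -> FO := @kp_iota n R[i] OM OC (hmt H) (prol H) rs dg.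
Definition quantum_h : Lg -> Lg := @kp_hq n R[i] OM OC (hmt H) (prol H) rs dg.
Definition quantum_prol : FO -> Lg := @kp_pr n R[i] OM OC (prol H).

Local Notation Qop := (@kp_Q n R[i] OM OC (hmt H) (prol H) rs dg).
Local Notation Qinv := (@kp_Qi n R[i] OM OC (hmt H) (prol H) rs dg).

Let c0 (f : OM) : ext0 n (prol H (rs f)) + k0 (hmt H (ext0 n f)) = ext0 n f.
Proof. exact: (hmt_contract0 H). Qed.
Let c1 i (x : ext n OM) : (0 < i)%N -> ext_homog i%:Z x -> hmt H (k0 x) + k0 (hmt H x) = x.
Proof. exact: (hmt_contract H). Qed.
Let lead := quantum_koszul_g_lead.
Let hdeg i (x : ext n OM) : ext_homog i%:Z x -> ext_homog i.+1%:Z (hmt H x).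
Proof. exact: (hmt_degree H). Qed.
Let rpK (c : OC) : rs (prol H c) = c.
Proof. exact: (prolK H). Qed.
Let hpl (c : OC) : hmt H (ext0 n (prol H c)) = 0.
Proof. exact: (hmt_prol H). Qed.

Lemma quantum_iota_linear : linear quantum_iota.
Proof. exact: (kp_iota_linear c0 c1 koszul_g0 lead). Qed.
Lemma quantum_h_linear : linear quantum_h.
Proof. exact: (kp_hq_linear c0 c1 koszul_g0 lead). Qed.
HB.instance Definition _ := GRing.isLinear.Build K Lg FO _ quantum_iota quantum_iota_linear.
HB.instance Definition _ := GRing.isLinear.Build K Lg Lg _ quantum_h quantum_h_linear.
HB.instance Definition _ := GRing.isLinear.Build K FO Lg _ quantum_prol (kp_pr_linear n (prol H)).

Lemma quantum_iota_koszul x : quantum_iota (quantum_koszul_g J e x) = 0.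
Proof. exact: (kp_iota_d rpK c0 c1 hpl koszul_g0 quantum_koszul_g0 quantum_koszul_g_sq lead). Qed.
Lemma quantum_iota_prol (c : FO) : quantum_iota (quantum_prol c) = c.
Proof. exact: (kp_iota_pr rpK c0 c1 hpl koszul_g0 quantum_koszul_g0 lead). Qed.
Lemma quantum_homotopy x : quantum_prol (quantum_iota x) + quantum_koszul_g J e (quantum_h x)
  + quantum_h (quantum_koszul_g J e x) = x.
Proof. exact: (kp_homotopy rpK c0 c1 hpl koszul_g0 quantum_koszul_g0 quantum_koszul_g_sq lead). Qed.
Lemma quantum_iota_proj0 x : quantum_iota (ext_proj 0 x) = quantum_iota x.
Proof. exact: (kp_iota_proj0 hdeg c0 c1 koszul_g0 quantum_koszul_g0 quantum_koszul_g_proj lead). Qed.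
Lemma quantum_iota_h x : quantum_iota (quantum_h x) = 0.
Proof. exact: (kp_iota_hq hdeg c0 c1 koszul_g0 quantum_koszul_g0 quantum_koszul_g_proj lead). Qed.
Lemma quantum_h_proj i x : ext_proj i.+1 (quantum_h x) = quantum_h (ext_proj i x).
Proof. exact: (kp_hq_proj hdeg c0 c1 koszul_g0 quantum_koszul_g0 quantum_koszul_g_proj lead). Qed.
Lemma quantum_h_proj0 x : ext_proj 0 (quantum_h x) = 0.
Proof. exact: (kp_hq_proj0 (prol H) rs dg hdeg). Qed.

Lemma koszul_Q_linear : linear Qop. Proof. exact: kp_Q_linear. Qed.
Lemma koszul_Qi_linear : linear Qinv. Proof. exact: (kp_Qi_linear c0 c1 koszul_g0 lead). Qed.
Definition koszul_Q : Lg -> Lg := Qop.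
Definition koszul_Qi : Lg -> Lg := Qinv.
HB.instance Definition _ := GRing.isLinear.Build K Lg Lg _ koszul_Q koszul_Q_linear.
HB.instance Definition _ := GRing.isLinear.Build K Lg Lg _ koszul_Qi koszul_Qi_linear.

Lemma inverse_degree_Q (f : A -> A) l :
  (forall a : A, antighost_degree l a -> f a = ext_map koszul_Q a) ->
  set_bij (antighost_degree l) (antighost_degree l) f /\
  forall a : A, inverse_on (antighost_degree l) f (antighost_proj l a) =
    ext_map koszul_Qi (ext_map (ext_proj l) a).
Proof.
apply: (inverse_degree (Q := koszul_Q : {linear Lg -> Lg}) (Qi := koszul_Qi : {linear Lg -> Lg})).
- exact: (kp_Q_proj (prol H) rs hdeg quantum_koszul_g0 quantum_koszul_g_proj).
- exact: (kp_Qi_proj hdeg c0 c1 koszul_g0 quantum_koszul_g0 quantum_koszul_g_proj lead).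
- exact: (kp_QiK c0 c1 koszul_g0 lead).
- exact: (kp_QK c0 c1 koszul_g0 lead).
Qed.

Lemma lift_koszul_contract x : kp_pr n (prol H) (kp_io rs x) + coef_lift (koszul_g J e) (coef_lift (hmt H) x)
  + coef_lift (hmt H) (coef_lift (koszul_g J e) x) = x.
Proof.
apply: series_coefP => r; rewrite !series_coefD !series_coef_lift.
rewrite -[RHS](contract_all c0 c1 koszul_g0); congr (_ + _ + _).
by apply/ffunP => I; rewrite !ffunE; case: eqP.
Qed.

Lemma htpy_opE i (a : A) : (0 < i)%N -> antighost_degree i a -> htpy_op H a = ext_map koszul_Q a.
Proof.
move=> i0 ai; rewrite /htpy_op /h_cl /quantum_koszul !(ext_smap_smap (quantum_koszul_g J e : {linear Lg -> Lg})).
rewrite (ext_smap_smap (kp_h (hmt H) : {linear Lg -> Lg})); apply/ffunP => I.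
rewrite ffunE ffunE ffunE [RHS]ffunE /koszul_Q /kp_Q.
have -> : kp_io rs (a I) = 0.
  rewrite /kp_io ai ?cards0 1?eq_sym -?lt0n //; exact: (linear0 (smap rs : {linear F -> FO})).
by rewrite linear0 add0r addrC.
Qed.

(** The division in [B1] is exact, as the two Koszul operators agree at order zero. *)
Lemma lam_B1 (a : A) : antighost_degree 1 a ->
  lam R[i] *: B1 J e a = koszul J e a - quantum_koszul J e a.
Proof.
move=> a1; have -> : B1 J e a = ext_map (ext_map (@sdiv_lam OM)) (koszul J e a - quantum_koszul J e a).
  by rewrite /B1; have -> : proj_l 1 a = a by
    apply/ffunP => I; apply/ffunP => L; rewrite !ffunE; case: eqP => // /eqP L1; rewrite a1.
apply/ffunP => I; apply/ffunP => L; rewrite ffunE ffunE ffunE [in LHS]ffunE.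
apply: lam_sdiv.
have kI : koszul J e a I = (-1) ^+ #|I| *: coef_lift (koszul_g J e) (a I) by rewrite ffunE.
have qI : quantum_koszul J e a I = (-1) ^+ #|I| *: quantum_koszul_g J e (a I) by rewrite ffunE.
have -> : (koszul J e a - quantum_koszul J e a) I = koszul J e a I - quantum_koszul J e a I.
  by rewrite ffunE [X in _ + X]ffunE.
rewrite kI qI -scalerBr; set z := _ - _.
have z0 : series_coef 0 z = 0 by rewrite series_coefB series_coef_lift lead // subrr.
rewrite ffunE fps_sign; have -> : z L 0%N = series_coef 0 z L by rewrite [RHS]ffunE.
by rewrite z0 ffunE scaler0.
Qed.

(** Subtracting [lam * B1 * h] replaces the classical Koszul operator by the quantum one in the
    classical contraction identity of degree zero. *)
Lemma htpy_op0E (a : A) : antighost_degree 0 a -> htpy_op0 H a = ext_map koszul_Q a.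
Proof.
move=> a0; have aE I : a I = ext_proj 0 (a I).
  by apply/ffunP => L; rewrite ffunE; case: eqP => // /eqP L0; rewrite a0.
have ha1 : antighost_degree 1 (h_cl H a).
  move=> I L L1; rewrite /h_cl ffunE [X in X = 0]ffunE aE.
  change ((-1) ^+ #|I| *: kp_h (hmt H) (ext_proj 0 (a I)) L = 0).
  by rewrite -(kp_h_proj hdeg) ffunE (negPf L1) scaler0.
rewrite /htpy_op0 lam_B1 //; apply/ffunP => I.
have e1 : koszul J e (h_cl H a) I = coef_lift (koszul_g J e) (coef_lift (hmt H) (a I)).
  transitivity (ext_smap (kp_h k0 : {linear Lg -> Lg}) (ext_smap (kp_h (hmt H)) a) I); first by [].
  by rewrite ext_smap_smap ffunE.
have e2 : quantum_koszul J e (h_cl H a) I = quantum_koszul_g J e (coef_lift (hmt H) (a I)).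
  transitivity (ext_smap dg (ext_smap (kp_h (hmt H)) a) I); first by [].
  by rewrite ext_smap_smap ffunE.
rewrite ffunE [X in _ + X]ffunE [X in _ - X]ffunE [X in _ - (_ + X)]ffunE e1 e2 [RHS]ffunE /koszul_Q /kp_Q.
have d0 : quantum_koszul_g J e (a I) = 0 by rewrite aE ext_proj_zero quantum_koszul_g0.
rewrite [X in _ = _ + X](_ : _ = 0) ?addr0; last first.
  by change (kp_h (hmt H) (quantum_koszul_g J e (a I)) = 0); rewrite d0 linear0.
have := lift_koszul_contract (a I).
have -> : coef_lift (koszul_g J e) (a I) = 0.
  apply: series_coefP => r; rewrite series_coef_lift series_coef0 aE series_coef_proj ext_proj_zero.
  exact: koszul_g0.
rewrite (lin_rulesP (coef_lift_linear (hmt H))) addr0 => hE; rewrite -{1}hE.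
by rewrite opprB addrACA subrr addr0.
Qed.

Lemma htpy_op0_bij : set_bij (A_l 0) (A_l 0) (htpy_op0 H).
Proof. by have [] := inverse_degree_Q htpy_op0E. Qed.

Lemma htpy_op_bij i : (0 < i)%N -> set_bij (A_l i) (A_l i) (htpy_op H).
Proof. by move=> i0; have [] := inverse_degree_Q (fun a : A => @htpy_opE i a i0). Qed.

Lemma iota_qE (a : A) : iota_q H a = ext_smap quantum_iota a.
Proof.
have [_ inv] := inverse_degree_Q htpy_op0E.
rewrite /iota_q; have -> : inverse_on (A_l 0) (htpy_op0 H) (proj_l 0 a) =
    ext_map koszul_Qi (ext_map (ext_proj 0) a) by exact: inv.
apply/ffunP => I; rewrite ffunE [RHS]ffunE -quantum_iota_proj0; congr (_ *: _).
by rewrite !(ffunE (fun _ => koszul_Qi _)) ffunE.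
Qed.

Lemma h_qE (a : A) : h_q H a = ext_smap quantum_h a.
Proof.
have [_ inv0] := inverse_degree_Q htpy_op0E.
have inv i : (0 < i)%N -> inverse_on (A_l i) (htpy_op H) (proj_l i a) =
    ext_map koszul_Qi (ext_map (ext_proj i) a).
  by move=> i0; have [_] := inverse_degree_Q (fun a : A => @htpy_opE i a i0); apply.
rewrite /h_q; have -> : inverse_on (A_l 0) (htpy_op0 H) (proj_l 0 a) =
    ext_map koszul_Qi (ext_map (ext_proj 0) a) by exact: inv0.
rewrite (eq_big_nat _ _ (F2 := fun i => h_cl H (ext_map koszul_Qi (ext_map (ext_proj i) a)))); last first.
  by move=> i /andP[i1 _]; rewrite inv.
(* The separate term of degree zero becomes the first term of the sum. *)
rewrite -(big_ltn (F := fun i => h_cl H (ext_map koszul_Qi (ext_map (ext_proj i) a)))) // big_mkord.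
apply/ffunP => I; rewrite sum_ffunE [RHS]ffunE.
have -> : quantum_h (a I) = \sum_(i < n.+1) kp_h (hmt H) (koszul_Qi (ext_proj i (a I))).
  by rewrite -!linear_sum ext_proj_sum.
rewrite scaler_sumr; apply: eq_bigr => i _; rewrite ffunE.
by rewrite !(ffunE (fun _ => koszul_Qi _)) ffunE.
Qed.

End KoszulOperators.

(** * Contraction of the BRST complex *)

Section CartanEilenbergForm.
Variables (n : nat) (K : comNzRingType) (V : lmodType K) (t2 : 'I_n -> 'I_n -> 'I_n -> K).
Variable T : 'I_n -> {linear V -> V}.
Local Notation B := (ext n V).
Implicit Types (x : B) (d b c : 'I_n).

(** The common shape of [delta] and [deltaC], with the representation given on basis vectors by
    [T]. *)
Definition ce_form x : B :=
  - (\sum_d \sum_b \sum_c t2 c d b *: ext_wedge d (ext_wedge b (ext_insert c x)))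
  + \sum_d ext_wedge d (ext_map (T d) x).

Lemma ce_form_linear : linear ce_form.
Proof.
apply: add_linear; last by apply: sum_linear => d k x y; rewrite !linearP.
apply: opp_linear; do 3 (apply: sum_linear => ?); apply: scale_linear => k x y.
by rewrite !linearP.
Qed.
Definition ce_form_lin := lin_rulesP ce_form_linear.

Lemma ext_proj_wedge_insert (W : lmodType K) i c b (x : ext n W) :
  ext_proj i (ext_wedge c (ext_insert b x)) = ext_wedge c (ext_insert b (ext_proj i x)).
Proof.
case: i => [|i]; last by rewrite ext_proj_wedge ext_proj_insert.
by rewrite ext_proj_wedge0 ext_insert_proj0 linear0.
Qed.

Lemma ext_proj_ce_form i x : ext_proj i.+1 (ce_form x) = ce_form (ext_proj i x).
Proof.
rewrite /ce_form ?ext_proj_lin; congr (- _ + _); apply: eq_bigr => d _; last first.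
  by rewrite ext_proj_wedge ext_map_proj.
rewrite ?ext_proj_lin; apply: eq_bigr => b _; rewrite ?ext_proj_lin; apply: eq_bigr => c _.
by rewrite ?ext_proj_lin ext_proj_wedge ext_proj_wedge_insert.
Qed.

Lemma ext_proj0_ce_form x : ext_proj 0 (ce_form x) = 0.
Proof.
rewrite /ce_form ?ext_proj_lin big1 ?oppr0 ?add0r => [|d _].
  by apply: big1 => d _; rewrite ext_proj_wedge0.
rewrite ?ext_proj_lin; apply: big1 => b _; rewrite ?ext_proj_lin; apply: big1 => c _.
by rewrite ?ext_proj_lin ext_proj_wedge0 scaler0.
Qed.

Lemma ce_form0 v : ce_form (ext0 n v) = \sum_d ext_wedge d (ext0 n (T d v)).
Proof.
rewrite /ce_form big1 ?oppr0 ?add0r => [|d _]; first by apply: eq_bigr => d _; rewrite ext_map0.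
by apply: big1 => b _; apply: big1 => c _; rewrite ext_insert0 !linear0.
Qed.

Lemma sum_wedge0 (v : 'I_n -> V) d :
  (\sum_c ext_wedge c (ext0 n (v c)) : B) [set d]%SET = v d.
Proof.
rewrite sum_ffunE (bigD1 d) //= big1 ?addr0 => [|c cd].
  rewrite !ffunE finset.in_set1 eqxx finset.setDv eqxx positionE finset.big_set1 ltnn expr0.
  by rewrite scale1r.
by rewrite ffunE finset.in_set1 (negPf cd).
Qed.

Lemma ce_form0_eq0 v : ce_form (ext0 n v) = 0 <-> forall d, T d v = 0.
Proof.
rewrite ce_form0; split=> [h d|h]; last by rewrite big1 // => d _; rewrite h !linear0.
by rewrite -(sum_wedge0 (fun d => T d v) d) h ffunE.
Qed.

End CartanEilenbergForm.

Lemma ext_num_sum n (K : comNzRingType) (V : lmodType K) (x : ext n V) :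
  ext_num x = \sum_(i < n.+1) ext_proj i x *+ i.
Proof.
rewrite -{1}[x]ext_proj_sum (@ext_num_lin n K V); apply: eq_bigr => i _; apply/ffunP => I.
rewrite ffunE; have e j (y : ext n V) : (y *+ j) I = y I *+ j.
  by elim: j => [|j IH]; rewrite ?mulr0n ?ffunE // !mulrS ffunE IH.
by rewrite e ffunE; case: eqP => [->|] //; rewrite !mul0rn.
Qed.

(** * Extension of the contraction to ghosts, and nilpotence *)

Section GhostContraction.
Variables (n : nat) (K : comNzRingType) (F O : lmodType K).
Local Notation L := (ext n F).
Local Notation A := (ext n L).
Local Notation E := (ext n O).
Variables (iq : {linear L -> O}) (hq dg : {linear L -> L}) (pq : {linear O -> L}).
Variables (T : 'I_n -> {linear L -> L}) (t2 : 'I_n -> 'I_n -> 'I_n -> K).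
Hypotheses (iq_dg : forall x, iq (dg x) = 0) (iq_pq : forall c, iq (pq c) = c)
  (homotopyE : forall x, pq (iq x) + dg (hq x) + hq (dg x) = x)
  (iq_proj0 : forall x, iq (ext_proj 0 x) = iq x) (iq_hq : forall x, iq (hq x) = 0)
  (hq_proj : forall i x, ext_proj i.+1 (hq x) = hq (ext_proj i x))
  (hq_proj0 : forall x, ext_proj 0 (hq x) = 0)
  (dg_ext0 : forall f, dg (ext0 n f) = 0)
  (pq_ext0 : forall c, exists f, pq c = ext0 n f)
  (T_proj : forall d i x, ext_proj i (T d x) = T d (ext_proj i x))
  (delta_dg : forall a : A, ce_form t2 T (ext_smap dg a) = - ext_smap dg (ce_form t2 T a)).
Implicit Types (a : A) (c : E) (x : L) (d b : 'I_n).
Local Notation smapl f := (@ext_smap_lin n K _ _ f).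
Local Notation mapl := (@ext_map_lin n K _ _ (@ext_proj n K F _ : {linear L -> L})).

Definition gc_rho d (o : O) : O := iq (T d (pq o)).
Lemma gc_rho_linear d : linear (gc_rho d).
Proof. by move=> k x y; rewrite /gc_rho !linearP. Qed.
HB.instance Definition _ d := GRing.isLinear.Build K O O _ (gc_rho d) (gc_rho_linear d).
Local Notation rC := (fun d => gc_rho d : {linear O -> O}).

Definition gc_delta a : A := ce_form t2 T a.
Definition gc_dC c : E := ce_form t2 rC c.
Definition gc_iota a : E := ext_smap iq a.
Definition gc_h a : A := ext_smap hq a.
Definition gc_prol c : A := ext_smap pq c.
HB.instance Definition _ := GRing.isLinear.Build K A A _ gc_delta (ce_form_linear t2 T).
HB.instance Definition _ := GRing.isLinear.Build K E E _ gc_dC (ce_form_linear t2 rC).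
HB.instance Definition _ := GRing.isLinear.Build K A E _ gc_iota (ext_smap_linear iq).
HB.instance Definition _ := GRing.isLinear.Build K A A _ gc_h (ext_smap_linear hq).
HB.instance Definition _ := GRing.isLinear.Build K E A _ gc_prol (ext_smap_linear pq).

Lemma gc_iota_prol c : gc_iota (gc_prol c) = c.
Proof. by rewrite /gc_iota /gc_prol ext_smap_smap; apply/ffunP => I; rewrite ffunE /= iq_pq. Qed.
Lemma gc_iota_h a : gc_iota (gc_h a) = 0.
Proof. by rewrite /gc_iota /gc_h ext_smap_smap; apply/ffunP => I; rewrite !ffunE /= iq_hq. Qed.
Lemma gc_iota_dq a : gc_iota (ext_smap dg a) = 0.
Proof. by rewrite /gc_iota ext_smap_smap; apply/ffunP => I; rewrite !ffunE /= iq_dg. Qed.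
Lemma gc_dq_prol c : ext_smap dg (gc_prol c) = 0.
Proof.
rewrite /gc_prol ext_smap_smap; apply/ffunP => I; rewrite !ffunE /=.
by have [f ->] := pq_ext0 (c I).
Qed.
Lemma gc_homotopy a : gc_prol (gc_iota a) + ext_smap dg (gc_h a) + gc_h (ext_smap dg a) = a.
Proof.
rewrite /gc_prol /gc_iota /gc_h !ext_smap_smap; apply/ffunP => I.
by rewrite ffunE [X in X + _]ffunE !(ffunE (fun _ => (_ \o _) _)) /= homotopyE.
Qed.

(** On elements without ghosts the anticommutation of the two differentials is an equation between
    sums of e^d terms; comparing their coefficients gives one relation for each [d]. *)
Lemma gc_T_dg d x : T d (dg x) = dg (T d x).
Proof.
have := delta_dg (ext0 n x); rewrite ext_smap0 !ce_form0 (smapl dg) -sumrN.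
rewrite [RHS](eq_bigr (fun k : 'I_n => ext_wedge k (ext0 n (dg (T k x))))) => [h|k _]; last first.
  by rewrite ext_smap_wedge ext_smap0 opprK.
by rewrite -(sum_wedge0 (fun d => T d (dg x)) d) h sum_wedge0.
Qed.

(** [pq (iq x)] differs from [x] by an image of [dg], which stays one under [T d], and an image of
    [hq], which has no part of degree zero; [iq] kills both. *)
Lemma gc_rho_iota d x : gc_rho d (iq x) = iq (T d x).
Proof.
rewrite -[in RHS](homotopyE x) !(linearD (T d)) !(linearD iq) /= gc_T_dg iq_dg addr0.
rewrite -[iq (T d (hq _))]iq_proj0 T_proj hq_proj0 !linear0 addr0 //.
Qed.

Lemma gc_iota_delta a : gc_iota (gc_delta a) = - gc_dC (gc_iota a).
Proof.
pose S1 (W : lmodType K) (y : ext n W) := \sum_d \sum_b \sum_c t2 c d b *: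
    ext_wedge d (ext_wedge b (ext_insert c y)).
have e1 : gc_iota (S1 L a) = - S1 O (gc_iota a).
  rewrite /S1 /gc_iota (smapl iq) -sumrN; apply: eq_bigr => d _.
  rewrite (smapl iq) -sumrN; apply: eq_bigr => b _; rewrite (smapl iq) -sumrN; apply: eq_bigr => c _.
  rewrite (smapl iq) !ext_smap_wedge ext_smap_insert !(@ext_wedge_lin n K O) opprK.
  by rewrite scalerN.
have e2 : gc_iota (\sum_d ext_wedge d (ext_map (T d) a)) =
    - \sum_d ext_wedge d (ext_map (gc_rho d) (gc_iota a)).
  rewrite /gc_iota (smapl iq) -sumrN; apply: eq_bigr => d _; rewrite ext_smap_wedge.
  congr (- ext_wedge d _); rewrite ext_smap_map; apply/ffunP => I.
  by rewrite ffunE ffunE ffunE linearZ /= gc_rho_iota.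
transitivity (- gc_iota (S1 L a) + gc_iota (\sum_d ext_wedge d (ext_map (T d) a))).
  by rewrite -(linearN (gc_iota : {linear A -> E})) -(linearD (gc_iota : {linear A -> E})).
by rewrite e1 e2 -opprD.
Qed.

(** Antighost degree at least [k]: raised by [gc_h], kept by [gc_delta], and impossible for nonzero
    elements beyond [n]. *)
Definition filtered k a := forall i, (i < k)%N -> ext_map (ext_proj i) a = 0.

Lemma gc_h_filtered k a : filtered k a -> filtered k.+1 (gc_h a).
Proof.
move=> ak i ik; rewrite /gc_h ext_map_smap; apply/ffunP => I; rewrite ffunE [RHS]ffunE /=.
case: i ik => [|i]; first by rewrite hq_proj0 scaler0.
rewrite ltnS => /ak /ffunP /(_ I); rewrite !ffunE hq_proj => ->.
by rewrite linear0 scaler0.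
Qed.

Lemma gc_delta_proj i a : ext_map (ext_proj i) (gc_delta a) = gc_delta (ext_map (ext_proj i) a).
Proof.
rewrite /gc_delta /ce_form ?mapl; congr (- _ + _); apply: eq_bigr => d _.
  rewrite ?mapl; apply: eq_bigr => b _; rewrite ?mapl; apply: eq_bigr => c _.
  by rewrite ?mapl !ext_map_wedge ext_map_insert.
rewrite ext_map_wedge; congr (ext_wedge d _); rewrite !ext_map_map.
by apply/ffunP => I; rewrite ffunE [RHS]ffunE /= T_proj.
Qed.

Lemma gc_delta_filtered k a : filtered k a -> filtered k (gc_delta a).
Proof. by move=> ak i ik; rewrite gc_delta_proj ak // linear0. Qed.

Lemma filteredD k a a' : filtered k a -> filtered k a' -> filtered k (a + a').
Proof. by move=> ak a'k i ik; rewrite linearD /= ak // a'k // addr0. Qed.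

Lemma filtered_large a : filtered n.+1 a -> a = 0.
Proof.
move=> an; apply/ffunP => I; rewrite ffunE -[LHS]ext_proj_sum big1 // => i _.
by have /ffunP/(_ I) := an i (ltn_ord i); rewrite !ffunE.
Qed.

Lemma gc_h_nil a : iter n.+1 (fun a => gc_h (gc_delta a)) a = 0.
Proof.
apply: filtered_large; elim: n.+1 => // k IH.
exact/gc_h_filtered/gc_delta_filtered.
Qed.

Lemma gc_hat_nil (x : E * A) : iter n.+2 (hat_comm (gc_delta : {linear A -> A}) (gc_h : {linear A -> A})
  (gc_prol : {linear E -> A}) (gc_dC : {linear E -> E})) x = 0.
Proof.
(* The first application empties the component in [E] and gains no degree; each later one gains one.
   Hence [n.+2] iterations. *)
have e k : (iter k.+1 (hat_comm (gc_delta : {linear A -> A}) (gc_h : {linear A -> A})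
  (gc_prol : {linear E -> A}) (gc_dC : {linear E -> E})) x).1 = 0 /\
  filtered k (iter k.+1 (hat_comm (gc_delta : {linear A -> A}) (gc_h : {linear A -> A})
  (gc_prol : {linear E -> A}) (gc_dC : {linear E -> E})) x).2.
  elim: k => [|k [IH1 IH2]]; first by rewrite /= !linear0 addr0.
  rewrite iterS; move: (iter _ _ _) IH1 IH2 => [c a] /= -> ak; rewrite !linear0 addr0; split=> //.
  rewrite !add0r; apply: filteredD; first exact/gc_delta_filtered/gc_h_filtered.
  exact/gc_h_filtered/gc_delta_filtered.
have [e1 e2] := e n.+1; rewrite [LHS]surjective_pairing e1.
by rewrite (filtered_large e2).
Qed.

Lemma ext_num_T d x : ext_num (T d x) = T d (ext_num x).
Proof.
rewrite !ext_num_sum linear_sum; apply: eq_bigr => i _.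
by rewrite linearMn T_proj.
Qed.

Lemma ext_num_hq x : ext_num (hq x) = hq (ext_num x) + hq x.
Proof.
(* The top degree would be mapped to degree [n.+1]; its vanishing makes the shifted sum match. *)
have e0 : hq (ext_proj n x) = 0 by rewrite -hq_proj ext_proj_large.
have e1 : hq (ext_num x) = \sum_(i < n.+1) hq (ext_proj i x) *+ i.
  by rewrite ext_num_sum linear_sum; apply: eq_bigr => i _; rewrite linearMn.
have e2 : hq x = \sum_(i < n.+1) hq (ext_proj i x) by rewrite -linear_sum ext_proj_sum.
rewrite e1 [X in _ + X]e2 -big_split [RHS]big_ord_recr /= e0 mul0rn !addr0.
rewrite ext_num_sum big_ord_recl mulr0n add0r; apply: eq_bigr => i _.
by rewrite lift0 hq_proj mulrSr.
Qed.

(** [gc_delta] adds a ghost and [gc_h] an antighost, so the ghost number is unchanged. *)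
Lemma gc_hdelta_ghost a : ghost (gc_h (gc_delta a)) = gc_h (gc_delta (ghost a)).
Proof.
have gT d y : ghost (ext_map (T d) y) = ext_map (T d) (ghost y).
  rewrite !ghostE linearB /= ext_num_map; congr (_ - _).
  by apply/ffunP => I; rewrite !ffunE ext_num_T.
have gd y : ghost (gc_delta y) = gc_delta (ghost y) + gc_delta y.
  rewrite /gc_delta /ce_form; pose S1 (z : A) : A := \sum_d \sum_b \sum_c t2 c d b *:
    ext_wedge d (ext_wedge b (ext_insert c z)); pose S2 (z : A) : A := \sum_d ext_wedge d (ext_map (T d) z).
  have e1 : ghost (S1 y) = S1 (ghost y) + S1 y.
    rewrite /S1 (ghost_lin n F) -big_split; apply: eq_bigr => d _.
    rewrite (ghost_lin n F) -big_split; apply: eq_bigr => b _.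
    rewrite (ghost_lin n F) -big_split; apply: eq_bigr => c _ /=.
    rewrite (ghost_lin n F) !ghost_wedge ghost_insert !(@ext_wedge_lin n K L).
    by module_eq K (A : lmodType K).
  have e2 : ghost (S2 y) = S2 (ghost y) + S2 y.
    by rewrite /S2 (ghost_lin n F) -big_split; apply: eq_bigr => d _ /=; rewrite ghost_wedge gT.
  change (ghost (- S1 y + S2 y) = - S1 (ghost y) + S2 (ghost y) + (- S1 y + S2 y)).
  have gB (u v : A) : ghost (- u + v) = - ghost u + ghost v by rewrite !(ghost_lin n F).
  by rewrite gB e1 e2 opprD addrACA.
have gh y : ghost (gc_h y) = gc_h (ghost y) - gc_h y.
  have eM : ext_map (@ext_num n K F) (gc_h y) = gc_h (ext_map (@ext_num n K F) y) + gc_h y.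
    apply/ffunP => I; rewrite ffunE ffunE [RHS]ffunE !(ffunE (fun _ => _ *: _)) ffunE.
    by rewrite (@ext_num_lin n K F) ext_num_hq scalerDr.
  have eN : ext_num (gc_h y) = gc_h (ext_num y) by rewrite /gc_h ext_num_smap.
  have hB (u v : A) : gc_h (u - v) = gc_h u - gc_h v by exact: (linearB (gc_h : {linear A -> A})).
  by rewrite !ghostE eM eN hB opprD addrA.
by rewrite gh gd linearD /= addrK.
Qed.

Lemma gc_hdelta_ghostz (z : int) a : ghost a = a *~ z ->
  ghost (gc_h (gc_delta a)) = gc_h (gc_delta a) *~ z.
Proof.
move=> az; rewrite gc_hdelta_ghost az.
rewrite [gc_delta _](raddfMz (gc_delta : {linear A -> A})).
exact: (raddfMz (gc_h : {linear A -> A})).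
Qed.

End GhostContraction.

Lemma eq_hat_comm (K : comNzRingType) (A E : lmodType K) (delta delta' h h' : {linear A -> A})
    (prol prol' : {linear E -> A}) (dC dC' : {linear E -> E}) :
  delta =1 delta' -> h =1 h' -> prol =1 prol' -> dC =1 dC' ->
  hat_comm delta h prol dC =1 hat_comm delta' h' prol' dC'.
Proof.
move=> e1 e2 e3 e4 [c a]; rewrite /hat_comm /hat_delta /hat_h /=.
by rewrite e4 !e1 !e3 !e2 e4.
Qed.

Lemma linear_mulz (K : pzRingType) (U V : lmodType K) (f : {linear U -> V}) x z :
  f (x *~ z) = f x *~ z.
Proof. exact: raddfMz. Qed.

Lemma CE_ce_form (R : realType) (g : lieAlgebra R) (n : nat) (e : n.-tuple g)
    (Q : lmodType (fps R[i])) (rho : g -> Q -> Q) (T : 'I_n -> {linear Q -> Q}) c :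
  (forall d v, rho (tnth e d) v = T d v) ->
  CE e rho c = ce_form (fun c a b => rc (2^-1 * struct_const e c a b)) T c.
Proof.
move=> rT; rewrite /CE /ce_form; congr (_ + _); apply: eq_bigr => d _; congr (ext_wedge d _).
by apply/ffunP => I; rewrite !ffunE rT.
Qed.

Section QuantumContraction.
Variables (R : realType) (m : nat) (X : manifold R m) (om : symplectic_form X).
Variables (S : star_product om) (g : lieAlgebra R) (n : nat) (e : n.-tuple g).
Variable J : quantum_momentum_map S g.
Hypothesis he : basis_of (fullv : {vspace g}) e.
Variable H : koszul_contraction J e.
Local Notation OM := (Cinfty X).
Local Notation OC := (sub_Cinfty (constraint J)).
Local Notation K := (fps R[i]).
Local Notation F := (fps_module OM).
Local Notation FO := (fps_module OC).
Local Notation Lg := (ext n F).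
Local Notation A := (ext n Lg).
Local Notation E := (ext n FO).
Implicit Types (a : A) (c : E) (x : Lg) (f : F) (d : 'I_n) (xi : g).

Definition ad_rho xi x : Lg := ad_ext e xi x + ext_map (rhoM J xi) x.

Lemma ad_rho_linear xi : linear (ad_rho xi).
Proof.
apply: add_linear; last by move=> k x y; rewrite linearP.
do 2 (apply: sum_linear => ?); apply: scale_linear => k x y.
by rewrite !linearP.
Qed.
HB.instance Definition _ xi := GRing.isLinear.Build K Lg Lg _ (ad_rho xi) (ad_rho_linear xi).

Lemma ad_rho0 xi f : ad_rho xi (ext0 n f) = ext0 n (rhoM J xi f).
Proof.
rewrite /ad_rho ext_map0 /ad_ext big1 ?add0r // => b _; apply: big1 => c _.
by rewrite ext_insert0 !linear0.
Qed.

Lemma ad_rho_proj xi i x : ext_proj i (ad_rho xi x) = ad_rho xi (ext_proj i x).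
Proof.
rewrite /ad_rho ext_proj_lin -ext_map_proj; congr (_ + _).
rewrite /ad_ext ext_proj_lin; apply: eq_bigr => b _; rewrite ext_proj_lin; apply: eq_bigr => c _.
by rewrite ext_proj_lin ext_proj_wedge_insert.
Qed.

Local Notation iq := (quantum_iota H : {linear Lg -> FO}).
Local Notation hq := (quantum_h H : {linear Lg -> Lg}).
Local Notation dg := (quantum_koszul_g J e : {linear Lg -> Lg}).
Local Notation pq := (quantum_prol H : {linear FO -> Lg}).
Local Notation T := (fun d => ad_rho (tnth e d) : {linear Lg -> Lg}).
Local Notation t2 := (momentum_t2 e).

Lemma delta_dg a : ce_form t2 T (ext_smap dg a) = - ext_smap dg (ce_form t2 T a).
Proof. exact: (delta_koszul J he a). Qed.

Lemma iota_FE f : iota_F H f = quantum_iota H (ext0 n f).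
Proof. by rewrite /iota_F iota_qE ffunE cards0 expr0 scale1r ffunE eqxx. Qed.

Lemma rhoCE xi o : rhoC H xi o = quantum_iota H (ad_rho xi (quantum_prol H o)).
Proof. by rewrite /rhoC iota_FE -ad_rho0. Qed.

Lemma deltaCE c : deltaC H c = gc_dC iq pq T t2 c.
Proof. by apply: CE_ce_form => d v; exact: rhoCE. Qed.

Lemma iota_q_linear : linear (iota_q H).
Proof. by move=> k x y; rewrite !iota_qE linearP. Qed.
Lemma h_q_linear : linear (h_q H).
Proof. by move=> k x y; rewrite !h_qE linearP. Qed.
Lemma deltaC_linear : linear (deltaC H).
Proof. by move=> k x y; rewrite !deltaCE linearP. Qed.
HB.instance Definition _ := GRing.isLinear.Build K A E _ (iota_q H) iota_q_linear.
HB.instance Definition _ := GRing.isLinear.Build K A A _ (h_q H) h_q_linear.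
HB.instance Definition _ := GRing.isLinear.Build K E E _ (deltaC H) deltaC_linear.
HB.instance Definition _ := GRing.isLinear.Build K E A _ (prol_A H) (ext_smap_linear pq).

Let iq_dg := quantum_iota_koszul he H.
Let iq_pq := quantum_iota_prol H.
Let htp := quantum_homotopy he H.
Let iq_p0 := quantum_iota_proj0 H.
Let hq_p := quantum_h_proj H.
Let hq_p0 := quantum_h_proj0 H.
Let pq_e (c : FO) : exists f, pq c = ext0 n f.
Proof. by exists (smap (prol H) c). Qed.
Let T_p d i x : ext_proj i (T d x) = T d (ext_proj i x).
Proof. exact: ad_rho_proj. Qed.

Lemma iota_q_prol c : iota_q H (prol_A H c) = c.
Proof. rewrite iota_qE; exact: (gc_iota_prol (iq := iq) (pq := pq) iq_pq c). Qed.
Lemma iota_q_h a : iota_q H (h_q H a) = 0.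
Proof. rewrite iota_qE h_qE; exact: (gc_iota_h (iq := iq) (hq := hq) (quantum_iota_h H) a). Qed.
Lemma iota_q_koszul a : iota_q H (quantum_koszul J e a) = 0.
Proof. rewrite iota_qE; exact: (gc_iota_dq (iq := iq) (dg := dg) iq_dg a). Qed.
Lemma koszul_prol c : quantum_koszul J e (prol_A H c) = 0.
Proof.
have z f : dg (ext0 n f) = 0 by exact: quantum_koszul_g0.
exact: (gc_dq_prol (dg := dg) (pq := pq) z pq_e c).
Qed.
Lemma q_homotopy a : prol_A H (iota_q H a) + quantum_koszul J e (h_q H a)
  + h_q H (quantum_koszul J e a) = a.
Proof.
rewrite iota_qE !h_qE.
exact: (gc_homotopy (iq := iq) (hq := hq) (dg := dg) (pq := pq) htp a).
Qed.
Lemma iota_q_delta a : iota_q H (delta J e a) = - deltaC H (iota_q H a).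
Proof.
rewrite deltaCE !iota_qE.
exact: (gc_iota_delta (iq := iq) (hq := hq) (dg := dg) (pq := pq) (T := T) (t2 := t2)
  iq_dg htp iq_p0 hq_p0 T_p delta_dg a).
Qed.
Lemma rhoC_iota d x :
  rhoC H (tnth e d) (quantum_iota H x) = quantum_iota H (ad_rho (tnth e d) x).
Proof.
rewrite rhoCE; exact: (gc_rho_iota (iq := iq) (hq := hq) (dg := dg) (pq := pq) (T := T) (t2 := t2)
  iq_dg htp iq_p0 hq_p0 T_p delta_dg d x).
Qed.

Definition brst_map : {linear A -> A} := brst J e.
Definition delta_map : {linear A -> A} := delta J e.
Definition koszul_map : {linear A -> A} := quantum_koszul J e.
Definition h_q_map : {linear A -> A} := h_q H.
Definition iota_q_map : {linear A -> E} := iota_q H.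
Definition prol_map : {linear E -> A} := prol_A H.
Definition deltaC_map : {linear E -> E} := deltaC H.
Local Notation half := (rc (2^-1 : R)).

Lemma q_h_nil a : iter n.+1 (fun a => h_q H (delta J e a)) a = 0.
Proof.
have -> : (fun a => h_q H (delta J e a)) = fun a => gc_h hq (gc_delta T t2 a).
  by apply/funext => y; rewrite h_qE.
exact: (gc_h_nil (hq := hq) (T := T) t2 hq_p hq_p0 T_p a).
Qed.

Lemma q_hat_nil (x : E * A) : iter n.+2 (hat_comm delta_map h_q_map prol_map deltaC_map) x = 0.
Proof.
transitivity (iter n.+2 (hat_comm (gc_delta T t2 : {linear A -> A}) (gc_h hq : {linear A -> A})
    (gc_prol pq : {linear E -> A}) (gc_dC iq pq T t2 : {linear E -> E})) x).
  apply: eq_iter; apply: eq_hat_comm; [by []|exact: h_qE|by []|exact: deltaCE].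
exact: (gc_hat_nil iq (hq := hq) pq (T := T) t2 hq_p hq_p0 T_p x).
Qed.

Lemma brst_perturbation : perturbation half n.+2 n.+1 brst_map delta_map koszul_map h_q_map iota_q_map prol_map deltaC_map.
Proof.
split; [exact: rc_half|exact: brstE|exact: brst_sq|exact: delta_sq|exact: delta_koszul|
  exact: iota_q_prol|exact: iota_q_h|exact: iota_q_koszul|exact: koszul_prol|exact: q_homotopy|
  exact: iota_q_delta|exact: q_hat_nil|exact: q_h_nil].
Qed.

Lemma deltaC_sq c : deltaC H (deltaC H c) = 0.
Proof. exact: (dC_sq brst_perturbation c). Qed.

Lemma iota_q_brst a : iota_q H (brst J e a) = - deltaC H (iota_q H a).
Proof. exact: (iota_D brst_perturbation a). Qed.

Lemma htpy_op_hat_bij : set_bij setT setT (htpy_op_hat H).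
Proof. exact: (hat_op_bij brst_perturbation). Qed.

Let h_hat'E (x : E * A) : h_hat' H x = hat_h' half delta_map h_q_map prol_map deltaC_map x.
Proof. exact: erefl. Qed.

Lemma brst_hat_homotopy (x : E * A) : brst_hat H (h_hat' H x) + h_hat' H (brst_hat H x) = x.
Proof. by rewrite !h_hat'E; exact: (hat_h'P brst_perturbation x). Qed.

Lemma brst_closed_exact a c : brst J e a = 0 -> iota_q H a = deltaC H c -> exists b, a = brst J e b.
Proof. exact: (closed_exact brst_perturbation). Qed.

Lemma h_hatC'P c : deltaC H c = 0 ->
  brst J e (h_hatC' H c *+ 2) = 0 /\ iota_q H (h_hatC' H c *+ 2) = c.
Proof.
have -> : h_hatC' H c = hat_hC half delta_map h_q_map prol_map deltaC_map c by exact: (congr1 snd (h_hat'E (c, 0))).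
exact: (hat_hCP brst_perturbation).
Qed.

Definition brst_lift c : A := \sum_(k < n.+1) rc ((- 2^-1) ^+ k) *:
  iter k (fun a => h_q H (delta J e a)) (prol_A H c).

Lemma brst_liftP c : deltaC H c = 0 -> brst J e (brst_lift c) = 0 /\ iota_q H (brst_lift c) = c.
Proof.
have -> : brst_lift c = koszul_lift half n.+1 delta_map h_q_map prol_map c.
  by apply: eq_bigr => k _; rewrite rcX rcN.
exact: (koszul_liftP brst_perturbation).
Qed.

Lemma fps_torsionz f (k : int) : k != 0 -> f *~ k = 0 -> f = 0.
Proof.
case: k => [[|k]|k] // _; first exact: fps_torsion.
by rewrite NegzE mulrNz => /eqP; rewrite oppr_eq0 => /eqP; exact: fps_torsion.
Qed.

(** A coefficient of ghost number w satisfies the equation only if w - z annihilates it; without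
    integer torsion this forces w = z or a zero coefficient. *)
Lemma A_ghostP z a : A_ghost z a <-> ghost a = a *~ z.
Proof.
have gE I L : ghost a I L = a I L *~ (#|I|%:Z - #|L|%:Z).
  rewrite ghostE bigradedD bigradedN ffunE ffunE ffunE mulrzBr -!pmulrn; congr (_ - _).
  by elim: #|I| => [|k IH]; rewrite ?mulr0n ?ffunE // !mulrS ffunE IH.
have zE I L : (a *~ z) I L = a I L *~ z.
  case: z => k; first exact: bigradedMn.
  by rewrite NegzE !mulrNz bigradedN; congr (- _); exact: bigradedMn.
split=> [az|h I L IL].
  apply: bigradedP => I L; rewrite gE zE; have [->//|IL] := eqVneq (#|I|%:Z - #|L|%:Z) z.
  by rewrite az // !mul0rz.
have := congr1 (fun b : A => b I L) h; rewrite /= gE zE => /eqP; rewrite -subr_eq0 -mulrzBr => /eqP.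
by apply: fps_torsionz; rewrite subr_eq0.
Qed.

Lemma A_ghost_mul z w (a b : A) : A_ghost z a -> A_ghost w b -> A_ghost (z + w) (starS S a b).
Proof.
move=> /A_ghostP az /A_ghostP bw; apply/A_ghostP.
by rewrite -!standard_productE; exact: st_ghostz.
Qed.

Lemma A_ghostD z (a b : A) : A_ghost z a -> A_ghost z b -> A_ghost z (a + b).
Proof. by move=> az bz I L IL; rewrite bigradedD az // bz // addr0. Qed.
Lemma A_ghostZ z (k : K) a : A_ghost z a -> A_ghost z (k *: a).
Proof. by move=> az I L IL; rewrite bigradedZ az // scaler0. Qed.
Lemma A_ghost0 f : A_ghost 0 (ext0 n (ext0 n f) : A).
Proof.
move=> I L IL; rewrite ffunE; case: ifP => [/eqP I0|_]; last by rewrite ffunE.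
rewrite ffunE; case: ifP => // /eqP L0.
by rewrite I0 L0 cards0 subrr eqxx in IL.
Qed.

Lemma iota_q_ghost z a : A_ghost z a -> ext_homog z (iota_q H a).
Proof.
move=> az I Iz; rewrite iota_qE ffunE -quantum_iota_proj0 ext_proj_zero az ?cards0 ?subr0 //.
by rewrite !linear0.
Qed.

Lemma prol_A_ghost z c : ext_homog z c -> A_ghost z (prol_A H c).
Proof.
move=> cz I L IL; rewrite ffunE ffunE ffunE; case: ifP => [/eqP L0|_]; last by rewrite scaler0.
rewrite L0 cards0 subr0 in IL; rewrite (cz _ IL).
have -> : smap (prol H) 0 = 0 :> F by exact: (linear0 (smap (prol H) : {linear FO -> F})).
by rewrite scaler0.
Qed.

Lemma hdelta_ghost z a : A_ghost z a -> A_ghost z (h_q H (delta J e a)).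
Proof.
move=> /A_ghostP az; apply/A_ghostP; rewrite h_qE.
exact: (gc_hdelta_ghostz (hq := hq) (T := T) t2 hq_p T_p az).
Qed.

Lemma brst_lift_ghost z c : ext_homog z c -> A_ghost z (brst_lift c).
Proof.
move=> cz; rewrite /brst_lift; elim/big_rec: _ => [I L _|k a _ az]; first by rewrite !ffunE.
apply: A_ghostD => //; apply: A_ghostZ; elim: (k : nat) => [|j IH]; first exact: prol_A_ghost.
exact: hdelta_ghost.
Qed.

End QuantumContraction.

(** * Reduced algebra and invariants *)

Section DegreeProjection.
Variables (n : nat) (K : comNzRingType) (V : lmodType K).
Implicit Types (z w : int) (x : ext n V).

(** Zero in negative degrees, so that the shift by one under the differential holds for every
    integer. *)
Definition ext_projz z x : ext n V := if z is Posz i then ext_proj i x else 0.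

Lemma ext_projz_linear z : linear (ext_projz z).
Proof. by case: z => i k x y /=; [exact: linearP|rewrite scaler0 addr0]. Qed.
HB.instance Definition _ z := GRing.isLinear.Build K (ext n V) (ext n V) _
  (ext_projz z) (ext_projz_linear z).

Lemma ext_projz_homog z x : ext_homog z (ext_projz z x).
Proof. by case: z => i; [exact: ext_proj_homog|move=> I _; rewrite ffunE]. Qed.

Lemma ext_projz_id z x : ext_homog z x -> ext_projz z x = x.
Proof.
case: z => i xi; first by rewrite /= (ext_homog_proj _ xi) eqxx.
by apply/ffunP => I; rewrite /= xi // ffunE.
Qed.

Lemma ext_projz_other z w x : z != w -> ext_homog w x -> ext_projz z x = 0.
Proof.
move=> zw xw; case: z zw => i // zw; apply/ffunP => I; rewrite !ffunE.
by case: eqP => // Ii; rewrite xw // Ii.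
Qed.

Lemma ext_projz_sum x : x = \sum_(p < n.+1) ext_projz p%:Z x.
Proof. by rewrite ext_proj_sum. Qed.

Lemma ext_homog_range z x : ext_homog z x -> ~~ (0 <= z < n.+1%:Z) -> x = 0.
Proof.
move=> xz zn; apply/ffunP => I; rewrite ffunE; apply: xz.
apply: contra zn => /eqP <-; rewrite lez_nat /= ltz_nat ltnS.
by rewrite (leq_trans (max_card _)) ?card_ord.
Qed.

Lemma ext_projz_ce_form (t2 : 'I_n -> 'I_n -> 'I_n -> K) (T : 'I_n -> {linear V -> V}) z x :
  ext_projz (z + 1) (ce_form t2 T x) = ce_form t2 T (ext_projz z x).
Proof.
have c0 : ce_form t2 T (0 : ext n V) = 0 by exact: (ce_form_lin t2 T).1.2.
case: z => i; first by rewrite -PoszD addn1 /= ext_proj_ce_form.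
rewrite [in RHS]/ext_projz c0 NegzE addrC; case: i => [|i]; first by rewrite subrr /= ext_proj0_ce_form.
by rewrite -[i.+2]addn1 PoszD opprD addrCA subrr addr0 -NegzE.
Qed.

Lemma ext0_homog v : ext_homog 0 (ext0 n v : ext n V).
Proof. by move=> I; rewrite ffunE; case: ifP => // /eqP ->; rewrite cards0. Qed.

Lemma ext0_eval x : ext_homog 0 x -> ext0 n (x finset.set0) = x.
Proof. by move=> x0; rewrite -ext_proj_zero (ext_homog_proj _ x0). Qed.

Definition ext_eval x : V := x finset.set0.
Lemma ext_eval_linear : linear ext_eval.
Proof. by move=> k x y; rewrite /ext_eval !ffunE. Qed.
HB.instance Definition _ := GRing.isLinear.Build K (ext n V) V _ ext_eval ext_eval_linear.

Lemma ext_eval0 v : ext_eval (ext0 n v) = v.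
Proof. by rewrite /ext_eval ffunE eqxx. Qed.

Lemma ext_eval_ce_form (t2 : 'I_n -> 'I_n -> 'I_n -> K) (T : 'I_n -> {linear V -> V}) x :
  ext_eval (ce_form t2 T x) = 0.
Proof.
have := ext_proj0_ce_form t2 T x => /ffunP /(_ finset.set0).
by rewrite ffunE cards0 [RHS]ffunE.
Qed.

End DegreeProjection.

Section ReducedAlgebra.
Variables (R : realType) (m : nat) (X : manifold R m) (om : symplectic_form X).
Variables (S : star_product om) (g : lieAlgebra R) (n : nat) (e : n.-tuple g).
Variable J : quantum_momentum_map S g.
Hypothesis he : basis_of (fullv : {vspace g}) e.
Variable H : koszul_contraction J e.
Local Notation OM := (Cinfty X).
Local Notation OC := (sub_Cinfty (constraint J)).
Local Notation K := (fps R[i]).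
Local Notation F := (fps_module OM).
Local Notation FO := (fps_module OC).
Local Notation Lg := (ext n F).
Local Notation A := (ext n Lg).
Local Notation E := (ext n FO).
Local Notation il := (ilam R).
Local Notation Jd d := (pairing J (tnth e d)).
Local Notation chd d := (rc (chi e (tnth e d))).
Local Ltac mod_F := module_eq (fps R[i]) (fps_module (Cinfty X) : lmodType (fps R[i])).
Implicit Types (a : A) (c : E) (x : Lg) (f h : F) (d : 'I_n) (xi : g).

Lemma quantum_koszul_eval x : quantum_koszul_g J e x finset.set0 =
  \sum_d (star S (x [set d]%SET) (Jd d) + il *: (chd d *: x [set d]%SET)).
Proof.
rewrite quantum_koszul_gE.
have ins d : ext_insert d x finset.set0 = x [set d]%SET.
  by rewrite ffunE finset.in_set0 positionE finset.big_set0 expr0 scale1r finset.setU0.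
rewrite ffunE [X in X + _]ffunE [X in _ + X]ffunE [X in - X]ffunE.
have -> : (\sum_(a : 'I_n) \sum_(b : 'I_n | (a < b)%N) \sum_c
      rc (struct_const e c a b) *: ext_wedge c (ext_insert b (ext_insert a x))) finset.set0 = 0.
  rewrite sum_ffunE big1 // => a _; rewrite sum_ffunE big1 // => b _; rewrite sum_ffunE big1 // => c _.
  by rewrite ffunE ffunE finset.in_set0 scaler0.
rewrite scaler0 subr0 [X in _ + X]ffunE !sum_ffunE scaler_sumr -big_split; apply: eq_bigr => d _ /=.
by rewrite ffunE [X in _ + il *: X]ffunE ins.
Qed.

Lemma ideal_CP f : ideal_C J e f <-> exists y : 'I_n -> F,
  f = \sum_d (star S (y d) (Jd d) + il *: (chd d *: y d)).
Proof.
split=> [[a _ <-]|[y ->]].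
  exists (fun d => a finset.set0 [set d]%SET).
  by rewrite -quantum_koszul_eval ffunE cards0 expr0 scale1r.
exists (ext0 n (\sum_d ext_wedge d (ext0 n (y d)))) => [I L|].
  rewrite ffunE; case: ifP => [/eqP ->|_]; last by rewrite ffunE.
  rewrite cards0 eqxx /= => L1; rewrite sum_ffunE big1 // => d _.
  rewrite !ffunE; case: ifP => // dL; case: eqP => [/eqP|_]; last by rewrite scaler0.
  rewrite finset.setD_eq0 => Ld.
  by case/eqP: L1; apply/eqP; rewrite eqn_leq (leq_trans (subset_leq_card Ld)) ?cards1 // card_gt0;
    apply/finset.set0Pn; exists d.
rewrite quantum_koszul0 quantum_koszul_eval.
by apply: eq_bigr => d _; rewrite sum_wedge0.
Qed.

(** If [f] is in the kernel, the homotopy identity leaves only the image of [quantum_h] of [f] under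
    the Koszul operator. *)
Lemma ideal_CE f : ideal_C J e f <-> iota_F H f = 0.
Proof.
rewrite iota_FE; split=> [/ideal_CP[y ->]|h].
  have -> : ext0 n (\sum_d (star S (y d) (Jd d) + il *: (chd d *: y d))) =
      ext_proj 0 (quantum_koszul_g J e (\sum_d ext_wedge d (ext0 n (y d)))).
    by rewrite ext_proj_zero quantum_koszul_eval; congr (ext0 n _); apply: eq_bigr => d _; rewrite sum_wedge0.
  by rewrite quantum_iota_proj0 quantum_iota_koszul.
have := quantum_homotopy he H (ext0 n f).
rewrite h quantum_koszul_g0 !linear0 add0r addr0 => hE; apply/ideal_CP.
exists (fun d => quantum_h H (ext0 n f) [set d]%SET).
by rewrite -quantum_koszul_eval hE ffunE eqxx.
Qed.

Lemma ilam_scale_eq0 (V : lmodType R[i]) (v : fps_module V) : il *: v = 0 -> v = 0.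
Proof.
move=> h; apply/funext => r; have := congr1 (fun w : fps_module V => w r.+1) h.
rewrite ilamE => /(congr1 (fun w => (iC R)^-1 *: w)).
by rewrite scalerA mulVf ?iC_neq0 // scale1r scaler0.
Qed.

Lemma iota_F_linear : linear (iota_F H).
Proof. by move=> k x y; rewrite !iota_FE !linearP. Qed.
HB.instance Definition _ := GRing.isLinear.Build K F FO _ (iota_F H) iota_F_linear.

Lemma ideal_C_left f h : ideal_C J e h -> ideal_C J e (star S f h).
Proof.
move=> /ideal_CP[y ->]; apply/ideal_CP; exists (fun d => star S f (y d)).
rewrite starr_lin; apply: eq_bigr => d _.
by rewrite !starr_lin starA.
Qed.

Lemma ideal_CD f h : ideal_C J e f -> ideal_C J e h -> ideal_C J e (f + h).
Proof.
move=> /ideal_CP[y ->] /ideal_CP[z ->]; apply/ideal_CP; exists (fun d => y d + z d).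
by rewrite -big_split; apply: eq_bigr => d _ /=; rewrite !starl_lin; mod_F.
Qed.

Lemma ideal_CZ (k : K) f : ideal_C J e f -> ideal_C J e (k *: f).
Proof.
move=> /ideal_CP[y ->]; apply/ideal_CP; exists (fun d => k *: y d).
by rewrite scaler_sumr; apply: eq_bigr => d _ /=; rewrite !starl_lin; mod_F.
Qed.

Lemma ideal_C_sum (f : 'I_n -> F) : (forall d, ideal_C J e (f d)) -> ideal_C J e (\sum_d f d).
Proof.
move=> fI; elim/big_ind: _ => //; last exact: ideal_CD.
apply/ideal_CP; exists (fun _ => 0); rewrite big1 // => d _.
by rewrite starl_lin !scaler0 addr0.
Qed.

Lemma normalizer_CE f : normalizer_C J e f <-> forall d, ideal_C J e (rhoM J (tnth e d) f).
Proof.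
split=> [Nf d|rf h].
  (* The generator J_d + i lambda chi(e_d) of the ideal. Its constant part is central, so its
     commutator with [f] is i lambda times [rhoM], up to sign. *)
  pose u : F := \sum_b (star S ((d == b)%:R *: one_F X) (Jd b) + il *: (chd b *: ((d == b)%:R *: one_F X))).
  have uI : ideal_C J e u by apply/ideal_CP; exists (fun b => (d == b)%:R *: one_F X).
  have uE : u = Jd d + il *: (chd d *: one_F X).
    rewrite -(sum_delta d (fun b => Jd b + il *: (chd b *: one_F X))); apply: eq_bigr => b _.
    by rewrite !starl_lin star1l; mod_F.
  have := Nf u uI; rewrite uE !(starl_lin, starr_lin) star1l star1r => h.
  have e1 : star S f (Jd d) + il *: (chd d *: f) - (star S (Jd d) f + il *: (chd d *: f)) =
      - (il *: rhoM J (tnth e d) f) by rewrite rhoM_ilam; mod_F.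
  (* As the kernel of a map into a module without lambda-torsion, the ideal allows i lambda to be
     cancelled. *)
  move: h; rewrite e1 => /ideal_CE; rewrite linearN linearZ /= => /eqP; rewrite oppr_eq0 => /eqP.
  by move=> /ilam_scale_eq0 /ideal_CE.
move=> /ideal_CP[y ->].
(* Leibniz rule for the commutator with [f]: differentiating the coefficients [y d] stays in the
   ideal, and differentiating the generators produces [rhoM]. *)
have -> : star S f (\sum_d (star S (y d) (Jd d) + il *: (chd d *: y d))) -
  star S (\sum_d (star S (y d) (Jd d) + il *: (chd d *: y d))) f =
  \sum_d (star S (star S f (y d) - star S (y d) f) (Jd d) +
     il *: (chd d *: (star S f (y d) - star S (y d) f))) -
  il *: \sum_d star S (y d) (rhoM J (tnth e d) f).
  rewrite !(starl_lin, starr_lin) scaler_sumr -!sumrB; apply: eq_bigr => d _.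
  rewrite -[il *: star S (y d) _]starr_lin rhoM_ilam !(starl_lin, starr_lin) !starA; mod_F.
apply: ideal_CD; first by apply/ideal_CP; eexists.
rewrite -scaleN1r scalerA; apply: ideal_CZ; apply: ideal_C_sum => d; exact: ideal_C_left.
Qed.

Lemma deltaC0 (o : FO) : deltaC H (ext0 n o) = 0 <-> forall d, rhoC H (tnth e d) o = 0.
Proof.
rewrite deltaCE; split=> [h d|h].
  by rewrite rhoCE; have /ce_form0_eq0 := h; apply.
by apply/ce_form0_eq0 => d; have := h d; rewrite rhoCE.
Qed.

Lemma rhoC_iota_F d f : rhoC H (tnth e d) (iota_F H f) = iota_F H (rhoM J (tnth e d) f).
Proof. by rewrite !iota_FE -(ad_rho0 e); exact: rhoC_iota. Qed.

Lemma normalizer_deltaC f : normalizer_C J e f <-> deltaC H (ext0 n (iota_F H f)) = 0.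
Proof.
rewrite normalizer_CE; split=> [h|/deltaC0 h d].
  by apply/deltaC0 => d; rewrite rhoC_iota_F; apply/ideal_CE; exact: h.
by apply/ideal_CE; rewrite -rhoC_iota_F.
Qed.

Lemma rhoM_sum xi f : rhoM J xi f = \sum_d rc (coord e d xi) *: rhoM J (tnth e d) f.
Proof.
apply: ilam_injF; rewrite scaler_sumr rhoM_ilam {1 2}[xi](basis_expansion he) !pairing_sum.
rewrite !(starl_lin, starr_lin) -sumrB; apply: eq_bigr => d _.
rewrite scalerA mulrC -scalerA rhoM_ilam !(starl_lin, starr_lin); mod_F.
Qed.

Lemma invariantsP (o : FO) : invariants H o <-> deltaC H (ext0 n o) = 0.
Proof.
rewrite deltaC0; split=> [h d|h xi]; first exact: h.
rewrite /rhoC rhoM_sum linear_sum big1 // => d _; rewrite linearZ /=.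
have := h d; rewrite /rhoC => ->; exact: scaler0.
Qed.

Definition zero_part a : F := a finset.set0 finset.set0.
Lemma zero_part_linear : linear zero_part.
Proof. by move=> k x y; rewrite /zero_part bigraded_coef. Qed.
HB.instance Definition _ := GRing.isLinear.Build K A F _ zero_part zero_part_linear.

Lemma zero_partZ (k : K) a : zero_part (k *: a) = k *: zero_part a.
Proof. by rewrite /zero_part bigradedZ. Qed.
Lemma zero_part_sum (I : Type) (r : seq I) (P : pred I) (h : I -> A) :
  zero_part (\sum_(i <- r | P i) h i) = \sum_(i <- r | P i) zero_part (h i).
Proof. exact: (linear_sum (zero_part : {linear A -> F})). Qed.

Lemma iota_q_eval a : ext_eval (iota_q H a) = iota_F H (zero_part a).
Proof.
by rewrite iota_FE iota_qE /ext_eval ffunE cards0 expr0 scale1r -quantum_iota_proj0 ext_proj_zero.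
Qed.

Lemma deltaC_eval c : ext_eval (deltaC H c) = 0.
Proof. by rewrite deltaCE ext_eval_ce_form. Qed.

Lemma zero_part_wedge_star a (b : A) : zero_part (wedge_star S a b) = star S (zero_part a) (zero_part b).
Proof.
rewrite /zero_part wedge_starE finset.powerset0 finset.big_set1 finset.big_set1.
rewrite !finset.setD0 /shuffle_sign !inversionsE !finset.big_set0 cards0 mul0n !expr0 !mul1r.
by rewrite scale1r.
Qed.

(* Contracting b lowers its ghost number, so that the contracted factors have no
   component in degree (0, 0). *)
Lemma zero_part_starS a (b : A) : A_ghost 0 b ->
  zero_part (starS S a b) = star S (zero_part a) (zero_part b).
Proof.
move=> b0; rewrite starSE -zero_part_wedge_star.
have c0 : rc (0`!%:R)^-1 * (2%:R * il) ^+ 0 = 1 by rewrite fact0 invr1 rc1 expr0 mul1r.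
apply: (contraction_exp_head (phi := fun a => wedge_star S a : {linear A -> A}) (I := exp_insert F)
  (exp_right_insert F) (coef := fun r => rc (r`!%:R)^-1 * (2%:R * il) ^+ r) c0
  (h := zero_part : {linear A -> F}) (G := fun z => @A_ghost R m X n z)) b0 => [d z y yz|z x y yz z0].
  have /A_ghostP h := yz; apply/A_ghostP; rewrite ghost_insert h mulrzBr mulr1z; congr (_ - _).
  exact: (linear_mulz (ext_insert d : {linear A -> A})).
rewrite [LHS]zero_part_wedge_star (_ : zero_part y = 0) ?starr_lin //.
by apply: yz; rewrite cards0 subrr eq_sym.
Qed.

Lemma zero_part_h_q a : zero_part (h_q H a) = 0.
Proof.
have h0 : quantum_h H (a finset.set0) finset.set0 = 0.
  have := congr1 (fun y : Lg => y finset.set0) (quantum_h_proj0 H (a finset.set0)).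
  by rewrite ffunE cards0 eqxx [RHS]ffunE.
by rewrite /zero_part h_qE ffunE cards0 expr0 scale1r.
Qed.

(** All later terms of the series are values of [h_q], which have positive antighost degree. *)
Lemma zero_part_lift c : zero_part (brst_lift H c) = zero_part (prol_A H c).
Proof.
rewrite /brst_lift zero_part_sum big_ord_recl big1 => [|k _].
  by rewrite addr0 zero_partZ expr0 rc1 scale1r.
by rewrite zero_partZ lift0 iterS zero_part_h_q scaler0.
Qed.

End ReducedAlgebra.

Section CohomologyHypotheses.
Variables (R : realType) (m : nat) (X : manifold R m) (om : symplectic_form X).
Variables (S : star_product om) (g : lieAlgebra R) (n : nat) (e : n.-tuple g).
Variable J : quantum_momentum_map S g.
Hypothesis he : basis_of (fullv : {vspace g}) e.
Variable H : koszul_contraction J e.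
Local Notation K := (fps R[i]).
Local Notation F := (fps_module (Cinfty X)).
Local Notation FO := (fps_module (sub_Cinfty (constraint J))).
Local Notation A := (ext n (ext n F)).
Local Notation E := (ext n FO).
Implicit Types (a : A) (c : E).

Lemma deltaC_projz z c : ext_projz (z + 1) (deltaC H c) = deltaC H (ext_projz z c).
Proof. by rewrite !deltaCE; exact: ext_projz_ce_form. Qed.

Lemma brst_parity_closed a : brst J e a = 0 -> brst J e (ext_parity a) = 0.
Proof.
move=> Da; apply: oppr_inj; rewrite -brst_parity Da oppr0.
exact: (linear0 (@ext_parity n K F : {linear A -> A})).
Qed.

(** In ghost number zero [iota_q] sees only the zero part, and it maps the closed [a] to a closed,
    hence invariant, function. *)
Lemma brst_normalizer a : A_ghost 0 a -> brst J e a = 0 -> normalizer_C J e (zero_part a).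
Proof.
move=> a0 Da; apply/(normalizer_deltaC he H).
have iE : ext0 n (iota_F H (zero_part a)) = iota_q H a.
  by rewrite -iota_q_eval; apply: ext0_eval; exact: iota_q_ghost.
rewrite iE -[LHS]opprK -iota_q_brst // Da.
by rewrite (linear0 (iota_q H : {linear A -> E})) oppr0.
Qed.

End CohomologyHypotheses.

Theorem theorem29 (R : realType) (m : nat) (X : manifold R m)
    (om : symplectic_form X) (S : star_product om)
    (g : lieAlgebra R) (n : nat) (e : n.-tuple g)
    (he : basis_of (fullv : {vspace g}) e)
    (J : quantum_momentum_map S g) (hC : regular_constraint J)
    (H : koszul_contraction J e) :
  (* the inverses in the definitions of iota_q, h_q and h_hat' exist *)
  [/\ set_bij (A_l 0) (A_l 0) (htpy_op0 H),
      (forall i : nat, (0 < i)%N -> set_bij (A_l i) (A_l i) (htpy_op H)) &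
      set_bij setT setT (htpy_op_hat H)]
  /\
  (* (i) *)
  ((forall x, brst_hat H (h_hat' H x) + h_hat' H (brst_hat H x) = x) /\
   (forall a, brst J e a = 0 ->
      deltaC H (iota_q H a) = 0 /\ Psi H (cls_BRST J e a) = cls_CE H (iota_q H a)) /\
   set_bij (H_BRST J e) (H_CE H) (Psi H) /\
   (forall z : int, Psi H @` H_BRST_deg J e z = H_CE_deg H z) /\
   (forall Y Z, H_BRST J e Y -> H_BRST J e Z ->
      Psi H (class_add (range (brst J e)) Y Z)
      = class_add (range (deltaC H)) (Psi H Y) (Psi H Z)) /\
   (forall (k : fps R[i]) Y, H_BRST J e Y ->
      Psi H (class_scale (range (brst J e)) k Y)
      = class_scale (range (deltaC H)) k (Psi H Y)) /\
   (forall Y, H_BRST J e Y -> Psi_inv H (Psi H Y) = Y) /\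
   (forall Z, H_CE H Z -> Psi H (Psi_inv H Z) = Z) /\
   (forall c, deltaC H c = 0 ->
      [/\ brst J e (h_hatC' H c *+ 2) = 0,
          Psi_inv H (cls_CE H c) = cls_BRST J e (h_hatC' H c *+ 2) &
          cls_BRST J e (h_hatC' H c *+ 2) =
          cls_BRST J e (\sum_(k < n.+1) rc ((- 2^-1) ^+ k) *:
            iter k (fun a => h_q H (delta J e a)) (prol_A H c))]))
  /\
  (* (ii) *)
  (graded_unital_algebra (range (deltaC H)) n.+1 (H_CE H) (H_CE_deg H)
     (mul_CE H) (Psi H (cls_BRST J e (one_A X n))) /\
   (forall Y Z, H_BRST J e Y -> H_BRST J e Z ->
      Psi H (mul_BRST J e Y Z) = mul_CE H (Psi H Y) (Psi H Z)) /\
   (forall c1 c2, deltaC H c1 = 0 -> deltaC H c2 = 0 ->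
      mul_CE H (cls_CE H c1) (cls_CE H c2) =
      cls_CE H (iota_q H (starS S (h_hatC' H c1) (h_hatC' H c2)) *+ 4)))
  /\
  (* (iii) *)
  ((forall phi, A_ghost 0 phi -> brst J e phi = 0 ->
      normalizer_C J e (phi finset.set0 finset.set0) /\
      Lmap J e (cls_BRST J e phi) =
        vcoset (ideal_C J e) (phi finset.set0 finset.set0)) /\
   set_bij (H_BRST_deg J e 0) (reduced J e) (Lmap J e) /\
   (forall Y Z, H_BRST_deg J e 0 Y -> H_BRST_deg J e 0 Z ->
      Lmap J e (class_add (range (brst J e)) Y Z)
      = class_add (ideal_C J e) (Lmap J e Y) (Lmap J e Z)) /\
   (forall (k : fps R[i]) Y, H_BRST_deg J e 0 Y ->
      Lmap J e (class_scale (range (brst J e)) k Y)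
      = class_scale (ideal_C J e) k (Lmap J e Y)) /\
   (forall Y Z, H_BRST_deg J e 0 Y -> H_BRST_deg J e 0 Z ->
      Lmap J e (mul_BRST J e Y Z)
      = mul_reduced J e (Lmap J e Y) (Lmap J e Z)) /\
   Lmap J e (cls_BRST J e (one_A X n)) = vcoset (ideal_C J e) (one_F X))
  /\
  (* (iv) *)
  (set_bij (invariants H) (H_CE_deg H 0) (fun c => cls_CE H (ext0 n c)) /\
   (forall c1 c2, invariants H c1 -> invariants H c2 ->
      exists c3, [/\ invariants H c3,
        ext0 n c3 =
          iota_q H (starS S (prol_A H (ext0 n c1)) (prol_A H (ext0 n c2))) &
        mul_CE H (cls_CE H (ext0 n c1)) (cls_CE H (ext0 n c2))
          = cls_CE H (ext0 n c3)])).
Proof.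
(* The maps are bundled with their linear structures once, so that the abstract lemmas are all
   instantiated with the same ones. *)
pose K := fps R[i]; pose F : lmodType K := fps_module (Cinfty X).
pose FO : lmodType K := fps_module (sub_Cinfty (constraint J)).
pose A : lmodType K := ext n (ext n F); pose E : lmodType K := ext n FO.
pose D := brst J e : {linear A -> A}.
pose iq := iota_q H : {linear A -> E}.
pose dC := deltaC H : {linear E -> E}.
pose st := (fun a => starS S a : {linear A -> A}).
pose str := (fun b => starS_right S b : {linear A -> A}).
pose fm := (fun f => star_left S f : {linear F -> F}).
pose fmr := (fun f => star_right S f : {linear F -> F}).
pose iF := iota_F H : {linear F -> FO}.
pose zz := @zero_part R m X n : {linear A -> F}.
pose ev := @ext_eval n K FO : {linear E -> FO}.
pose e0 := @ext0 n K FO : {linear FO -> E}.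
pose pr := fun z => @ext_projz n K FO z : {linear E -> E}.
have D2 a : D (D a) = 0 by exact: (brst_sq J he).
have dC2 c : dC (dC c) = 0 by exact: (deltaC_sq he H).
have iD a : iq (D a) = - dC (iq a) by exact: (iota_q_brst he H).
have ce a c : D a = 0 -> iq a = dC c -> exists b, a = D b by exact: brst_closed_exact.
have hP c : dC c = 0 -> D (h_hatC' H c *+ 2) = 0 /\ iq (h_hatC' H c *+ 2) = c by exact: h_hatC'P.
have lP c : dC c = 0 -> D (brst_lift H c) = 0 /\ iq (brst_lift H c) = c by exact: brst_liftP.
have lg z c : ext_homog z c -> A_ghost z (brst_lift H c) by exact: brst_lift_ghost.
have ig z a : A_ghost z a -> ext_homog z (iq a) by exact: iota_q_ghost.
have strE a b : str b a = st a b by [].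
have stA a b a' : st a (st b a') = st (st a b) a' by exact: starS_assoc.
have st1 a : st (one_A X n) a = a by exact: starS1l.
have stx1 a : st a (one_A X n) = a by exact: starS1r.
have Dd a b : D (st a b) = st (D a) b + st (ext_parity a) (D b) by exact: brst_derivation.
have pK (a : A) : ext_parity (ext_parity a) = a by exact: ext_parityK.
have Dp a : D a = 0 -> D (ext_parity a) = 0 by exact: brst_parity_closed.
have D1 : D (one_A X n) = 0 by exact: brst1.
have o0 : A_ghost 0 (one_A X n) by exact: A_ghost0.
have sg z w a b : A_ghost z a -> A_ghost w b -> A_ghost (z + w) (st a b) by exact: A_ghost_mul.
have pg z x : ext_homog z (pr z x) by exact: ext_projz_homog.
have pi z x : ext_homog z x -> pr z x = x by exact: ext_projz_id.
have po z w x : z != w -> ext_homog w x -> pr z x = 0 by exact: ext_projz_other.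
have ps (x : E) : x = \sum_(p < n.+1) pr p%:Z x by exact: ext_projz_sum.
have er z (x : E) : ext_homog z x -> ~~ (0 <= z < n.+1%:Z) -> x = 0 by exact: ext_homog_range.
have pd z x : pr (z + 1) (dC x) = dC (pr z x) by exact: deltaC_projz.
have fE f h : fmr h f = fm f h by [].
have IP f : ideal_C J e f <-> iF f = 0 by exact: ideal_CE.
have evi a : ev (iq a) = iF (zz a) by exact: iota_q_eval.
have evd x : ev (dC x) = 0 by exact: deltaC_eval.
have e0K o : ev (e0 o) = o by exact: ext_eval0.
have e0d o : ext_homog 0 (e0 o) by exact: ext0_homog.
have e0e c : ext_homog 0 c -> e0 (ev c) = c by exact: ext0_eval.
have zs a b : A_ghost 0 a -> A_ghost 0 b -> zz (st a b) = fm (zz a) (zz b).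
  by move=> _; exact: zero_part_starS.
have z1 : zz (one_A X n) = one_F X by rewrite /zz /= /zero_part ffunE eqxx ffunE eqxx.
have nc a : A_ghost 0 a -> D a = 0 -> normalizer_C J e (zz a) by exact: brst_normalizer.
have nl f : normalizer_C J e f -> dC (e0 (iF f)) = 0.
  by move=> Nf; apply/normalizer_deltaC.
have nm f h : normalizer_C J e f -> ideal_C J e h -> ideal_C J e (fm f h - fm h f).
  by move=> Nf; exact: Nf.
have il f h : ideal_C J e h -> ideal_C J e (fm f h) by exact: ideal_C_left.
have gD a b : A_ghost 0 a -> A_ghost 0 b -> A_ghost 0 (a + b : A) by exact: A_ghostD.
have gZ (k : K) (a : A) : A_ghost 0 a -> A_ghost 0 (k *: a) by exact: A_ghostZ.
have iP o : invariants H o <-> dC (e0 o) = 0 by exact: invariantsP.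
have pag c : ext_homog 0 c -> A_ghost 0 (prol_A H c) by exact: prol_A_ghost.
have zl c : zz (brst_lift H c) = zz (prol_A H c) by exact: zero_part_lift.
split; last split; last split; last split.
- split; [exact: htpy_op0_bij|exact: htpy_op_bij|exact: htpy_op_hat_bij].
- split; first exact: brst_hat_homotopy.
  split; first by move=> a Da; split; [exact: (coh_closed_iota iD Da)|exact: (coh_psiE iD a)].
  split; first exact: (coh_psi_bij iD ce lP).
  split; first exact: (coh_psi_deg iD lP lg ig).
  split; first exact: (coh_psi_add iD).
  split; first exact: (coh_psi_scale iD).
  split; first exact: (coh_psiK dC2 iD ce hP).
  split; first exact: (coh_psi_invK dC2 iD ce hP).
  move=> c cc; split; first by case: (hP c cc).
    exact: (coh_psi_invE dC2 ce hP cc).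
  exact: (coh_hC_lift ce hP lP cc).
- split; first exact: (coh_graded_algebra D2 dC2 iD ce hP lP lg ig strE stA st1 stx1 Dd pK Dp D1 o0 sg pg pi po ps er pd).
  split; first exact: (coh_psi_mul st dC2 iD ce hP).
  exact: (coh_mulE_hC D2 dC2 iD ce hP strE Dd pK Dp).
- split.
    move=> a az Da; split; first exact: nc.
    exact: (coh_LE iD IP evi evd az).
  split; first exact: (coh_L_bij iD ce lP lg ig IP evi evd e0K e0d e0e nc nl).
  split; first exact: (coh_L_add iD IP evi evd gD).
  split; first exact: (coh_L_scale iD IP evi evd gZ).
  split; first exact: (coh_L_mul D2 iD strE Dd pK Dp sg fE IP evi evd zs nc nm il).
  exact: (coh_L1 iD o0 IP evi evd z1).
- split; first exact: (coh_inv_bij evd e0K e0d e0e iP).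
  exact: (coh_inv_mul D2 dC2 iD ce hP lP lg ig strE Dd pK Dp sg evi e0d e0e zs iP pag zl).
Qed.
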